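(* Let $p$ be a prime, let $K$ be an unramified extension of $\mathbb{Q}_p$ of degree $n$ with ring of integers $\mathcal{O}_K$ and residue field $k\cong\mathbb{F}_{p^n}$, and let $G$ be the Honda formal group law over $k$ of height $n$. Then in each $\star$-isomorphism class of lifts of $G$ to $\mathcal{O}_K$ there is a unique formal group law $F=F_\alpha$, necessarily a Lubin–Tate formal group law for some $\alpha\in\mathscr{F}_p$, satisfying $$ [p]_{F_\alpha}(T)=\prod_{\lambda\in\Lambda_{\alpha,1}}(T+_{F_\alpha}\lambda). $$
   Context: $X+_FY:=F(X,Y)$; $[p]_F$ is the $p$-series of $F$. The Honda formal group law $G$ of height $n$ satisfies $[p]_G(T)=T^{p^n}$. A lift of $G$ to $\mathcal{O}_K$ is a formal group law over $\mathcal{O}_K$ whose reduction modulo the maximal ideal is $G$. Two formal group laws $F,F'$ over $\mathcal{O}_K$ are $\star$-isomorphic if there is an isomorphism $u:F\to F'$ over $\mathcal{O}_K$ whose reduction to $k$ is the identity series $T$. With $q=p^n$ and uniformizer $p$, set $\mathscr{F}_p=\{\alpha(T)\in\mathcal{O}_K[[T]]:\alpha(T)\equiv pT \bmod T^2,\ \alpha(T)\equiv T^q\bmod p\}$. For $\alpha\in\mathscr{F}_p$, $F_\alpha$ denotes the Lubin–Tate formal group law, i.e. the unique formal group law over $\mathcal{O}_K$ with $\alpha\in\mathrm{End}(F_\alpha)$; one has $[p]_{F_\alpha}=\alpha$. Writing $\alpha=\tilde\alpha v$ with $v\in\mathcal{O}_K[[T]]$ a unit and $\tilde\alpha\in\mathcal{O}_K[T]$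 a polynomial as in the Weierstrass preparation theorem, $\Lambda_{\alpha,1}$ is the set of roots of $\tilde\alpha$ in a fixed algebraic closure of $K$. *)

(* Defs.v *)
From HB Require Import structures.
From mathcomp Require Import all_boot all_order all_algebra all_field.
From mathcomp.multinomials Require Import mpoly.

Set Implicit Arguments.
Unset Strict Implicit.
Unset Printing Implicit Defensive.

Import Order.TTheory GRing.Theory Num.Theory.

Local Open Scope ring_scope.

(* Rational-valued valuations, written additively.  The value at 0 is unconstrained:
   the convention v 0 = +oo is built into val_ge and val_gt below. *)
Record valuation (F : fieldType) := Valuation {
  valuation_fun :> F -> rat;
  valuationM : forall x y, x != 0 -> y != 0 ->
    valuation_fun (x * y) = valuation_fun x + valuation_fun y;
  valuationD : forall x y, x != 0 -> y != 0 -> x + y != 0 ->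
    Num.min (valuation_fun x) (valuation_fun y) <= valuation_fun (x + y) }.

Definition val_ge (F : fieldType) (v : valuation F) (r : rat) (x : F) : bool :=
  (x == 0) || (r <= v x).

Definition val_gt (F : fieldType) (v : valuation F) (r : rat) (x : F) : bool :=
  (x == 0) || (r < v x).

Definition val_integers (F : fieldType) (v : valuation F) : {pred F} :=
  [pred x | val_ge v 0 x].

Section ValuationRing.
Variables (F : fieldType) (v : valuation F).

Fact valuation1 : v 1 = 0.
Proof.
have := valuationM v (oner_neq0 F) (oner_neq0 F).
by rewrite mulr1 => /esym/eqP; rewrite -subr_eq0 addrK => /eqP.
Qed.

Fact valuationN x : x != 0 -> v (- x) = v x.
Proof.
move=> x0; have N10 : -1 != 0 :> F by rewrite oppr_eq0 oner_neq0.
have := valuationM v N10 N10; rewrite mulrNN mulr1 valuation1 => /esym/eqP.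
rewrite -mulr2n mulrn_eq0 /= => /eqP vN1.
by rewrite -mulN1r valuationM // vN1 add0r.
Qed.

Fact val_integers_subring : subring_closed (val_integers v).
Proof.
split; first by rewrite inE /val_ge valuation1 lexx orbT.
- move=> x y; rewrite !inE /val_ge.
  have [->|x0] := eqVneq x 0; have [->|y0] := eqVneq y 0 => //=.
  + by rewrite subr0 eqxx.
  + by rewrite sub0r oppr_eq0 (negPf y0) valuationN.
  + by rewrite subr0 (negPf x0).
  + have [//|xy0] := eqVneq (x - y) 0 => vx vy /=.
    have Ny0 : - y != 0 by rewrite oppr_eq0.
    apply: le_trans (valuationD v x0 Ny0 xy0).
    by rewrite le_min vx valuationN.
- move=> x y; rewrite !inE /val_ge mulf_eq0.
  have [//|x0] := eqVneq x 0; have [//|y0] := eqVneq y 0 => /= vx vy.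
  by rewrite valuationM // addr_ge0.
Qed.

Record val_ring := ValRing {
  val_ring_val : F;
  val_ring_valP : val_ring_val \in val_integers v }.

HB.instance Definition _ := [isSub for val_ring_val].
HB.instance Definition _ := [Choice of val_ring by <:].
HB.instance Definition _ :=
  GRing.SubChoice_isSubComNzRing.Build F (val_integers v) val_ring
    val_integers_subring.

End ValuationRing.

Definition val_extends (F E : fieldType) (f : F -> E)
    (v : valuation F) (w : valuation E) : Prop :=
  forall x, x != 0 -> w (f x) = v x.

Definition val_limit (F : fieldType) (v : valuation F) (u : nat -> F) (l : F) :=
  forall N : nat, exists M : nat, forall m, (M <= m)%N ->
    val_ge v N%:R (u m - l).

Definition val_cauchy (F : fieldType) (v : valuation F) (u : nat -> F) :=
  forall N : nat, exists M : nat, forall i j, (M <= i)%N -> (M <= j)%N ->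
    val_ge v N%:R (u i - u j).

(* The p-adic valuation of a nonzero rational number. *)
Definition padic_val (p : nat) (r : rat) : rat :=
  (logn p `|numq r|)%:R - (logn p `|denq r|)%:R.

(* (Qp, v) is the completion of rat for the p-adic valuation: a complete valued
   field of characteristic 0 in which rat, with its p-adic valuation, is dense.
   This determines (Qp, v) up to a unique isomorphism. *)
Definition is_Qp (p : nat) (Qp : fieldType) (v : valuation Qp) : Prop :=
  [/\ [pchar Qp] =i pred0,
      forall r : rat, r != 0 -> v (ratr r) = padic_val p r,
      forall (x : Qp) (N : nat), exists r : rat, val_ge v N%:R (x - ratr r)
    & forall u : nat -> Qp, val_cauchy v u -> exists l, val_limit v u l].

(* k is the residue field of the valuation ring of v, with reduction map red. *)
Definition is_reduction (F : fieldType) (v : valuation F) (k : nzRingType)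
    (red : val_ring v -> k) : Prop :=
  (forall y, exists x, red x = y) /\
  (forall x, (red x == 0) = val_gt v 0 (\val x)).

(* Ramification index 1; separability of the residue extension is automatic
   when the residue field is finite. *)
Definition unramified (F E : fieldType) (v : valuation F) (w : valuation E) :=
  forall x : E, x != 0 -> exists2 y : F, y != 0 & w x = v y.

Definition is_algebraic_closure (F : fieldType) (E : closedFieldType)
    (f : {rmorphism F -> E}) : Prop :=
  forall x : E, algebraicOver f x.

(* Formal power series in m variables, as families of coefficients.  Series are
   compared coefficientwise, with =1. *)
Definition series (R : Type) (m : nat) := 'X_{1..m} -> R.

Definition smap (R S : Type) (m : nat) (f : R -> S) (a : series R m) :
  series S m := fun k => f (a k).

Section Series.
Variable R : comNzRingType.

Definition strunc m (d : nat) (a : series R m) : {mpoly R[m]} :=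
  \sum_(k : 'X_{1..m < d.+1}) a k *: 'X_[k].

Definition sconst m (c : R) : series R m := fun k => c *+ (k == 0%MM).

Definition svar m (i : 'I_m) : series R m := fun k => (k == U_(i)%MM)%:R.

Definition sadd m (a b : series R m) : series R m := fun k => a k + b k.

(* The coefficients of degree at most d of a product only depend on the
   coefficients of degree at most d of its factors. *)
Definition smul m (a b : series R m) : series R m :=
  fun k => (strunc (mdeg k) a * strunc (mdeg k) b)@_k.

Definition sprod m (I : Type) (r : seq I) (a : I -> series R m) : series R m :=
  fun k => (\prod_(i <- r) strunc (mdeg k) (a i))@_k.

(* The composite a(b_1, ..., b_m).  It is the usual one only when the b_i have
   zero constant term; truncating at the degree of the coefficient being
   computed is then harmless. *)
Definition scomp m l (a : series R m) (b : m.-tuple (series R l)) : series R l :=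
  fun k => (strunc (mdeg k) a \mPo [tuple strunc (mdeg k) (tnth b i) | i < m])@_k.

Definition sT : series R 1 := svar ord0.

Definition coef1 (a : series R 1) (i : nat) : R := a [multinom i | _ < 1].

Definition coef2 (a : series R 2) (i j : nat) : R :=
  a [multinom [tuple i; j]].

Definition series1 (c : nat -> R) : series R 1 := fun k => c (k ord0).

(* One-dimensional commutative formal group laws. *)
Definition is_fgl (F : series R 2) : Prop :=
  [/\ scomp F [tuple sT; sconst 0] =1 sT,
      scomp F [tuple sconst 0; sT] =1 sT,
      (let X := svar (@Ordinal 3 0 isT) in
       let Y := svar (@Ordinal 3 1 isT) in
       let Z := svar (@Ordinal 3 2 isT) in
       scomp F [tuple scomp F [tuple X; Y]; Z]
         =1 scomp F [tuple X; scomp F [tuple Y; Z]])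
    & (let X := svar (@Ordinal 2 0 isT) in
       let Y := svar (@Ordinal 2 1 isT) in
       scomp F [tuple X; Y] =1 scomp F [tuple Y; X])].

Definition is_fgl_hom (F F' : series R 2) (u : series R 1) : Prop :=
  let X := svar (@Ordinal 2 0 isT) in
  let Y := svar (@Ordinal 2 1 isT) in
  u 0%MM = 0 /\
  scomp u [tuple F] =1 scomp F' [tuple scomp u [tuple X]; scomp u [tuple Y]].

Definition is_fgl_iso (F F' : series R 2) (u : series R 1) : Prop :=
  is_fgl_hom F F' u /\
  exists u', [/\ is_fgl_hom F' F u',
                 scomp u [tuple u'] =1 sT & scomp u' [tuple u] =1 sT].

(* The m-series [m]_F. *)
Fixpoint fgl_mul (F : series R 2) (m : nat) : series R 1 :=
  if m is m'.+1 then scomp F [tuple sT; fgl_mul F m'] else sconst 0.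

Definition is_sunit (a : series R 1) : Prop :=
  exists b, smul a b =1 sconst 1.

(* alpha is an endomorphism of the formal group law F. *)
Definition is_lubin_tate (alpha : series R 1) (F : series R 2) : Prop :=
  is_fgl F /\ is_fgl_hom F F alpha.

(* The set written \mathscr{F}_p, for the uniformizer p and q = p ^ n. *)
Definition frobenius_series (p q : nat) (alpha : series R 1) : Prop :=
  [/\ coef1 alpha 0 = 0, coef1 alpha 1 = p%:R
    & forall i, exists c : R, coef1 alpha i - (i == q)%:R = p%:R * c].

End Series.

(* The logarithm \sum_i T^(q^i) / p^i of the Honda formal group law. *)
Definition honda_log (K : fieldType) (p q : nat) : series K 1 :=
  series1 (fun m => let i := trunc_log q m in
                    if m == (q ^ i)%N then (p%:R ^+ i)^-1 else 0).

Section OverVal.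
Variables (K : fieldType) (v : valuation K).
Local Notation O := (val_ring v).

(* G is the reduction of the formal group law over O with the above logarithm,
   q = p ^ n; H is determined by its logarithm. *)
Definition is_honda (p n : nat) (k : comNzRingType) (red : O -> k)
    (G : series k 2) : Prop :=
  exists H : series O 2,
  [/\ is_fgl H,
      (let l := honda_log K p (p ^ n) in
       let X := svar K (@Ordinal 2 0 isT) in
       let Y := svar K (@Ordinal 2 1 isT) in
       scomp l [tuple smap \val H]
         =1 sadd (scomp l [tuple X]) (scomp l [tuple Y]))
    & smap red H =1 G].

Definition is_lift (k : comNzRingType) (red : O -> k) (G : series k 2)
    (F : series O 2) : Prop :=
  is_fgl F /\ smap red F =1 G.

Definition star_isomorphic (k : comNzRingType) (red : O -> k)
    (F F' : series O 2) : Prop :=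
  exists u, is_fgl_iso F F' u /\ smap red u =1 sT k.

Definition distinguished (P : {poly O}) : Prop :=
  P \is monic /\
  forall i, (i < (size P).-1)%N -> val_gt v 0 (\val P`_i).

Definition weierstrass_poly (alpha : series O 1) (P : {poly O}) : Prop :=
  distinguished P /\
  exists2 w, is_sunit w & alpha =1 smul (series1 (fun i => P`_i)) w.

Variables (Kbar : closedFieldType) (iota : {rmorphism K -> Kbar}).
Variable (w : valuation Kbar).

Definition emb (x : O) : Kbar := iota (\val x).

(* s enumerates without repetition the set Lambda_{alpha,1}. *)
Definition enum_Lambda (alpha : series O 1) (s : seq Kbar) : Prop :=
  uniq s /\
  exists2 P, weierstrass_poly alpha P & forall x, (x \in s) = root (map_poly emb P) x.

(* f is the series T +_F lambda = F(T, lambda): its i-th coefficient is the sum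
   of the convergent series of the F_{ij} lambda^j. *)
Definition is_translate (F : series O 2) (lambda : Kbar) (f : series Kbar 1) :=
  forall i, val_limit w
    (fun N => \sum_(j < N) emb (coef2 F i j) * lambda ^+ j) (coef1 f i).

(* The identity [p]_F(T) = \prod_(lambda in Lambda_{alpha,1}) (T +_F lambda). *)
Definition product_formula (p : nat) (alpha : series O 1) (F : series O 2) :=
  exists (s : seq Kbar) (f : Kbar -> series Kbar 1),
  [/\ enum_Lambda alpha s,
      forall lambda, lambda \in s -> is_translate F lambda (f lambda)
    & smap emb (fgl_mul F p) =1 sprod s f].

End OverVal.

(* Main.v *)
(* For every lift F of G, alpha = [p]_F is congruent to T^q mod p, hence lies in F_p
   and F is the Lubin-Tate formal group law of alpha.  Fix the lift F0, with a = [p]_F0,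
   whose zeros lam are simple.  Call M(u) the product of the u(F0(T, lam)) over all lam.
   For u = T mod p without constant term, M(u) = N(u)(a) for a series N(u) = T mod p
   (Coleman's norm): the u(F0(T, lam)) are the roots of the monic polynomial of degree q
   which u satisfies over the series in a.  As F0(T, lam) = T modulo the maximal ideal and
   p divides q, u = u' mod p^i implies N(u) = N(u') mod p^(i+1), so N has a unique fixed
   point u = T mod p.  Finally the lift u(F0(u^-1(X), u^-1(Y))), whose torsion points are
   the u(lam), satisfies the product formula iff M(u) = u(a), that is N(u) = u. *)

From HB Require Import structures.
From mathcomp Require Import all_boot all_order all_algebra all_field.
From mathcomp.multinomials Require Import mpoly.
From mathcomp Require Import boolp ring zify.
Require Import Defs.

Set Implicit Arguments.
Unset Strict Implicit.
Unset Printing Implicit Defensive.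

Import Order.TTheory GRing.Theory Num.Theory.
Local Open Scope ring_scope.

(** * The ring of formal power series *)

(** [Kbar] is not assumed complete, so F0(T, lam) is not built as a limit. The value of a series at
    a zero lam of the distinguished polynomial P is the value of its remainder modulo P. This makes
    evaluation a ring morphism by pure algebra, and limits reappear only when these values are
    compared with [is_translate]. The perturbation of the product gains only some positive valuation
    in [Kbar]. It becomes a full factor p because the norm has coefficients in the ring of integers
    of K, where the valuation is integral as K is unramified. The congruence [p]_F = T^q mod p is
    read off a logarithm l of the Honda law: l([p]) = p l, while p l = p T + l(T^q). The monic
    polynomial of u comes from expanding u^q along 1, u, ..., u^(q-1) with coefficients series in a.
    Such expansions are found by successive approximation from the evident case modulo p, where a =
    T^q and u = T. For u = T they give Weierstrass preparation and division; for general u they show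
    that lam is determined by u(lam). *)

Section Truncation.
Variables (R : comNzRingType) (m : nat).
Implicit Types (p q r : {mpoly R[m]}) (a b : series R m).

(** Congruence modulo terms of degree above d. Products and composites of series are defined through
    polynomials truncated at the degree in question, so the laws of series follow from those of
    polynomials once every operation respects this congruence. *)
Definition eqd (d : nat) p q := forall k, (mdeg k <= d)%N -> p@_k = q@_k.

Lemma eqd_sym d p q : eqd d p q -> eqd d q p.
Proof. by move=> h k /h. Qed.

Lemma eqd_trans d p q r : eqd d p q -> eqd d q r -> eqd d p r.
Proof. by move=> h1 h2 k kd; rewrite h1 ?h2. Qed.

Lemma eqdD d p p' q q' : eqd d p p' -> eqd d q q' -> eqd d (p + q) (p' + q').
Proof. by move=> h1 h2 k kd; rewrite !mcoeffD h1 ?h2. Qed.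

Lemma eqdZ d c p p' : eqd d p p' -> eqd d (c *: p) (c *: p').
Proof. by move=> h k kd; rewrite !mcoeffZ h. Qed.

Lemma eqdM d p p' q q' : eqd d p p' -> eqd d q q' -> eqd d (p * q) (p' * q').
Proof.
move=> h1 h2 k kd; rewrite !mcoeffM; apply: eq_bigr => -[k1 k2] /= /eqP kE.
have := bmdeg k1; have := bmdeg k2; rewrite !ltnS => k2k k1k.
by rewrite h1 ?h2 //; apply: leq_trans kd.
Qed.

Lemma eqd_sum d (I : Type) (r : seq I) (P : pred I) (f g : I -> {mpoly R[m]}) :
  (forall i, P i -> eqd d (f i) (g i)) ->
  eqd d (\sum_(i <- r | P i) f i) (\sum_(i <- r | P i) g i).
Proof.
by move=> h; elim/big_rec2: _ => // i y1 y2 Pi; apply: eqdD; apply: h.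
Qed.

Lemma eqd_prod d (I : Type) (r : seq I) (P : pred I) (f g : I -> {mpoly R[m]}) :
  (forall i, P i -> eqd d (f i) (g i)) ->
  eqd d (\prod_(i <- r | P i) f i) (\prod_(i <- r | P i) g i).
Proof.
by move=> h; elim/big_rec2: _ => // i y1 y2 Pi; apply: eqdM; apply: h.
Qed.

Lemma eqdX d p q n : eqd d p q -> eqd d (p ^+ n) (q ^+ n).
Proof.
by move=> h; elim: n => [//|n IH]; rewrite !exprS; apply: eqdM.
Qed.

Lemma coef_strunc d a k : (strunc d a)@_k = a k *+ (mdeg k <= d)%N.
Proof.
have [kd|kd] := leqP (mdeg k) d.
  by rewrite /strunc mcoeff_mpoly.
rewrite /strunc raddf_sum /= big1 // => i _; rewrite mcoeffZ mcoeffX.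
case: eqP => [ik|]; last by rewrite mulr0.
by have := bmdeg i; rewrite ik ltnS leqNgt kd.
Qed.

Lemma eqd_strunc d e a : (d <= e)%N -> eqd d (strunc e a) (strunc d a).
Proof. by move=> de k kd; rewrite !coef_strunc kd (leq_trans kd de). Qed.

Definition ordge e p := forall k, (mdeg k < e)%N -> p@_k = 0.

Lemma ordgeM d e p q : ordge d p -> ordge e q -> ordge (d + e) (p * q).
Proof.
move=> h1 h2 k kd; rewrite mcoeffM big1 // => -[k1 k2] /= /eqP kE.
have [k1d|k1d] := ltnP (mdeg k1) d; first by rewrite h1 ?mul0r.
rewrite h2 ?mulr0 //; rewrite kE mdegD in kd.
by rewrite -(ltn_add2l d); apply: leq_ltn_trans kd; rewrite leq_add2r.
Qed.

Lemma ordgeX p n : p@_0 = 0 -> ordge n (p ^+ n).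
Proof.
move=> p0; elim: n => [//|n IHn]; rewrite exprS -add1n; apply: ordgeM => //.
by move=> k; rewrite ltnS leqn0 mdeg_eq0 => /eqP->.
Qed.

Lemma ordge_prod (I : Type) (r : seq I) (f : I -> {mpoly R[m]}) (e : I -> nat) :
  (forall i, ordge (e i) (f i)) ->
  ordge (\sum_(i <- r) e i) (\prod_(i <- r) f i).
Proof.
move=> h; elim/big_rec2: _ => [//|i y1 y2 _ IH]; exact: ordgeM.
Qed.

End Truncation.

Section Composition.
Variables (R : comNzRingType) (m l : nat).
Implicit Types (p q : {mpoly R[m]}) (b : m.-tuple {mpoly R[l]}).

Lemma ordge_monomial b (k : 'X_{1..m}) : (forall i, (tnth b i)@_0 = 0) ->
  ordge (mdeg k) (\prod_(i < m) tnth b i ^+ k i).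
Proof. by move=> b0; rewrite mdegE; apply: ordge_prod => i; apply: ordgeX. Qed.

Lemma eqd_comp d p p' b b' : (forall i, (tnth b' i)@_0 = 0) ->
  eqd d p p' -> (forall i, eqd d (tnth b i) (tnth b' i)) ->
  eqd d (p \mPo b) (p' \mPo b').
Proof.
move=> b0 pp' bb'; set w := maxn (msize p) (msize p').
rewrite (@comp_mpolywE _ _ _ p b w) ?leq_maxl //.
rewrite (@comp_mpolywE _ _ _ p' b' w) ?leq_maxr //.
apply: eqd_sum => k _; apply: (@eqd_trans _ _ _ _ (p@_k *: \prod_(i < m) tnth b' i ^+ k i)).
  by apply/eqdZ/eqd_prod => i _; apply: eqdX.
(* Above degree d the coefficients of p and p' may differ, but the entries of b' have no constant
   term, so this monomial contributes nothing up to degree d. *)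
have [kd|kd] := leqP (mdeg k) d; first by rewrite pp'.
move=> j jd; rewrite !mcoeffZ (ordge_monomial (k := k) b0) ?mulr0 //.
exact: leq_ltn_trans kd.
Qed.

Lemma comp0_mpoly b p : (forall i, (tnth b i)@_0 = 0) -> (p \mPo b)@_0 = p@_0.
Proof.
move=> b0; have -> : p@_0 = (p@_0)%:MP_[l]@_0 by rewrite mcoeffC eqxx mulr1.
rewrite -(comp_mpolyC _ b); apply: (@eqd_comp 0); rewrite ?mdeg0 //.
by move=> k; rewrite leqn0 mdeg_eq0 => /eqP->; rewrite mcoeffC eqxx mulr1.
Qed.

End Composition.

Lemma comp_mpolyA (R : comNzRingType) m l r (p : {mpoly R[m]})
    (b : m.-tuple {mpoly R[l]}) (c : l.-tuple {mpoly R[r]}) :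
  (p \mPo b) \mPo c = p \mPo [tuple tnth b i \mPo c | i < m].
Proof.
rewrite [p]mpolyE (raddf_sum (comp_mpoly b)) (raddf_sum (comp_mpoly c)).
rewrite (raddf_sum (comp_mpoly _)); apply: eq_bigr => k _.
rewrite /= !comp_mpolyZ; congr (_ *: _); rewrite !comp_mpolyX rmorph_prod /=.
by apply: eq_bigr => i _; rewrite rmorphXn /= tnth_mktuple.
Qed.

(** Series are functions, so equality and choice come from classical logic. With functional
    extensionality the coefficientwise equality of the definitions becomes [=], and series enter the
    algebraic hierarchy as a ring. *)
HB.instance Definition _ (R : Type) m := gen_eqMixin (series R m).
HB.instance Definition _ (R : Type) m := gen_choiceMixin (series R m).

Section SeriesRing.
Variables (R : comNzRingType) (m : nat).
Implicit Types (a b c : series R m).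

Definition sopp a : series R m := fun k => - a k.
Definition szero : series R m := fun=> 0.

Fact saddA : associative (@sadd R m).
Proof. by move=> a b c; apply/funext => k; rewrite /sadd addrA. Qed.
Fact saddC : commutative (@sadd R m).
Proof. by move=> a b; apply/funext => k; rewrite /sadd addrC. Qed.
Fact sadd0 : left_id szero (@sadd R m).
Proof. by move=> a; apply/funext => k; rewrite /sadd add0r. Qed.
Fact saddN : left_inverse szero sopp (@sadd R m).
Proof. by move=> a; apply/funext => k; rewrite /sadd addNr. Qed.

HB.instance Definition _ :=
  GRing.isZmodule.Build (series R m) saddA saddC sadd0 saddN.

Lemma smulE d a b k : (mdeg k <= d)%N ->
  smul a b k = (strunc d a * strunc d b)@_k.
Proof.
by move=> kd; apply: (@eqdM _ _ (mdeg k)) => //; apply/eqd_sym/eqd_strunc.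
Qed.

Lemma eqd_strunc_mul d a b :
  eqd d (strunc d (smul a b)) (strunc d a * strunc d b).
Proof. by move=> k kd; rewrite coef_strunc kd (smulE _ _ kd). Qed.

Lemma eqd_strunc_const d (c : R) : eqd d (strunc d (@sconst R m c)) c%:MP.
Proof.
by move=> k kd; rewrite coef_strunc kd /sconst mcoeffC eq_sym; case: eqP; rewrite ?mulr1 ?mulr0.
Qed.

Fact smulA : associative (@smul R m).
Proof.
move=> a b c; apply/funext => k; rewrite !(smulE _ _ (leqnn _)).
transitivity ((strunc (mdeg k) a * strunc (mdeg k) b * strunc (mdeg k) c)@_k).
  rewrite -mulrA; apply: (@eqdM _ _ (mdeg k)) => //.
  exact: eqd_strunc_mul.
by symmetry; apply: (@eqdM _ _ (mdeg k)) => //; apply: eqd_strunc_mul.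
Qed.
Fact smulC : commutative (@smul R m).
Proof. by move=> a b; apply/funext => k; rewrite /smul mulrC. Qed.
Fact smul1 : left_id (@sconst R m 1) (@smul R m).
Proof.
move=> a; apply/funext => k; rewrite /smul.
transitivity ((1%:MP * strunc (mdeg k) a)@_k).
  by apply: (@eqdM _ _ (mdeg k)) => //; apply: eqd_strunc_const.
by rewrite mcoeffCM mul1r coef_strunc leqnn.
Qed.
Fact strunc_add d a b : strunc d (sadd a b) = strunc d a + strunc d b.
Proof.
by apply/mpolyP => k; rewrite mcoeffD !coef_strunc /sadd mulrnDl.
Qed.
Fact smulDl : left_distributive (@smul R m) (@sadd R m).
Proof.
by move=> a b c; apply/funext => k; rewrite /smul strunc_add mulrDl mcoeffD.
Qed.
Fact sone_neq0 : @sconst R m 1 != 0.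
Proof.
apply/eqP => /(congr1 (fun f : series R m => f 0%MM)) /eqP.
by rewrite /sconst eqxx oner_eq0.
Qed.

HB.instance Definition _ :=
  GRing.Zmodule_isComNzRing.Build (series R m) smulA smulC smul1 smulDl sone_neq0.

Lemma sD a b k : (a + b) k = a k + b k. Proof. by []. Qed.
Lemma s1 k : (1 : series R m) k = (k == 0%MM)%:R. Proof. by []. Qed.
Lemma sB a b k : (a - b) k = a k - b k. Proof. by []. Qed.
Lemma s_sum (I : Type) (r : seq I) (P : pred I) (f : I -> series R m) k :
  (\sum_(i <- r | P i) f i) k = \sum_(i <- r | P i) f i k.
Proof. by elim/big_rec2: _ => // i y1 y2 _ <-. Qed.

Lemma sM d a b k : (mdeg k <= d)%N ->
  (a * b) k = (strunc d a * strunc d b)@_k.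
Proof. exact: smulE. Qed.

Lemma strunc_mul d a b : eqd d (strunc d (a * b)) (strunc d a * strunc d b).
Proof. exact: eqd_strunc_mul. Qed.

Lemma strunc1 d : eqd d (strunc d (1 : series R m)) 1.
Proof. by move=> k kd; rewrite eqd_strunc_const. Qed.

Lemma strunc_prod d (I : Type) (r : seq I) (f : I -> series R m) :
  eqd d (strunc d (\prod_(i <- r) f i)) (\prod_(i <- r) strunc d (f i)).
Proof.
elim/big_rec2: _ => [|i y1 y2 _ IH]; first exact: strunc1.
by apply: eqd_trans (@strunc_mul _ _ _) _; apply: eqdM.
Qed.

Lemma sprodE (I : Type) (r : seq I) (f : I -> series R m) :
  sprod r f = \prod_(i <- r) f i.
Proof.
by apply/funext => k; rewrite /sprod -strunc_prod ?coef_strunc leqnn.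
Qed.

Lemma sMconv a b k : (a * b) k =
  \sum_(j : 'X_{1..m < (mdeg k).+1, (mdeg k).+1} | k == (j.1 + j.2)%MM)
     a j.1 * b j.2.
Proof.
rewrite (sM _ _ (leqnn _)) mcoeffM; apply: eq_bigr => -[j1 j2] _ /=.
by rewrite !coef_strunc -![(mdeg _ <= _)%N]ltnS !bmdeg.
Qed.

Lemma sM0 a b : (a * b) 0%MM = a 0%MM * b 0%MM.
Proof.
have -> : (a * b) 0%MM = (strunc 0 a * strunc 0 b)@_0 by apply: sM; rewrite mdeg0.
by rewrite rmorphM /= !coef_strunc mdeg0.
Qed.

Lemma sX0 a n : (a ^+ n) 0%MM = a 0%MM ^+ n.
Proof.
by elim: n => [|n IH]; rewrite ?expr0 ?exprS ?sM0 ?IH // s1 eqxx.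
Qed.

Fact sconst_is_zmod_morphism : zmod_morphism (@sconst R m).
Proof. by move=> x y; apply/funext => k; rewrite sB /sconst mulrnBl. Qed.
Fact sconst_is_monoid_morphism : monoid_morphism (@sconst R m).
Proof.
split=> // x y; apply/funext => k; rewrite (sM _ _ (leqnn _)).
transitivity ((x%:MP * y%:MP : {mpoly R[m]})@_k).
  by rewrite -mpolyCM /sconst mcoeffC eq_sym; case: eqP; rewrite ?mulr1 ?mulr0.
by symmetry; apply: (@eqdM _ _ (mdeg k)) => //; apply: eqd_strunc_const.
Qed.
HB.instance Definition _ :=
  GRing.isZmodMorphism.Build R (series R m) (@sconst R m) sconst_is_zmod_morphism.
HB.instance Definition _ :=
  GRing.isMonoidMorphism.Build R (series R m) (@sconst R m) sconst_is_monoid_morphism.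

Lemma sconstM (c : R) a k : (@sconst R m c * a) k = c * a k.
Proof.
rewrite (sM _ _ (leqnn _)).
transitivity ((c%:MP * strunc (mdeg k) a)@_k).
  by apply: (@eqdM _ _ (mdeg k)) => //; apply: eqd_strunc_const.
by rewrite mcoeffCM coef_strunc leqnn.
Qed.

Lemma natsM n a k : (n%:R * a) k = n%:R * a k.
Proof. by rewrite -sconstM rmorph_nat. Qed.

Lemma svarM i a k :
  (svar R i * a) k = if k i == 0%N then 0 else a (k - U_(i))%MM.
Proof.
rewrite (sM _ _ (leqnn _)).
have -> : ((strunc (mdeg k) (svar R i)) * strunc (mdeg k) a)@_k =
  ('X_i * strunc (mdeg k) a)@_k.
  apply: (@eqdM _ _ (mdeg k)) => // j jk.
  by rewrite coef_strunc jk /svar mcoeffX eq_sym.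
rewrite mulrC; case: (eqVneq (k i)) => [ki0|ki0].
  rewrite mcoeffM big1 // => -[j1 j2] /= /eqP kE; rewrite mcoeffX.
  case: eqP => [j2E|]; last by rewrite mulr0.
  by move/mnmP/(_ i): kE; rewrite ki0 -j2E mnmDE mnm1E eqxx addn1.
have {1}-> : k = (U_(i) + (k - U_(i)))%MM.
  rewrite addmC submK //; apply/mnm_lepP => j; rewrite mnm1E.
  by case: eqP => [<-|//]; rewrite lt0n.
rewrite mcoeffMX coef_strunc; case: leqP => //.
rewrite ltnNge => /negP[]; rewrite !mdegE; apply: leq_sum => j _.
by rewrite mnmBE leq_subr.
Qed.

End SeriesRing.

(** * Substitution of series without constant term *)

Section Substitution.
Variables (R : comNzRingType) (m l : nat).
Implicit Types (a c : series R m) (b : m.-tuple (series R l)).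

Definition zconst b := forall i, tnth b i 0%MM = 0.

Lemma scompE d a b k : zconst b -> (mdeg k <= d)%N ->
  scomp a b k = (strunc d a \mPo [tuple strunc d (tnth b i) | i < m])@_k.
Proof.
move=> b0 kd; apply: (@eqd_comp _ _ _ (mdeg k)) => //.
- by move=> i; rewrite tnth_mktuple coef_strunc b0 mul0rn.
- exact/eqd_sym/eqd_strunc.
- by move=> i; rewrite !tnth_mktuple; exact/eqd_sym/eqd_strunc.
Qed.

Lemma strunc_comp d a b : zconst b ->
  eqd d (strunc d (scomp a b)) (strunc d a \mPo [tuple strunc d (tnth b i) | i < m]).
Proof. by move=> b0 k kd; rewrite coef_strunc kd (scompE _ b0 kd). Qed.

Lemma scomp0 a b : zconst b -> scomp a b 0%MM = a 0%MM.
Proof.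
move=> b0; rewrite /scomp comp0_mpoly ?coef_strunc ?mdeg0 // => i.
by rewrite tnth_mktuple coef_strunc b0 mul0rn.
Qed.

End Substitution.

Section SubstitutionMorphism.
Variables (R : comNzRingType) (m l : nat).
Implicit Types (a : series R m).

(** The proof of [zconst b] is kept as an argument so that a ring morphism structure can be attached
    to the function: multiplicativity relies on zero constant terms. *)
Definition subst (b : m.-tuple (series R l)) (_ : zconst b) :=
  fun a => scomp a b.

Variables (b : m.-tuple (series R l)) (b0 : zconst b).

Let trb d := [tuple strunc d (tnth b i) | i < m].

Let trb0 d i : (tnth (trb d) i)@_0 = 0.
Proof. by rewrite tnth_mktuple coef_strunc b0 mul0rn. Qed.

Fact subst_is_zmod_morphism : zmod_morphism (subst b0).
Proof.
move=> x y; apply/funext => k; rewrite sB /subst /scomp -mcoeffB -comp_mpolyB.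
congr (_@__); congr (_ \mPo _); apply/mpolyP => j.
by rewrite mcoeffB !coef_strunc sB mulrnBl.
Qed.
Fact subst_is_monoid_morphism : monoid_morphism (subst b0).
Proof.
split=> [|x y]; apply/funext => k; rewrite /subst /scomp.
  transitivity ((1 \mPo trb (mdeg k))@_k); last by rewrite comp_mpoly1 mcoeff1.
  by apply: (@eqd_comp _ _ _ (mdeg k)) => //; apply: strunc1.
transitivity (((strunc (mdeg k) x * strunc (mdeg k) y) \mPo trb (mdeg k))@_k).
  by apply: (@eqd_comp _ _ _ (mdeg k)) => //; apply: strunc_mul.
rewrite rmorphM /= (sM _ _ (leqnn _)).
by apply: (@eqdM _ _ (mdeg k)) => //; apply/eqd_sym/strunc_comp.
Qed.
HB.instance Definition _ := GRing.isZmodMorphism.Build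
  (series R m) (series R l) (subst b0) subst_is_zmod_morphism.
HB.instance Definition _ := GRing.isMonoidMorphism.Build
  (series R m) (series R l) (subst b0) subst_is_monoid_morphism.

Lemma scompD x y : scomp (x + y) b = scomp x b + scomp y b.
Proof. exact: (rmorphD (subst b0)). Qed.
Lemma scompB x y : scomp (x - y) b = scomp x b - scomp y b.
Proof. exact: (rmorphB (subst b0)). Qed.
Lemma scompM x y : scomp (x * y) b = scomp x b * scomp y b.
Proof. exact: (rmorphM (subst b0)). Qed.
Lemma scompX x n : scomp (x ^+ n) b = scomp x b ^+ n.
Proof. exact: (rmorphXn (subst b0)). Qed.
Lemma scomp1 : scomp 1 b = 1.
Proof. exact: (rmorph1 (subst b0)). Qed.
Lemma scomp_zero : scomp 0 b = 0.
Proof. exact: (rmorph0 (subst b0)). Qed.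
Lemma scomp_nat n : scomp n%:R b = n%:R.
Proof. exact: (rmorph_nat (subst b0)). Qed.
Lemma scomp_sum (I : Type) (r : seq I) (P : pred I) f :
  scomp (\sum_(i <- r | P i) f i) b = \sum_(i <- r | P i) scomp (f i) b.
Proof. exact: (rmorph_sum (subst b0)). Qed.

Lemma scomp_const (c : R) : scomp (sconst c) b = sconst c.
Proof.
apply/funext => k; rewrite /scomp.
transitivity ((c%:MP \mPo trb (mdeg k))@_k).
  by apply: (@eqd_comp _ _ _ (mdeg k)) => //; apply: eqd_strunc_const.
by rewrite comp_mpolyC mcoeffC /sconst eq_sym; case: eqP; rewrite ?mulr1 ?mulr0.
Qed.

Lemma scomp_var i : scomp (svar R i) b = tnth b i.
Proof.
apply/funext => k; rewrite /scomp.
transitivity (('X_i \mPo trb (mdeg k))@_k).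
  apply: (@eqd_comp _ _ _ (mdeg k)) => // j jk.
  by rewrite coef_strunc jk /svar mcoeffX eq_sym.
by rewrite comp_mpolyXU -tnth_nth tnth_mktuple coef_strunc leqnn.
Qed.

Lemma scompA r (a : series R r) (c : r.-tuple (series R m)) : zconst c ->
  scomp (scomp a c) b = scomp a [tuple scomp (tnth c i) b | i < r].
Proof.
move=> c0; have cb0 : zconst [tuple scomp (tnth c i) b | i < r].
  by move=> i; rewrite tnth_mktuple scomp0.
apply/funext => k; rewrite (scompE _ cb0 (leqnn _)) (scompE _ b0 (leqnn _)).
transitivity (((strunc (mdeg k) a \mPo [tuple strunc (mdeg k) (tnth c i) | i < r])
  \mPo trb (mdeg k))@_k).
  by apply: (@eqd_comp _ _ _ (mdeg k)) => //; apply: strunc_comp.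
rewrite comp_mpolyA; apply/esym/(@eqd_comp _ _ _ (mdeg k)) => // i.
  by rewrite !tnth_mktuple comp0_mpoly // coef_strunc c0 mul0rn.
by rewrite !tnth_mktuple; exact: strunc_comp.
Qed.

End SubstitutionMorphism.

Lemma scomp_id (R : comNzRingType) m (a : series R m) :
  scomp a [tuple svar R i | i < m] = a.
Proof.
have v0 : zconst [tuple svar R i | i < m].
  by move=> i; rewrite tnth_mktuple /svar eq_sym mnm1_eq0.
apply/funext => k; rewrite /scomp.
transitivity ((strunc (mdeg k) a \mPo [tuple 'X_i | i < m])@_k).
  apply: (@eqd_comp _ _ _ (mdeg k)) => // i; rewrite !tnth_mktuple.
    by rewrite mcoeffX mnm1_eq0.
  by move=> j jk; rewrite coef_strunc jk mcoeffX /svar eq_sym.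
by rewrite comp_mpoly_id coef_strunc leqnn.
Qed.

(** * Change of coefficient ring *)

Section Map.
Variables (R S : comNzRingType) (f : {rmorphism R -> S}).

Lemma strunc_map m d (a : series R m) :
  strunc d (smap f a) = map_mpoly f (strunc d a).
Proof.
apply/mpolyP => k; rewrite mcoeff_map_mpoly !coef_strunc /smap.
by rewrite raddfMn.
Qed.

Section Hom.
Variable m : nat.
Fact smap_is_zmod_morphism : zmod_morphism (@smap R S m f).
Proof. by move=> x y; apply/funext => k; rewrite /smap !sB rmorphB. Qed.
Fact smap_is_monoid_morphism : monoid_morphism (@smap R S m f).
Proof.
split=> [|x y]; apply/funext => k; rewrite /smap.
  by rewrite !s1 rmorph_nat.
rewrite !(sM _ _ (leqnn _)) !strunc_map -rmorphM.
by rewrite mcoeff_map_mpoly.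
Qed.
HB.instance Definition _ := GRing.isZmodMorphism.Build
  (series R m) (series S m) (@smap R S m f) smap_is_zmod_morphism.
HB.instance Definition _ := GRing.isMonoidMorphism.Build
  (series R m) (series S m) (@smap R S m f) smap_is_monoid_morphism.

Lemma smap_const (c : R) : smap f (sconst c) = sconst (f c) :> series S m.
Proof. by apply/funext => k; rewrite /smap /sconst rmorphMn. Qed.
Lemma smap_var i : smap f (svar R i) = svar S i :> series S m.
Proof. by apply/funext => k; rewrite /smap /svar rmorph_nat. Qed.
End Hom.

Lemma smap_comp m l (a : series R m) (b : m.-tuple (series R l)) :
  smap f (scomp a b) = scomp (smap f a) [tuple smap f (tnth b i) | i < m].
Proof.
apply/funext => k; rewrite /smap /scomp strunc_map -mcoeff_map_mpoly.
congr (_@__); set p := strunc _ a; set d := mdeg k.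
rewrite comp_mpolyE (raddf_sum (map_mpoly f)) [in RHS](mpolyE p).
rewrite (raddf_sum (map_mpoly f)) (raddf_sum (comp_mpoly _)).
apply: eq_bigr => j _ /=.
rewrite !map_mpolyZ !comp_mpolyZ; congr (_ *: _).
rewrite map_mpolyX !comp_mpolyX rmorph_prod /=; apply: eq_bigr => i _.
by rewrite rmorphXn /= !tnth_mktuple strunc_map.
Qed.

End Map.

(* Locked, so that rewriting never unfolds a composite while matching. *)
HB.lock Definition comp1 (R : comNzRingType) l (a : series R 1) (b : series R l) :
  series R l := scomp a [tuple b].
HB.lock Definition comp2 (R : comNzRingType) l (a : series R 2) (b c : series R l) :
  series R l := scomp a [tuple b; c].

Lemma comp1_scomp (R : comNzRingType) l (a : series R 1) (b : series R l) :
  comp1 a b = scomp a [tuple b].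
Proof. by rewrite unlock. Qed.
Lemma comp2_scomp (R : comNzRingType) l (a : series R 2) (b c : series R l) :
  comp2 a b c = scomp a [tuple b; c].
Proof. by rewrite unlock. Qed.

Definition compE := (comp1_scomp, comp2_scomp).

Lemma sordgeM (R : comNzRingType) m d e (a b : series R m) :
  (forall k, (mdeg k < d)%N -> a k = 0) -> (forall k, (mdeg k < e)%N -> b k = 0) ->
  forall k, (mdeg k < d + e)%N -> (a * b) k = 0.
Proof.
move=> h1 h2 k kd; rewrite (sM _ _ (leqnn _)).
apply: (@ordgeM _ _ d e) kd => j jd; rewrite coef_strunc ?h1 ?h2 ?mul0rn //.
Qed.

Lemma sordgeX (R : comNzRingType) m n (b : series R m) : b 0%MM = 0 ->
  forall k, (mdeg k < n)%N -> (b ^+ n) k = 0.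
Proof.
move=> b0; elim: n => [//|n IH]; rewrite exprS -add1n; apply: sordgeM => // k.
by rewrite ltnS leqn0 mdeg_eq0 => /eqP->.
Qed.

(** * Series in one and two variables *)

Section Univariate.
Variable R : comNzRingType.
Implicit Types (a b c : series R 1).
Local Notation T := (sT R).

Lemma mnm1_ord0 (k : 'X_{1..1}) : [multinom k ord0 | _ < 1] = k.
Proof. by apply/mnmP => i; rewrite mnmE (ord1 i). Qed.

Lemma mdeg_mnm1 n : mdeg [multinom n | _ < 1] = n.
Proof. by rewrite mdegE big_ord1 mnmE. Qed.

Lemma mnm1_0 : [multinom 0%N | _ < 1] = 0%MM.
Proof. by apply/mnmP => i; rewrite !mnmE. Qed.

Lemma coef1_0 a : coef1 a 0 = a 0%MM.
Proof. by rewrite /coef1 mnm1_0. Qed.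

Lemma s1P a b : coef1 a =1 coef1 b -> a = b.
Proof.
by move=> h; apply/funext => k; rewrite -(mnm1_ord0 k); apply: h.
Qed.

Lemma coef1_series1 (f : nat -> R) n : coef1 (series1 f) n = f n.
Proof. by rewrite /coef1 /series1 mnmE. Qed.

Lemma coef1D a b n : coef1 (a + b) n = coef1 a n + coef1 b n. Proof. by []. Qed.
Lemma coef1B a b n : coef1 (a - b) n = coef1 a n - coef1 b n. Proof. by []. Qed.
Lemma coef1z n : coef1 (0 : series R 1) n = 0. Proof. by []. Qed.
Lemma coef1_sum (I : Type) (r : seq I) (P : pred I) (f : I -> series R 1) n :
  coef1 (\sum_(i <- r | P i) f i) n = \sum_(i <- r | P i) coef1 (f i) n.
Proof. exact: s_sum. Qed.
Lemma coef1_const (x : R) n : coef1 (sconst x) n = x *+ (n == 0%N).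
Proof. by rewrite /coef1 /sconst -mdeg_eq0 mdeg_mnm1. Qed.
Lemma coef1_one n : coef1 (1 : series R 1) n = (n == 0%N)%:R.
Proof. exact: coef1_const. Qed.
Lemma coef1CM (x : R) a n : coef1 (sconst x * a) n = x * coef1 a n.
Proof. exact: sconstM. Qed.

Lemma coef1XM a n : coef1 (T * a) n = if n is n'.+1 then coef1 a n' else 0.
Proof.
rewrite /coef1 /sT svarM mnmE; case: n => [//|n] /=.
by congr a; apply/mnmP => i; rewrite mnmBE mnm1E !mnmE (ord1 i) eqxx subn1.
Qed.

Lemma coef1XnM a e n :
  coef1 (T ^+ e * a) n = if (n < e)%N then 0 else coef1 a (n - e).
Proof.
elim: e n => [|e IH] n; first by rewrite mul1r subn0.
by rewrite exprS -mulrA coef1XM; case: n => [|n] //; rewrite IH ltnS subSS.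
Qed.

Lemma coef1Xn e n : coef1 (T ^+ e) n = (n == e)%:R.
Proof.
rewrite -[T ^+ e]mulr1 coef1XnM coef1_one; case: ltngtP => [//|en|->].
  by rewrite subn_eq0 leqNgt en.
by rewrite subnn.
Qed.

Lemma coef1X n : coef1 T n = (n == 1%N)%:R.
Proof. by rewrite -[T]expr1 coef1Xn. Qed.

Definition sshift e a : series R 1 := series1 (fun n => coef1 a (e + n)).

Lemma coef1_shift e a n : coef1 (sshift e a) n = coef1 a (e + n).
Proof. exact: coef1_series1. Qed.

Lemma s1_split a e :
  a = \sum_(i < e) sconst (coef1 a i) * T ^+ i + T ^+ e * sshift e a.
Proof.
apply: s1P => n; rewrite coef1D coef1_sum coef1XnM coef1_shift.
under eq_bigr do rewrite coef1CM coef1Xn.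
case: ltnP => ne.
  rewrite (bigD1 (Ordinal ne)) //= eqxx mulr1 big1 ?addr0 // => i.
  by rewrite -val_eqE /= eq_sym => /negPf->; rewrite mulr0.
rewrite big1 ?add0r ?subnKC // => i _; case: eqP => [ni|]; last by rewrite mulr0.
by have := ltn_ord i; rewrite -ni ltnNge ne.
Qed.

Lemma s1_split1 a : a = sconst (coef1 a 0) + T * sshift 1 a.
Proof. by rewrite {1}[a](s1_split _ 1) big_ord1 expr0 mulr1 expr1. Qed.

Lemma coef1M a b n :
  coef1 (a * b) n = \sum_(i < n.+1) coef1 a i * coef1 b (n - i).
Proof.
elim: n a => [|n IH] a; rewrite {1}[a]s1_split1 mulrDl coef1D coef1CM -mulrA coef1XM.
  by rewrite big_ord1 addr0.
rewrite IH [in RHS]big_ord_recl subn0; congr (_ + _); apply: eq_bigr => i _.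
by rewrite coef1_shift subSS.
Qed.

Lemma zconst1 l (b : series R l) : b 0%MM = 0 -> zconst [tuple b].
Proof. by move=> b0 i; rewrite ord1. Qed.

Section Comp1.
Variables (l : nat) (b : series R l) (b0 : b 0%MM = 0).
Let zb := zconst1 b0.

Lemma comp1D a c : comp1 (a + c) b = comp1 a b + comp1 c b.
Proof. by rewrite !compE scompD. Qed.
Lemma comp1B a c : comp1 (a - c) b = comp1 a b - comp1 c b.
Proof. by rewrite !compE scompB. Qed.
Lemma comp1M a c : comp1 (a * c) b = comp1 a b * comp1 c b.
Proof. by rewrite !compE scompM. Qed.
Lemma comp1Xn a n : comp1 (a ^+ n) b = comp1 a b ^+ n.
Proof. by rewrite !compE scompX. Qed.
Lemma comp1_1 : comp1 1 b = 1.
Proof. by rewrite !compE scomp1. Qed.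
Lemma comp1_0 : comp1 0 b = 0.
Proof. by rewrite !compE scomp_zero. Qed.
Lemma comp1_nat n : comp1 n%:R b = n%:R.
Proof. by rewrite !compE scomp_nat. Qed.
Lemma comp1_sum (I : Type) (r : seq I) (P : pred I) f :
  comp1 (\sum_(i <- r | P i) f i) b = \sum_(i <- r | P i) comp1 (f i) b.
Proof. rewrite compE scomp_sum //; by apply: eq_bigr => i _; rewrite compE. Qed.
Lemma comp1_const (x : R) : comp1 (sconst x) b = sconst x.
Proof. by rewrite !compE scomp_const. Qed.
Lemma comp1_sT : comp1 T b = b.
Proof. rewrite compE; exact: scomp_var. Qed.
Lemma comp1_zc a : comp1 a b 0%MM = a 0%MM.
Proof. by rewrite !compE scomp0. Qed.

(** Replaces the infinite composite by e terms and a tail divisible by b^e. Coefficients ([comp1E])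
    and values at torsion points ([ev_comp_split]) are both computed from it. *)
Lemma comp1_split a e :
  comp1 a b = \sum_(i < e) sconst (coef1 a i) * b ^+ i + b ^+ e * comp1 (sshift e a) b.
Proof.
rewrite {1}[a](s1_split _ e) comp1D comp1M comp1Xn comp1_sT comp1_sum.
congr (_ + _); apply: eq_bigr => i _.
by rewrite comp1M comp1_const comp1Xn comp1_sT.
Qed.

Lemma comp1E a k e : (mdeg k < e)%N ->
  comp1 a b k = \sum_(i < e) coef1 a i * (b ^+ i) k.
Proof.
move=> ke; rewrite (comp1_split a e) sD s_sum.
rewrite [X in _ + X](@sordgeM _ _ e 0) ?addr0 ?addn0 //; last exact: sordgeX.
by apply: eq_bigr => i _; rewrite sconstM.
Qed.

Lemma comp1A a c : c 0%MM = 0 -> comp1 (comp1 a c) b = comp1 a (comp1 c b).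
Proof.
move=> /zconst1 c0; rewrite !compE scompA //.
by congr scomp; apply: eq_from_tnth => i; rewrite tnth_mktuple !ord1.
Qed.
End Comp1.

Lemma comp1_id a : comp1 a T = a.
Proof.
rewrite compE -[RHS]scomp_id; congr scomp; apply: eq_from_tnth => i.
by rewrite tnth_mktuple ord1.
Qed.

Lemma comp1_z l a : a 0%MM = 0 -> comp1 a (0 : series R l) = 0.
Proof.
move=> a0; apply/funext => k; rewrite (@comp1E _ _ _ _ _ (mdeg k).+1) //.
rewrite big_ord_recl coef1_0 a0 mul0r add0r big1 // => i _.
by rewrite expr0n; exact: mulr0.
Qed.

End Univariate.

Section Bivariate.
Variable R : comNzRingType.
Implicit Types (H K : series R 2) (f g : series R 1).
Local Notation T := (sT R).
Local Notation X := (svar R (@Ordinal 2 0 isT)).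
Local Notation Y := (svar R (@Ordinal 2 1 isT)).

Lemma mnm2P (k k' : 'X_{1..2}) :
  k (@Ordinal 2 0 isT) = k' (@Ordinal 2 0 isT) ->
  k (@Ordinal 2 1 isT) = k' (@Ordinal 2 1 isT) -> k = k'.
Proof.
move=> h0 h1; apply/mnmP => -[[|[|//]] hi].
  by rewrite (_ : Ordinal hi = @Ordinal 2 0 isT) //; apply: val_inj.
by rewrite (_ : Ordinal hi = @Ordinal 2 1 isT) //; apply: val_inj.
Qed.

Lemma mdeg_mnm2 i j : mdeg ([multinom [tuple i; j]] : 'X_{1..2}) = (i + j)%N.
Proof. by rewrite mdegE !big_ord_recl big_ord0 addn0; congr addn. Qed.

Lemma s2P H K : (forall i j, coef2 H i j = coef2 K i j) -> H = K.
Proof.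
move=> h; apply/funext => k.
have -> : k = [multinom [tuple k (@Ordinal 2 0 isT); k (@Ordinal 2 1 isT)]].
  exact: mnm2P.
exact: h.
Qed.

Lemma coef2XM H i j : coef2 (X * H) i j = if i is i'.+1 then coef2 H i' j else 0.
Proof.
rewrite /coef2 svarM; case: i => [//|i] /=.
by congr H; apply: mnm2P; rewrite mnmBE mnm1E /= ?subn1 ?subn0.
Qed.

Lemma coef2YM H i j : coef2 (Y * H) i j = if j is j'.+1 then coef2 H i j' else 0.
Proof.
rewrite /coef2 svarM; case: j => [//|j] /=.
by congr H; apply: mnm2P; rewrite mnmBE mnm1E /= ?subn1 ?subn0.
Qed.

Lemma coef2CM (x : R) H i j : coef2 (sconst x * H) i j = x * coef2 H i j.
Proof. exact: sconstM. Qed.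

Lemma coef2_const (x : R) i j : coef2 (sconst x) i j = x *+ ((i == 0) && (j == 0))%N.
Proof.
by rewrite /coef2 /sconst -mdeg_eq0 mdeg_mnm2 addn_eq0.
Qed.

Lemma svar0 m i : svar R i (0%MM : 'X_{1..m}) = 0.
Proof. by rewrite /svar eq_sym mnm1_eq0. Qed.

Definition inX f := comp1 f X.
Definition inY f := comp1 f Y.

Lemma inY_split f : inY f = sconst (coef1 f 0) + Y * inY (sshift 1 f).
Proof.
by rewrite /inY (comp1_split _ _ 1) ?svar0 // big_ord1 expr0 mulr1 expr1.
Qed.

Lemma inX_split f : inX f = sconst (coef1 f 0) + X * inX (sshift 1 f).
Proof.
by rewrite /inX (comp1_split _ _ 1) ?svar0 // big_ord1 expr0 mulr1 expr1.
Qed.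

(** The coefficient of X^i in H, as a series in Y renamed T. Evaluation at Y = lam will act on each
    row separately. *)
Definition row i H : series R 1 := series1 (coef2 H i).

Lemma coef1_row i H j : coef1 (row i H) j = coef2 H i j.
Proof. exact: coef1_series1. Qed.

Lemma rowD i H K : row i (H + K) = row i H + row i K.
Proof. by apply: s1P => j; rewrite coef1D !coef1_row. Qed.
Lemma rowB i H K : row i (H - K) = row i H - row i K.
Proof. by apply: s1P => j; rewrite coef1B !coef1_row. Qed.
Lemma rowXM i H : row i (X * H) = if i is i'.+1 then row i' H else 0.
Proof. by apply: s1P => j; rewrite coef1_row coef2XM; case: i => // i; rewrite coef1_row. Qed.

Lemma rowYM i H : row i (Y * H) = T * row i H.
Proof.
by apply: s1P => j; rewrite coef1XM coef1_row coef2YM; case: j => // j; rewrite coef1_row.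
Qed.

Lemma row_const i (x : R) : row i (sconst x) = if i == 0%N then sconst x else 0.
Proof.
apply: s1P => j; rewrite coef1_row coef2_const.
by case: eqP => _ /=; rewrite ?mulr0n // coef1_const.
Qed.

Lemma rowYfM i f H : row i (inY f * H) = f * row i H.
Proof.
apply: s1P => j; rewrite coef1_row coef1M; elim: j f => [|j IH] f;
  rewrite inY_split mulrDl /coef2 sD -!/(coef2 _ _ _) coef2CM -mulrA coef2YM.
  by rewrite big_ord1 addr0 coef1_row.
rewrite IH [in RHS]big_ord_recl subn0 coef1_row; congr (_ + _); apply: eq_bigr => k _.
by rewrite coef1_shift subSS.
Qed.

Lemma rowY i f : row i (inY f) = if i == 0%N then f else 0.
Proof.
rewrite -[inY f]mulr1 rowYfM; have -> : (1 : series R 2) = sconst 1 by [].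
by rewrite row_const; case: eqP => _; rewrite ?mulr0 // mulr1.
Qed.

Lemma rowX i f : row i (inX f) = sconst (coef1 f i).
Proof.
by elim: i f => [|i IH] f; rewrite inX_split rowD row_const rowXM /= ?addr0 // add0r IH coef1_shift.
Qed.

Definition sshift2 e H : series R 2 := fun k => H (k + U_(@Ordinal 2 0 isT) *+ e)%MM.

Lemma coef2_shift2 e H i j : coef2 (sshift2 e H) i j = coef2 H (e + i) j.
Proof.
rewrite /coef2 /sshift2; congr H; apply: mnm2P; rewrite mnmDE mulmnE mnm1E /=.
  by rewrite mul1n addnC.
by rewrite mul0n addn0.
Qed.

Lemma row_shift2 e H i : row i (sshift2 e H) = row (e + i) H.
Proof. by apply: s1P => j; rewrite !coef1_row coef2_shift2. Qed.

Lemma s2_split1 H : H = inY (row 0 H) + X * sshift2 1 H.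
Proof.
apply: s2P => i j; rewrite -!coef1_row rowD rowXM rowY.
by case: i => [|i] /=; rewrite ?addr0 // add0r row_shift2.
Qed.

Lemma s2_splitY H : exists H', H = inX (series1 (fun i => coef2 H i 0)) + Y * H'.
Proof.
exists (fun k => H (k + U_(@Ordinal 2 1 isT))%MM); apply: s2P => i j.
rewrite -!coef1_row rowD rowYM rowX coef1D coef1XM coef1_const coef1_series1 coef1_row.
case: j => [|j] /=; rewrite ?addr0 // add0r coef1_row /coef2; congr H.
by apply: mnm2P; rewrite mnmDE mnm1E /= ?addn0 ?addn1.
Qed.

Lemma rowM i H K : row i (H * K) = \sum_(j < i.+1) row j H * row (i - j) K.
Proof.
elim: i H => [|i IH] H; rewrite {1}[H]s2_split1 mulrDl rowD rowYfM -mulrA rowXM.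
  by rewrite big_ord1 addr0.
rewrite IH [in RHS]big_ord_recl subn0; congr (_ + _); apply: eq_bigr => k _.
by rewrite row_shift2 subSS.
Qed.

Lemma s2_split H e :
  H = \sum_(i < e) inY (row i H) * X ^+ i + X ^+ e * sshift2 e H.
Proof.
elim: e => [|e IH].
  rewrite big_ord0 add0r mul1r; apply: s2P => i j.
  by rewrite coef2_shift2.
rewrite {1}IH big_ord_recr /= -addrA; congr (_ + _).
rewrite {1}[sshift2 e H]s2_split1 mulrDr row_shift2 addn0 mulrC; congr (_ + _).
rewrite mulrA -exprSr; congr (_ * _); apply: s2P => i j.
by rewrite !coef2_shift2 add1n addnS.
Qed.

Lemma zconst2 l (b c : series R l) : b 0%MM = 0 -> c 0%MM = 0 -> zconst [tuple b; c].
Proof. by move=> b0 c0 [[|[|//]] hi]. Qed.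

Section Comp2.
Variables (l : nat) (b c : series R l) (b0 : b 0%MM = 0) (c0 : c 0%MM = 0).
Let zb := zconst2 b0 c0.

Lemma comp2D H K : comp2 (H + K) b c = comp2 H b c + comp2 K b c.
Proof. by rewrite !compE scompD. Qed.
Lemma comp2M H K : comp2 (H * K) b c = comp2 H b c * comp2 K b c.
Proof. by rewrite !compE scompM. Qed.
Lemma comp2Xn H n : comp2 (H ^+ n) b c = comp2 H b c ^+ n.
Proof. by rewrite !compE scompX. Qed.
Lemma comp2_sum (I : Type) (r : seq I) (P : pred I) (f : I -> series R 2) :
  comp2 (\sum_(i <- r | P i) f i) b c = \sum_(i <- r | P i) comp2 (f i) b c.
Proof. rewrite compE scomp_sum //; by apply: eq_bigr => i _; rewrite compE. Qed.
Lemma comp2X : comp2 X b c = b.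
Proof. rewrite compE; exact: scomp_var. Qed.
Lemma comp2Y : comp2 Y b c = c.
Proof. rewrite compE; exact: scomp_var. Qed.
Lemma comp2_zc H : comp2 H b c 0%MM = H 0%MM.
Proof. by rewrite !compE scomp0. Qed.

Lemma comp2_comp1 f H : H 0%MM = 0 -> comp2 (comp1 f H) b c = comp1 f (comp2 H b c).
Proof.
move=> /zconst1 H0; rewrite !compE scompA //.
by congr scomp; apply: eq_from_tnth => i; rewrite tnth_mktuple !ord1.
Qed.

Lemma comp2_comp2 H K L : K 0%MM = 0 -> L 0%MM = 0 ->
  comp2 (comp2 H K L) b c = comp2 H (comp2 K b c) (comp2 L b c).
Proof.
move=> K0 L0; rewrite !compE scompA //; last exact: zconst2.
congr scomp; apply: eq_from_tnth => i; rewrite tnth_mktuple.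
by case: i => [[|[|//]] hi].
Qed.

Lemma comp2_inX f : comp2 (inX f) b c = comp1 f b.
Proof. by rewrite /inX comp2_comp1 ?svar0 // comp2X. Qed.

Lemma comp2_inY f : comp2 (inY f) b c = comp1 f c.
Proof. by rewrite /inY comp2_comp1 ?svar0 // comp2Y. Qed.
End Comp2.

Lemma comp1_comp2 l H f g (b : series R l) :
  f 0%MM = 0 -> g 0%MM = 0 -> b 0%MM = 0 ->
  comp1 (comp2 H f g) b = comp2 H (comp1 f b) (comp1 g b).
Proof.
move=> f0 g0 b0; rewrite !compE scompA; [|exact: zconst1|exact: zconst2].
congr scomp; apply: eq_from_tnth => i; rewrite tnth_mktuple.
by case: i => [[|[|//]] hi].
Qed.

Lemma comp2_id H : comp2 H X Y = H.
Proof.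
rewrite compE -[RHS]scomp_id; congr scomp; apply: eq_from_tnth => i.
rewrite tnth_mktuple; case: i => [[|[|//]] hi] /=; rewrite (tnth_nth 0) /=;
  by congr svar; apply: val_inj.
Qed.

End Bivariate.

Section MapComp.
Variables (R S : comNzRingType) (f : {rmorphism R -> S}).

Lemma coef1_smap (a : series R 1) n : coef1 (smap f a) n = f (coef1 a n).
Proof. by []. Qed.

Lemma smap_comp1 l a (b : series R l) :
  smap f (comp1 a b) = comp1 (smap f a) (smap f b).
Proof.
rewrite !compE smap_comp; congr scomp; apply: eq_from_tnth => i.
by rewrite tnth_mktuple !ord1.
Qed.

Lemma smap_comp2 l H (b c : series R l) :
  smap f (comp2 H b c) = comp2 (smap f H) (smap f b) (smap f c).
Proof.
rewrite !compE smap_comp; congr scomp; apply: eq_from_tnth => i.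
by rewrite tnth_mktuple; case: i => [[|[|//]] hi].
Qed.
End MapComp.

(** * Formal group laws *)

Section FormalGroupLaw.
Variable R : comNzRingType.
Implicit Types (F : series R 2) (u v : series R 1).
Local Notation T := (sT R).
Local Notation X := (svar R (@Ordinal 2 0 isT)).
Local Notation Y := (svar R (@Ordinal 2 1 isT)).

Local Notation x3 := (svar R (@Ordinal 3 0 isT)).
Local Notation y3 := (svar R (@Ordinal 3 1 isT)).
Local Notation z3 := (svar R (@Ordinal 3 2 isT)).

Lemma sT0 : T 0%MM = 0. Proof. exact: svar0. Qed.

Lemma sconst_zero m : sconst 0 = 0 :> series R m.
Proof. by rewrite rmorph0. Qed.

Lemma is_fglE F :
  is_fgl F <->
  [/\ comp2 F T 0 = T, comp2 F 0 T = T,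
      comp2 F (comp2 F x3 y3) z3 = comp2 F x3 (comp2 F y3 z3)
    & comp2 F X Y = comp2 F Y X].
Proof.
rewrite !compE -(sconst_zero 1).
split=> -[h1 h2 h3 h4].
  by split; [exact: (funext h1)|exact: (funext h2)|exact: (funext h3)|exact: (funext h4)].
by split=> /= k; [exact: (congr1 (@^~ k) h1)|exact: (congr1 (@^~ k) h2)
  |exact: (congr1 (fun f : series R 3 => f k) h3)|exact: (congr1 (@^~ k) h4)].
Qed.

Lemma fgl_zconst F : is_fgl F -> F 0%MM = 0.
Proof.
by case/is_fglE => h _ _ _; rewrite -(@comp2_zc _ _ T 0) ?h // sT0.
Qed.

Section Facts.
Variables (F : series R 2) (FP : is_fgl F).
Let F0 := fgl_zconst FP.
Variable l : nat.
Implicit Types (a b c : series R l).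

Lemma fgl_0r a : a 0%MM = 0 -> comp2 F a 0 = a.
Proof.
move=> a0; have [h _ _ _] := (is_fglE F).1 FP.
have := congr1 (fun f => comp1 f a) h.
by rewrite comp1_comp2 ?sT0 // comp1_sT // comp1_0.
Qed.

Lemma fgl_0l a : a 0%MM = 0 -> comp2 F 0 a = a.
Proof.
move=> a0; have [_ h _ _] := (is_fglE F).1 FP.
have := congr1 (fun f => comp1 f a) h.
by rewrite comp1_comp2 ?sT0 // comp1_sT // comp1_0.
Qed.

Lemma fglC a b : a 0%MM = 0 -> b 0%MM = 0 -> comp2 F a b = comp2 F b a.
Proof.
move=> a0 b0; have [_ _ _ h] := (is_fglE F).1 FP.
have := congr1 (fun f => comp2 f a b) h.
by rewrite !comp2_comp2 ?svar0 // comp2X // comp2Y.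
Qed.

Lemma fglA a b c : a 0%MM = 0 -> b 0%MM = 0 -> c 0%MM = 0 ->
  comp2 F (comp2 F a b) c = comp2 F a (comp2 F b c).
Proof.
move=> a0 b0 c0; have [_ _ h _] := (is_fglE F).1 FP.
have zabc : zconst [tuple a; b; c] by move=> [[|[|[|//]]] hi].
have E (K L : series R 3) : K 0%MM = 0 -> L 0%MM = 0 -> forall H : series R 2,
    scomp (comp2 H K L) [tuple a; b; c]
      = comp2 H (scomp K [tuple a; b; c]) (scomp L [tuple a; b; c]).
  move=> K0 L0 H2; rewrite !compE scompA //; last exact: zconst2.
  congr scomp; apply: eq_from_tnth => i; rewrite tnth_mktuple.
  by case: i => [[|[|//]] hi].
have := congr1 (fun f => scomp f [tuple a; b; c]) h.
by rewrite !E ?svar0 ?comp2_zc ?svar0 // !scomp_var.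
Qed.

Lemma fgl_add_zc a b : a 0%MM = 0 -> b 0%MM = 0 -> comp2 F a b 0%MM = 0.
Proof. by move=> a0 b0; rewrite comp2_zc. Qed.

Lemma fglACA a b c d : a 0%MM = 0 -> b 0%MM = 0 -> c 0%MM = 0 -> d 0%MM = 0 ->
  comp2 F (comp2 F a b) (comp2 F c d) = comp2 F (comp2 F a c) (comp2 F b d).
Proof.
move=> a0 b0 c0 d0.
rewrite fglA ?fgl_add_zc // -(fglA b0 c0 d0) (fglC b0 c0) (fglA c0 b0 d0).
by rewrite -fglA ?fgl_add_zc.
Qed.

End Facts.

Lemma fgl_mulS F m : fgl_mul F m.+1 = comp2 F T (fgl_mul F m).
Proof. by rewrite compE. Qed.

Lemma fgl_mul0 F : fgl_mul F 0 = 0.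
Proof. exact: sconst_zero. Qed.

Lemma fgl_mul_zc F m : is_fgl F -> fgl_mul F m 0%MM = 0.
Proof.
move=> FP; elim: m => [|m IH]; first by rewrite fgl_mul0.
by rewrite fgl_mulS fgl_add_zc ?sT0.
Qed.

Lemma comp1_fgl_mulS F l (b : series R l) m : is_fgl F -> b 0%MM = 0 ->
  comp1 (fgl_mul F m.+1) b = comp2 F b (comp1 (fgl_mul F m) b).
Proof.
by move=> FP b0; rewrite fgl_mulS comp1_comp2 ?sT0 ?fgl_mul_zc ?comp1_sT.
Qed.

Lemma comp1_zconst l (a : series R 1) (b : series R l) :
  a 0%MM = 0 -> b 0%MM = 0 -> comp1 a b 0%MM = 0.
Proof. by move=> a0 b0; rewrite comp1_zc. Qed.

Lemma fgl_mul_add F m l (a b : series R l) : is_fgl F ->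
  a 0%MM = 0 -> b 0%MM = 0 ->
  comp1 (fgl_mul F m) (comp2 F a b)
    = comp2 F (comp1 (fgl_mul F m) a) (comp1 (fgl_mul F m) b).
Proof.
move=> FP a0 b0; elim: m => [|m IH].
  by rewrite fgl_mul0 !comp1_0 ?fgl_0r // fgl_add_zc.
rewrite !comp1_fgl_mulS ?fgl_add_zc // IH fglACA //;
  by rewrite comp1_zconst ?fgl_mul_zc.
Qed.

Lemma is_fgl_homE F F' u : is_fgl_hom F F' u <->
  u 0%MM = 0 /\ comp1 u F = comp2 F' (comp1 u X) (comp1 u Y).
Proof.
rewrite !compE; split=> -[u0 h]; split=> //; first exact: (funext h).
by move=> k; exact: (congr1 (@^~ k) h).
Qed.

Lemma fgl_mul_hom F m : is_fgl F -> is_fgl_hom F F (fgl_mul F m).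
Proof.
move=> FP; apply/is_fgl_homE; split; first exact: fgl_mul_zc.
by rewrite -fgl_mul_add ?svar0 // comp2_id.
Qed.

Lemma fgl_homE F F' u l (a b : series R l) : F 0%MM = 0 ->
  is_fgl_hom F F' u -> a 0%MM = 0 -> b 0%MM = 0 ->
  comp1 u (comp2 F a b) = comp2 F' (comp1 u a) (comp1 u b).
Proof.
move=> F0 /is_fgl_homE[u0 h] a0 b0; have := congr1 (fun f => comp2 f a b) h.
rewrite comp2_comp1 // => ->; rewrite comp2_comp2 ?comp1_zconst ?svar0 //.
by rewrite !comp2_comp1 ?svar0 // comp2X // comp2Y.
Qed.

Lemma fgl_mul_iso F F' u m : is_fgl F -> is_fgl F' -> is_fgl_hom F F' u ->
  comp1 u (fgl_mul F m) = comp1 (fgl_mul F' m) u.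
Proof.
move=> FP F'P uP; have [u0 _] := uP; elim: m => [|m IH].
  by rewrite !fgl_mul0 comp1_z // comp1_0.
rewrite fgl_mulS (fgl_homE (fgl_zconst FP) uP) ?sT0 ?fgl_mul_zc //.
by rewrite comp1_id IH comp1_fgl_mulS.
Qed.

Lemma fgl_row0 F : is_fgl F -> row 0 F = T.
Proof.
move=> FP; have := @fgl_0l F FP 1 T sT0.
rewrite {1}[F]s2_split1 comp2D ?sT0 // comp2M ?sT0 // comp2X ?sT0 // mul0r addr0.
by rewrite comp2_inY ?sT0 // comp1_id.
Qed.

(** F(0, Y) = Y and F(X, 0) = X give F = X + Y to first order; this form yields the linear
    coefficient of [m]_F. *)
Lemma fgl_split F : is_fgl F -> exists2 F', F = Y + X * F' & F' 0%MM = 1.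
Proof.
move=> FP; exists (sshift2 1 F).
  rewrite {1}[F]s2_split1 fgl_row0 //; congr (_ + _).
  by rewrite /inY comp1_sT ?svar0.
have := @fgl_0r F FP 1 T sT0.
rewrite {1}[F]s2_split1 comp2D ?sT0 // comp2M ?sT0 // comp2X ?sT0 //.
rewrite comp2_inY ?sT0 // fgl_row0 // comp1_sT // add0r.
move/(congr1 (fun f => coef1 f 1)); rewrite coef1XM coef1X coef1_0.
by rewrite comp2_zc ?sT0.
Qed.

Lemma coef1_fgl_add F (a b : series R 1) : is_fgl F ->
  a 0%MM = 0 -> b 0%MM = 0 ->
  coef1 (comp2 F a b) 1 = coef1 a 1 + coef1 b 1.
Proof.
move=> FP a0 b0; have [F' -> F'0] := fgl_split FP.
rewrite comp2D // comp2M // comp2X // comp2Y //.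
rewrite coef1D coef1M big_ord_recl big_ord1 /= coef1_0 a0 mul0r add0r coef1_0.
by rewrite comp2_zc // F'0 mulr1 addrC.
Qed.

Lemma coef1_fgl_mul F m : is_fgl F -> coef1 (fgl_mul F m) 1 = m%:R.
Proof.
move=> FP; elim: m => [|m IH]; first by rewrite fgl_mul0.
rewrite fgl_mulS coef1_fgl_add ?sT0 ?fgl_mul_zc // IH coef1X; exact: nat1r.
Qed.

(** The law F in the coordinate u, when v is the inverse of u under composition. *)
Definition fgl_conj u v F : series R 2 := comp1 u (comp2 F (comp1 v X) (comp1 v Y)).

Section Conjugate.
Variables (F : series R 2) (FP : is_fgl F).
Variables (u v : series R 1) (u0 : u 0%MM = 0) (v0 : v 0%MM = 0).
Hypotheses (uv : comp1 u v = T) (vu : comp1 v u = T).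

Lemma fgl_conjE l (a b : series R l) : a 0%MM = 0 -> b 0%MM = 0 ->
  comp2 (fgl_conj u v F) a b = comp1 u (comp2 F (comp1 v a) (comp1 v b)).
Proof.
move=> a0 b0.
rewrite /fgl_conj comp2_comp1 ?fgl_add_zc ?comp1_zconst ?svar0 //.
by rewrite comp2_comp2 ?comp1_zconst ?svar0 // !comp2_comp1 ?svar0 // comp2X // comp2Y.
Qed.

Lemma comp1_uv l (a : series R l) : a 0%MM = 0 -> comp1 u (comp1 v a) = a.
Proof. by move=> a0; rewrite -comp1A // uv comp1_sT. Qed.

Lemma comp1_vu l (a : series R l) : a 0%MM = 0 -> comp1 v (comp1 u a) = a.
Proof. by move=> a0; rewrite -comp1A // vu comp1_sT. Qed.

Lemma fgl_conjP : is_fgl (fgl_conj u v F).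
Proof.
apply/is_fglE; split=> /=.
- by rewrite fgl_conjE ?sT0 // comp1_z // fgl_0r ?comp1_uv ?comp1_zconst ?sT0.
- by rewrite fgl_conjE ?sT0 // comp1_z // fgl_0l ?comp1_uv ?comp1_zconst ?sT0.
- rewrite !fgl_conjE ?comp1_zconst ?fgl_add_zc ?comp1_zconst ?svar0 //.
  by rewrite !comp1_vu ?fgl_add_zc ?comp1_zconst ?svar0 // fglA ?comp1_zconst ?svar0.
- by rewrite !fgl_conjE ?svar0 // fglC ?comp1_zconst ?svar0.
Qed.

Lemma fgl_conj_hom : is_fgl_hom F (fgl_conj u v F) u.
Proof.
apply/is_fgl_homE; split=> //; rewrite fgl_conjE ?comp1_zconst ?svar0 //.
by rewrite !comp1_vu ?svar0 // comp2_id.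
Qed.

Lemma fgl_conj_hom_inv : is_fgl_hom (fgl_conj u v F) F v.
Proof.
apply/is_fgl_homE; split=> //; rewrite -[in LHS](comp2_id (fgl_conj u v F)).
by rewrite fgl_conjE ?svar0 // comp1_vu // fgl_add_zc ?comp1_zconst ?svar0.
Qed.

Lemma fgl_conj_iso : is_fgl_iso F (fgl_conj u v F) u.
Proof.
split; first exact: fgl_conj_hom; exists v; split; first exact: fgl_conj_hom_inv.
  by rewrite -comp1_scomp uv.
by rewrite -comp1_scomp vu.
Qed.
End Conjugate.

(** The target of an isomorphism is determined by its source and the series u, so uniqueness of a
    law in its class reduces to uniqueness of u. *)
Lemma fgl_iso_conj F F' u v : is_fgl F -> is_fgl F' -> is_fgl_hom F F' u ->
  v 0%MM = 0 -> comp1 u v = T -> F' = fgl_conj u v F.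
Proof.
move=> FP F'P uP v0 uv; have [u0 _] := uP.
rewrite /fgl_conj (fgl_homE (fgl_zconst FP) uP) ?comp1_zconst ?svar0 //.
by rewrite -!comp1A ?svar0 // uv !comp1_sT ?svar0 // comp2_id.
Qed.

End FormalGroupLaw.

(** * The p-adic topology *)

Definition pdvd (p : nat) (A : comNzRingType) (N : nat) (x : A) :=
  exists y, x = p%:R ^+ N * y.

Section PDivisibility.
Variables (p : nat) (A : comNzRingType).
Implicit Types (x y z : A).
Local Notation pdvd := (pdvd p).

Lemma pdvd0 N : pdvd N (0 : A).
Proof. by exists 0; rewrite mulr0. Qed.
Lemma pdvd_0 x : pdvd 0 x.
Proof. by exists x; rewrite mul1r. Qed.
Lemma pdvdD N x y : pdvd N x -> pdvd N y -> pdvd N (x + y).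
Proof. by move=> [a ->] [b ->]; exists (a + b); rewrite mulrDr. Qed.
Lemma pdvdN N x : pdvd N x -> pdvd N (- x).
Proof. by move=> [a ->]; exists (- a); rewrite mulrN. Qed.
Lemma pdvdB N x y : pdvd N x -> pdvd N y -> pdvd N (x - y).
Proof. by move=> hx hy; apply: pdvdD => //; apply: pdvdN. Qed.
Lemma pdvdMr N x y : pdvd N x -> pdvd N (x * y).
Proof. by move=> [a ->]; exists (a * y); rewrite mulrA. Qed.
Lemma pdvdMl N x y : pdvd N y -> pdvd N (x * y).
Proof. by rewrite mulrC; apply: pdvdMr. Qed.
Lemma pdvdM M N x y : pdvd M x -> pdvd N y -> pdvd (M + N) (x * y).
Proof. by move=> [a ->] [b ->]; exists (a * b); rewrite exprD mulrACA. Qed.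
Lemma pdvd_p N x : pdvd N (p%:R ^+ N * x).
Proof. by exists x. Qed.
Lemma pdvd_leq M N x : (M <= N)%N -> pdvd N x -> pdvd M x.
Proof.
by move=> /subnKC <- [a ->]; exists (p%:R ^+ (N - M) * a); rewrite exprD mulrA.
Qed.
Lemma pdvd_sum N (I : Type) (r : seq I) (P : pred I) (f : I -> A) :
  (forall i, P i -> pdvd N (f i)) -> pdvd N (\sum_(i <- r | P i) f i).
Proof.
by move=> h; elim/big_ind: _ => //; [exact: pdvd0|move=> x y; exact: pdvdD].
Qed.
Lemma pdvd_trans N x y z : pdvd N (x - y) -> pdvd N (y - z) -> pdvd N (x - z).
Proof. by move=> h1 h2; rewrite -(subrK y x) -addrA; apply: pdvdD. Qed.
Lemma pdvd_sym N x y : pdvd N (x - y) -> pdvd N (y - x).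
Proof. by move=> h; rewrite -opprB; apply: pdvdN. Qed.
Lemma pdvd_subM N x y x' y' :
  pdvd N (x - x') -> pdvd N (y - y') -> pdvd N (x * y - x' * y').
Proof.
move=> h1 h2; have -> : x * y - x' * y' = (x - x') * y + x' * (y - y') by ring.
by apply: pdvdD; [apply: pdvdMr|apply: pdvdMl].
Qed.
Lemma pdvd_subX N x y n : pdvd N (x - y) -> pdvd N (x ^+ n - y ^+ n).
Proof. by move=> h; rewrite subrXX; apply: pdvdMr. Qed.

Lemma pdvd_subXp N x y : pdvd N.+1 (x - y) -> pdvd N.+2 (x ^+ p - y ^+ p).
Proof.
move=> h; rewrite subrXX -[N.+2]addn1; apply: pdvdM => //.
(* The cofactor of x - y is p y^(p-1) modulo x - y, hence divisible by p. *)
have -> : \sum_(i < p) x ^+ (p.-1 - i) * y ^+ i =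
    p%:R ^+ 1 * y ^+ p.-1 + \sum_(i < p) (x ^+ (p.-1 - i) - y ^+ (p.-1 - i)) * y ^+ i.
  rewrite expr1 mulr_natl -[p in _ *+ p]card_ord -sumr_const -big_split /=.
  apply: eq_bigr => i _; rewrite mulrBl addrC -exprD subnK ?subrK //.
  by rewrite -ltnS (leq_trans (ltn_ord i)) // leqSpred.
apply: pdvdD; first exact: pdvd_p.
apply: pdvd_sum => i _; apply/pdvdMr/pdvd_subX.
by apply: pdvd_leq h.
Qed.

Lemma pdvd_subXpn x y n : pdvd 1 (x - y) -> pdvd n.+1 (x ^+ (p ^ n) - y ^+ (p ^ n)).
Proof.
move=> h; elim: n => [|n IH]; first by rewrite !expr1.
by rewrite expnSr !exprM; apply: pdvd_subXp.
Qed.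

End PDivisibility.

Lemma pdvd_rmorph p (A B : comNzRingType) (f : {rmorphism A -> B}) N x :
  pdvd p N x -> pdvd p N (f x).
Proof. by move=> [y ->]; exists (f y); rewrite rmorphM rmorphXn rmorph_nat. Qed.

(** No p-torsion, separated, complete. The modulus of convergence is fixed, s_(n+1) = s_n mod p^n,
    so that the property passes to series coefficient by coefficient. *)
Definition padic_complete (p : nat) (A : comNzRingType) :=
  [/\ forall x : A, p%:R * x = 0 -> x = 0,
      forall x : A, (forall N, pdvd p N x) -> x = 0
    & forall s : nat -> A, (forall n, pdvd p n (s n.+1 - s n)) ->
        exists l, forall N, pdvd p N (l - s N)].

Lemma spM (A : comNzRingType) (p N m : nat) (a : series A m) k :
  (p%:R ^+ N * a) k = p%:R ^+ N * a k.
Proof. by rewrite -natrX natsM natrX. Qed.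

Lemma pdvd_seriesP (A : comNzRingType) (p N m : nat) (a : series A m) :
  pdvd p N a <-> forall k, pdvd p N (a k).
Proof.
split=> [[b ->] k|h]; first by exists (b k); rewrite spM.
have [b bP] := choice h.
by exists b; apply/funext => k; rewrite spM.
Qed.

Lemma padic_complete_series p (A : comNzRingType) m :
  padic_complete p A -> padic_complete p (series A m : comNzRingType).
Proof.
move=> [h1 h2 h3]; split=> [x|x hx|s hs].
- move=> px; apply/funext => k; apply: h1.
  by rewrite -natsM px.
- by apply/funext => k; apply: h2 => N; apply: (pdvd_seriesP p N x).1.
- have /choice[l lP] : forall k, exists lk, forall N, pdvd p N (lk - s N k).
    by move=> k; apply: h3 => n; apply: (pdvd_seriesP p n (s n.+1 - s n)).1.
  by exists l => N; apply/pdvd_seriesP => k; apply: lP.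
Qed.

Section Complete.
Variables (p : nat) (A : comNzRingType) (cA : padic_complete p A).
Local Notation pdvd := (pdvd p).

Lemma ptors (x : A) : p%:R * x = 0 -> x = 0. Proof. by case: cA => h _ _; apply: h. Qed.
Lemma psep (x : A) : (forall N, pdvd N x) -> x = 0. Proof. by case: cA => _ h _; apply: h. Qed.
Lemma plim (s : nat -> A) : (forall n, pdvd n (s n.+1 - s n)) ->
  exists l, forall N, pdvd N (l - s N).
Proof. by case: cA => _ _; apply. Qed.

Lemma pinj N (x y : A) : p%:R ^+ N * x = p%:R ^+ N * y -> x = y.
Proof.
move/eqP; rewrite -subr_eq0 -mulrBr => /eqP; elim: N => [|N IH].
  by rewrite mul1r => /subr0_eq.
by rewrite exprS -mulrA => /ptors.
Qed.

Lemma pdvd_cancel M N (x : A) : pdvd (M + N) (p%:R ^+ M * x) -> pdvd N x.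
Proof. by move=> [y]; rewrite exprD -mulrA => /pinj ->; exists y. Qed.

Lemma plim_sum (a : nat -> A) :
  exists l, forall N, pdvd N (l - \sum_(i < N) p%:R ^+ i * a i).
Proof.
apply: plim => n; rewrite big_ord_recr /= addrAC subrr add0r; exact: pdvd_p.
Qed.

(** With x = 1 + p z, the inverse is the geometric series in -p z. *)
Lemma punit (x : A) : pdvd 1 (x - 1) -> exists y, x * y = 1.
Proof.
move=> [z zE]; have [y yP] := plim_sum (fun i => (- z) ^+ i).
exists y; apply/eqP; rewrite -subr_eq0; apply/eqP/psep => N.
apply: (@pdvd_trans _ _ _ _ (x * \sum_(i < N) p%:R ^+ i * (- z) ^+ i)).
  by rewrite -mulrBr; apply: pdvdMl.
have -> : x = 1 - p%:R * (- z) by rewrite mulrN opprK -[p%:R]expr1 -zE subrKC.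
under eq_bigr do rewrite -exprMn.
rewrite -[1 - _]opprB mulNr -subrX1 opprB addrAC subrr add0r exprMn.
by apply/pdvdN/pdvd_p.
Qed.

End Complete.

Section CompositionCongruence.
Variables (p : nat) (A : comNzRingType).
Local Notation pdvd := (pdvd p).
Local Notation T := (sT A).

Lemma pdvd_comp1l N l (f g : series A 1) (b : series A l) : b 0%MM = 0 ->
  pdvd N (f - g) -> pdvd N (comp1 f b - comp1 g b).
Proof.
move=> b0 [h hE]; rewrite -comp1B // hE comp1M // comp1Xn // comp1_nat //.
exact: pdvd_p.
Qed.

Lemma pdvd_comp1r N l (f : series A 1) (b c : series A l) :
  b 0%MM = 0 -> c 0%MM = 0 -> pdvd N (b - c) -> pdvd N (comp1 f b - comp1 f c).
Proof.
move=> b0 c0 h; apply/pdvd_seriesP => k; rewrite sB.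
rewrite (@comp1E _ _ _ b0 _ _ (mdeg k).+1) // (@comp1E _ _ _ c0 _ _ (mdeg k).+1) //.
rewrite -sumrB; apply: pdvd_sum => i _; rewrite -mulrBr -sB; apply: pdvdMl.
by apply: (pdvd_seriesP p N _).1; apply: pdvd_subX.
Qed.

Lemma coef1_comp1Tq q c n : (0 < q)%N ->
  coef1 (comp1 c (T ^+ q)) n = if (q %| n)%N then coef1 c (n %/ q) else 0.
Proof.
move=> q0; have Tq0 : (T ^+ q) 0%MM = 0 by rewrite sX0 sT0 expr0n gtn_eqF.
rewrite {1}/coef1 (@comp1E _ _ _ Tq0 _ _ n.+1) ?mdeg_mnm1 //.
under eq_bigr do rewrite -exprM -/(coef1 _ n) coef1Xn.
case: (boolP (q %| n)%N) => [/dvdnP[k ->]|qn].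
  rewrite mulnK // mulnC; have kn : (k < (q * k).+1)%N by rewrite ltnS leq_pmull.
  rewrite (bigD1 (Ordinal kn)) //= eqxx mulr1 big1 ?addr0 // => i.
  rewrite -val_eqE /= => ik; rewrite eqn_pmul2l // eq_sym (negPf ik) mulr0 //.
rewrite big1 // => i _; case: eqP => [ni|]; last by rewrite mulr0.
by case/dvdnP: qn; exists i; rewrite mulnC.
Qed.

(** Exponents are grouped by their residue modulo q. This is the case a = T^q, u = T of
    [weierstrass_basis], from which the general one is obtained by deformation. *)
Lemma basis_Tq q (f : series A 1) : (0 < q)%N ->
  f = \sum_(i < q) comp1 (series1 (fun j => coef1 f (q * j + i))) (T ^+ q) * T ^+ i.
Proof.
move=> q0; apply: s1P => n; rewrite coef1_sum.
have nq : (n %% q < q)%N by rewrite ltn_mod.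
rewrite (bigD1 (Ordinal nq)) //= big1 ?addr0 => [|i].
  rewrite mulrC coef1XnM ltnNge leq_mod coef1_comp1Tq // coef1_series1.
  by rewrite {2 4}(divn_eq n q) addnK dvdn_mull // mulnK // mulnC -divn_eq.
rewrite -val_eqE /= => iq; rewrite mulrC coef1XnM; case: ltnP => // ni.
rewrite coef1_comp1Tq //; case: ifP => // /dvdnP[k kE].
by move: iq; rewrite -(subnK ni) kE modnMDl modn_small ?eqxx.
Qed.

End CompositionCongruence.

(** * Weierstrass division and preparation *)

Section Weierstrass.
Variables (p : nat) (A : comNzRingType) (cA : padic_complete p A).
Local Notation pdvd := (pdvd p).
Local Notation T := (sT A).
Let cS m := padic_complete_series m cA.

(** If f = p^N g and p^(N+1) divides f(a), then p divides g(a), which is g(T^q) modulo p; the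
    coefficients of g(T^q) in degrees divisible by q are those of g. *)
Lemma pdvd_comp1_inj N q (f a : series A 1) : (0 < q)%N -> a 0%MM = 0 ->
  pdvd 1 (a - T ^+ q) -> pdvd N (comp1 f a) -> pdvd N f.
Proof.
move=> q0 a0 aT; elim: N f => [|N IH] f fa; first exact: pdvd_0.
have [g fE] := IH f (pdvd_leq (leqnSn N) fa).
have : pdvd 1 (comp1 g a).
  apply: (@pdvd_cancel _ _ (cS 1) N); rewrite addn1.
  by move: fa; rewrite fE comp1M // comp1Xn // comp1_nat.
have Tq0 : (T ^+ q) 0%MM = 0 by rewrite sX0 sT0 expr0n gtn_eqF.
move=> ga; have : pdvd 1 (comp1 g (T ^+ q)).
  rewrite -[comp1 g _](subKr (comp1 g a)); apply: pdvdB => //.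
  exact: pdvd_comp1r.
move=> /pdvd_seriesP h; rewrite fE -[N.+1]addn1; apply: pdvdM; first by exists 1; rewrite mulr1.
apply/pdvd_seriesP => k; rewrite -(mnm1_ord0 k) -/(coef1 _ _).
have := h [multinom (q * k ord0)%N | _ < 1]; rewrite -/(coef1 _ _).
by rewrite coef1_comp1Tq // dvdn_mulr // mulKn.
Qed.

Section Basis.
Variables (q : nat) (q0 : (0 < q)%N) (a u : series A 1).
Hypotheses (a0 : a 0%MM = 0) (aT : pdvd 1 (a - T ^+ q)).
Hypotheses (uT : pdvd 1 (u - T)).

Let L (c : nat -> series A 1) := \sum_(i < q) comp1 (c i) a * u ^+ i.

Let L_cong N c d : (forall i, pdvd N (c i - d i)) -> pdvd N (L c - L d).
Proof.
move=> h; rewrite /L -sumrB; apply: pdvd_sum => i _; rewrite -mulrBl.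
by apply: pdvdMr; apply: pdvd_comp1l.
Qed.

Let L_step f : exists cf : (nat -> series A 1) * series A 1, f = L cf.1 + p%:R * cf.2.
Proof.
pose c i := series1 (fun j => coef1 f (q * j + i)).
have Tq0 : (T ^+ q) 0%MM = 0 by rewrite sX0 sT0 expr0n gtn_eqF.
suff [g gE] : pdvd 1 (f - L c) by exists (c, g); rewrite -[p%:R]expr1 -gE subrKC.
rewrite {1}(basis_Tq f q0) -sumrB; apply: pdvd_sum => i _.
apply: pdvd_subM; first by apply/pdvd_sym/pdvd_comp1r.
by apply/pdvd_subX/pdvd_sym.
Qed.

(** Modulo p, a = T^q and u = T, so [basis_Tq] expands f up to a remainder p f'. The same is done to
    f' and so on, and the coefficients are summed p-adically. *)
Lemma weierstrass_basis f : exists c : nat -> series A 1,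
  f = \sum_(i < q) comp1 (c i) a * u ^+ i.
Proof.
have [S SP] := choice L_step.
pose fs n := iter n (fun g => (S g).2) f.
pose cs n := (S (fs n)).1.
have fsP n : f = L (fun i => \sum_(j < n) p%:R ^+ j * cs j i) + p%:R ^+ n * fs n.
  elim: n => [|n IH].
    rewrite mul1r /L big1 ?add0r // => i _.
    by rewrite big_ord0 comp1_0 // mul0r.
  rewrite {1}IH {1}[fs n]SP mulrDr addrA -/(cs n) mulrA -exprSr; congr (_ + _).
  rewrite /L mulr_sumr -big_split /=; apply: eq_bigr => i _.
  rewrite big_ord_recr /= comp1D // comp1M // comp1Xn // comp1_nat //.
  by rewrite mulrDl mulrA.
have /choice[c cP] : forall i, exists l, forall N,
    pdvd N (l - \sum_(j < N) p%:R ^+ j * cs j i).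
  by move=> i; exact: (plim_sum (cS 1) (fun j => cs j i)).
exists c; apply/eqP; rewrite -subr_eq0; apply/eqP/(psep (cS 1)) => N.
rewrite -/(L c) {1}(fsP N) addrAC; apply: pdvdD; last exact: pdvd_p.
by apply/pdvd_sym/L_cong => i; apply: cP.
Qed.

(** Modulo p, u^q = T^q = a, so u^q = a + p d, and d is expanded along the powers of u. The result
    is a monic equation of degree q for u over the series in a. *)
Lemma weierstrass_power : exists c : nat -> series A 1,
  [/\ u ^+ q = \sum_(i < q) comp1 (c i) a * u ^+ i,
      pdvd 1 (c 0%N - T) & forall i, (0 < i)%N -> pdvd 1 (c i)].
Proof.
have [d dE] : pdvd 1 (u ^+ q - a).
  apply: (@pdvd_trans _ _ _ _ (T ^+ q)); first exact: pdvd_subX.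
  exact: pdvd_sym.
have [c cE] := weierstrass_basis d.
(* The summand T in index 0 accounts for the term a of a + p d, because T(a) = a. *)
exists (fun i => (if i == 0%N then T else 0) + p%:R ^+ 1 * c i); split.
- rewrite -[LHS](subrK a) dE {1}cE mulr_sumr addrC.
  rewrite [RHS](eq_bigr (fun i : 'I_q =>
    (if i == 0%N :> nat then a else 0) + p%:R ^+ 1 * (comp1 (c i) a * u ^+ i))).
    rewrite big_split /=; congr (_ + _).
    rewrite (bigD1 (Ordinal q0)) //= big1 ?addr0 // => i.
    by rewrite -val_eqE /= => /negPf->.
  move=> i _; rewrite comp1D // comp1M // comp1Xn // comp1_nat // mulrDl mulrA.
  by case: eqP => [->|_]; rewrite ?comp1_sT ?comp1_0 ?expr0 ?mulr1 ?mul0r.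
- by rewrite addrAC subrr add0r; apply: pdvd_p.
- by case=> // i _; rewrite add0r; apply: pdvd_p.
Qed.

End Basis.

(** With u = T + p d, the equation u(v) = T reads v = T - p d(v), whose right-hand side is a p-adic
    contraction in v. *)
Lemma comp1_right_inverse (u : series A 1) : u 0%MM = 0 -> pdvd 1 (u - T) ->
  exists v : series A 1, [/\ v 0%MM = 0, pdvd 1 (v - T) & comp1 u v = T].
Proof.
move=> u0 [d dE]; have uE : u = T + p%:R * d by rewrite -[p%:R]expr1 -dE subrKC.
have d0 : d 0%MM = 0.
  apply: (ptors cA); have := congr1 (fun f : series A 1 => f 0%MM) uE.
  by rewrite sD u0 sT0 add0r natsM.
pose v n := iter n (fun f => T - p%:R * comp1 d f) T.
have v0 n : v n 0%MM = 0.
  elim: n => [|n IH] /=; first exact: sT0.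
  by rewrite sB sT0 natsM comp1_zc // d0 mulr0 subr0.
have vS n : v n.+1 = T - p%:R * comp1 d (v n) by [].
have vc n : pdvd n (v n.+1 - v n).
  elim: n => [|n IH]; first exact: pdvd_0.
  rewrite !vS opprB addrC subrKA -mulrBr -[n.+1]add1n -[p%:R]expr1 -vS.
  apply: pdvdM; first by exists 1; rewrite mulr1.
  by apply/pdvd_comp1r/pdvd_sym.
have [w wP] := plim (cS 1) vc.
have w0 : w 0%MM = 0.
  apply: (psep cA) => N; have := (pdvd_seriesP p N _).1 (wP N) 0%MM.
  by rewrite sB v0 subr0.
exists w; split=> //.
  apply: (@pdvd_trans _ _ _ _ (v 1%N)); first exact: wP.
  by rewrite vS addrAC subrr add0r; apply/pdvdN; rewrite -[p%:R]expr1; apply: pdvd_p.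
apply/eqP; rewrite -subr_eq0; apply/eqP/(psep (cS 1)) => N.
rewrite uE comp1D // comp1M // comp1_nat // comp1_sT //.
have -> : T = v N.+1 + p%:R * comp1 d (v N) by rewrite vS subrK.
rewrite opprD addrACA; apply: pdvdD.
  by apply: pdvd_leq (wP N.+1).
by rewrite -mulrBr; apply/pdvdMl/pdvd_comp1r.
Qed.

Lemma comp1_inverse (u : series A 1) : u 0%MM = 0 -> pdvd 1 (u - T) ->
  exists v : series A 1, [/\ v 0%MM = 0, pdvd 1 (v - T), comp1 u v = T & comp1 v u = T].
Proof.
move=> u0 uT; have [v [v0 vT uv]] := comp1_right_inverse u0 uT.
(* The right inverse v has itself a right inverse w, and u = u(v(w)) = w, so v is a two-sided
   inverse. *)
exists v; split=> //; have [w [w0 _ vw]] := comp1_right_inverse v0 vT.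
have -> : u = w by rewrite -[LHS]comp1_id -vw -comp1A // uv comp1_sT.
exact: vw.
Qed.

Definition pser (P : {poly A}) : series A 1 := series1 (fun i => P`_i).

Lemma coef1_pser P n : coef1 (pser P) n = P`_n.
Proof. exact: coef1_series1. Qed.

Fact pser_is_zmod_morphism : zmod_morphism pser.
Proof. by move=> P Q; apply: s1P => n; rewrite coef1B !coef1_pser coefB. Qed.
Fact pser_is_monoid_morphism : monoid_morphism pser.
Proof.
split=> [|P Q]; apply: s1P => n.
  by rewrite coef1_pser coef1_one poly.coef1.
by rewrite coef1_pser coef1M coefM; apply: eq_bigr => i _; rewrite !coef1_pser.
Qed.
HB.instance Definition _ :=
  GRing.isZmodMorphism.Build {poly A} (series A 1) pser pser_is_zmod_morphism.
HB.instance Definition _ :=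
  GRing.isMonoidMorphism.Build {poly A} (series A 1) pser pser_is_monoid_morphism.

Lemma pserC x : pser x%:P = sconst x.
Proof. by apply: s1P => n; rewrite coef1_pser coefC coef1_const; case: eqP. Qed.
Lemma pserX : pser 'X = T.
Proof. by apply: s1P => n; rewrite coef1_pser coefX coef1X. Qed.

(** Apply [weierstrass_power] with u = T and write c_i(a) = c_i(0) + a c_i'(a). Then P = T^q - sum
    of c_i(0) T^i equals a times E = sum of c_i'(a) T^i. As c_0 = T and the other c_i vanish modulo
    p, E = 1 mod p. *)
Lemma weierstrass_preparation q (a : series A 1) : (0 < q)%N ->
  a 0%MM = 0 -> pdvd 1 (a - T ^+ q) ->
  exists P E, [/\ P \is monic, size P = q.+1,
    forall i, (i < q)%N -> pdvd 1 P`_i, pser P = a * E & pdvd 1 (E - 1)].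
Proof.
move=> q0 a0 aT.
have TT : pdvd 1 (T - T) by rewrite subrr; apply: pdvd0.
have [c [cE c0 cS']] := weierstrass_power q0 a0 aT TT.
pose R := \poly_(i < q) (coef1 (c i) 0).
have sR : (size R <= q)%N by apply: size_poly.
exists ('X^q - R), (\sum_(i < q) comp1 (sshift 1 (c i)) a * T ^+ i).
have sX : size ('X^q - R) = q.+1.
  by rewrite size_polyDl ?size_polyXn // size_polyN ltnS.
split=> //.
- rewrite monicE lead_coefE sX /= coefB coefXn eqxx coef_poly ltnn subr0 //.
- move=> i iq; rewrite coefB coefXn ltn_eqF // sub0r coef_poly iq; apply: pdvdN.
  case: i iq => [|i] iq; last by apply: (pdvd_seriesP p 1 _).1; apply: cS'.
  have := (pdvd_seriesP p 1 _).1 c0 [multinom 0%N | _ < 1].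
  by rewrite sB -!/(coef1 _ _) coef1X subr0.
- rewrite rmorphB rmorphXn /= pserX cE mulr_sumr.
  have -> : pser R = \sum_(i < q) sconst (coef1 (c i) 0) * T ^+ i.
    rewrite /R poly_def rmorph_sum /=; apply: eq_bigr => i _.
    by rewrite -mul_polyC rmorphM /= pserC rmorphXn /= pserX.
  rewrite -sumrB; apply: eq_bigr => i _; rewrite -mulrBl mulrA; congr (_ * _).
  by rewrite (comp1_split a0 _ 1) big_ord1 mulr1 addrAC subrr add0r.
- rewrite (bigD1 (Ordinal q0)) //= mulr1 addrAC; apply: pdvdD.
    rewrite -(comp1_1 a0); apply: pdvd_comp1l => //.
    apply/pdvd_seriesP => k; rewrite -(mnm1_ord0 k) -/(coef1 _ _) coef1B coef1_shift.
    have := (pdvd_seriesP p 1 _).1 c0 [multinom (1 + k ord0)%N | _ < 1].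
    by rewrite sB -!/(coef1 _ _) coef1X coef1_one.
  apply: pdvd_sum => i; rewrite -val_eqE /= -lt0n => i0; apply: pdvdMr.
  rewrite -[comp1 _ _]subr0 -(comp1_0 a0); apply: pdvd_comp1l => //; rewrite subr0.
  apply/pdvd_seriesP => k; rewrite -(mnm1_ord0 k) -/(coef1 _ _) coef1_shift.
  by apply: (pdvd_seriesP p 1 _).1; apply: cS'.
Qed.

Lemma weierstrass_division q (a : series A 1) : (0 < q)%N ->
  a 0%MM = 0 -> pdvd 1 (a - T ^+ q) -> forall f, exists R Q, f = pser R + a * Q.
Proof.
move=> q0 a0 aT f.
have TT : pdvd 1 (T - T) by rewrite subrr; apply: pdvd0.
have [c cE] := weierstrass_basis q0 a0 aT TT f.
exists (\poly_(i < q) (coef1 (c i) 0)), (\sum_(i < q) comp1 (sshift 1 (c i)) a * T ^+ i).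
rewrite {1}cE poly_def rmorph_sum mulr_sumr -big_split /=; apply: eq_bigr => i _.
rewrite -mul_polyC rmorphM /= pserC rmorphXn /= pserX mulrA -mulrDl; congr (_ * _).
by rewrite (comp1_split a0 _ 1) big_ord1 mulr1.
Qed.

End Weierstrass.

(** * Evaluation at the torsion points and the norm *)

Section ValuationLemmas.
Variables (F : fieldType) (v : valuation F).
Implicit Types (x y : F) (r s : rat).

Lemma val_ge0 r : val_ge v r 0. Proof. by rewrite /val_ge eqxx. Qed.
Lemma val_gt0 r : val_gt v r 0. Proof. by rewrite /val_gt eqxx. Qed.
Lemma val_ge1 : val_ge v 0 1. Proof. by rewrite /val_ge valuation1 lexx orbT. Qed.

Lemma val_gtW r x : val_gt v r x -> val_ge v r x.
Proof. by rewrite /val_gt /val_ge => /orP[->//|/ltW ->]; rewrite orbT. Qed.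

Lemma val_ge_gt r s x : s < r -> val_ge v r x -> val_gt v s x.
Proof. by rewrite /val_gt /val_ge => sr /orP[->//|/(lt_le_trans sr) ->]; rewrite orbT. Qed.

Lemma val_geN r x : val_ge v r (- x) = val_ge v r x.
Proof.
rewrite /val_ge oppr_eq0; have [//|x0] := eqVneq x 0; by rewrite valuationN.
Qed.

Lemma val_geD r x y : val_ge v r x -> val_ge v r y -> val_ge v r (x + y).
Proof.
have [->|x0] := eqVneq x 0; first by rewrite add0r.
have [->|y0] := eqVneq y 0; first by rewrite addr0.
rewrite /val_ge (negPf x0) (negPf y0) /= => hx hy.
have [//|xy0] := eqVneq (x + y) 0 => /=.
by apply: le_trans (valuationD v x0 y0 xy0); rewrite le_min hx hy.
Qed.

Lemma val_gtD r x y : val_gt v r x -> val_gt v r y -> val_gt v r (x + y).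
Proof.
have [->|x0] := eqVneq x 0; first by rewrite add0r.
have [->|y0] := eqVneq y 0; first by rewrite addr0.
rewrite /val_gt (negPf x0) (negPf y0) /= => hx hy.
have [//|xy0] := eqVneq (x + y) 0 => /=.
by apply: lt_le_trans (valuationD v x0 y0 xy0); rewrite lt_min hx hy.
Qed.

Lemma val_geB r x y : val_ge v r x -> val_ge v r y -> val_ge v r (x - y).
Proof. by move=> hx hy; apply: val_geD; rewrite ?val_geN. Qed.
Lemma val_geM r s x y : val_ge v r x -> val_ge v s y -> val_ge v (r + s) (x * y).
Proof.
rewrite /val_ge mulf_eq0; have [//|x0] := eqVneq x 0; have [//|y0] := eqVneq y 0.
by rewrite /= valuationM //; apply: lerD.
Qed.

Lemma val_gtM r s x y : val_ge v r x -> val_gt v s y -> val_gt v (r + s) (x * y).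
Proof.
rewrite /val_gt /val_ge mulf_eq0; have [//|x0] := eqVneq x 0; have [//|y0] := eqVneq y 0.
by rewrite /= valuationM //; apply: ler_ltD.
Qed.

Lemma val_ge_sum r (I : Type) (t : seq I) (P : pred I) (f : I -> F) :
  (forall i, P i -> val_ge v r (f i)) -> val_ge v r (\sum_(i <- t | P i) f i).
Proof.
by move=> h; elim/big_ind: _ => //; [exact: val_ge0|move=> x y; exact: val_geD].
Qed.

Lemma val_gt_sum r (I : Type) (t : seq I) (P : pred I) (f : I -> F) :
  (forall i, P i -> val_gt v r (f i)) -> val_gt v r (\sum_(i <- t | P i) f i).
Proof.
by move=> h; elim/big_ind: _ => //; [exact: val_gt0|move=> x y; exact: val_gtD].
Qed.

Lemma val_geX r x n : val_ge v r x -> val_ge v (n%:R * r) (x ^+ n).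
Proof.
move=> hx; elim: n => [|n IH]; first by rewrite mul0r val_ge1.
by rewrite exprS -nat1r mulrDl mul1r; apply: val_geM.
Qed.

Lemma val_geX0 x n : val_ge v 0 x -> val_ge v 0 (x ^+ n).
Proof. by move/(val_geX n); rewrite mulr0. Qed.

Lemma val_geM0 x y : val_ge v 0 x -> val_ge v 0 y -> val_ge v 0 (x * y).
Proof. by move=> hx hy; rewrite -[0]addr0; apply: val_geM. Qed.

Lemma valuationX x n : x != 0 -> v (x ^+ n) = n%:R * v x.
Proof.
move=> x0; elim: n => [|n IH]; first by rewrite mul0r valuation1.
by rewrite exprS -nat1r mulrDl mul1r valuationM ?IH ?expf_neq0.
Qed.

Lemma val_ge_sep d x : 0 < d -> (forall N, val_ge v (N%:R * d) x) -> x = 0.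
Proof.
move=> d0 h; apply: contraTeq isT => x0.
have := h (Num.bound `|v x / d|); rewrite /val_ge (negPf x0) /= -ler_pdivlMr //.
by rewrite leNgt (le_lt_trans (ler_norm _)) // archi_boundP ?normr_ge0.
Qed.

Lemma val_limit_unique u l l' : val_limit v u l -> val_limit v u l' -> l = l'.
Proof.
move=> h h'; apply/eqP; rewrite -subr_eq0; apply/eqP/(@val_ge_sep 1) => // N.
have [M hM] := h N; have [M' hM'] := h' N; rewrite mulr1.
have -> : l - l' = (u (M + M')%N - l') - (u (M + M')%N - l) by ring.
by apply: val_geB; [apply: hM'; rewrite leq_addl|apply: hM; rewrite leq_addr].
Qed.

End ValuationLemmas.

(** * Integral series and congruences modulo the maximal ideal *)

Section IntegralSeries.
Variables (L : fieldType) (w : valuation L).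

Definition sint m (f : series L m) := forall k, val_ge w 0 (f k).
(** Congruence modulo the maximal ideal of w is written as [ssmall] of a difference, which avoids
    building the residue field of w. *)
Definition ssmall m (f : series L m) := forall k, val_gt w 0 (f k).

Lemma sintD m (f g : series L m) : sint f -> sint g -> sint (f + g).
Proof. by move=> hf hg k; apply: val_geD. Qed.
Lemma sintM m (f g : series L m) : sint f -> sint g -> sint (f * g).
Proof.
by move=> hf hg k; rewrite sMconv; apply: val_ge_sum => j _; apply: val_geM0.
Qed.
Lemma sint1 m : sint (1 : series L m).
Proof. by move=> k; rewrite s1; case: eqP => _; rewrite ?val_ge1 ?val_ge0. Qed.
Lemma ssmall0 m : ssmall (0 : series L m).
Proof. by move=> k; apply: val_gt0. Qed.
Lemma ssmallD m (f g : series L m) : ssmall f -> ssmall g -> ssmall (f + g).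
Proof. by move=> hf hg k; apply: val_gtD. Qed.
Lemma ssmallM m (f g : series L m) : sint f -> ssmall g -> ssmall (f * g).
Proof.
move=> hf hg k; rewrite sMconv; apply: val_gt_sum => j _.
by rewrite -[0]addr0; apply: val_gtM.
Qed.
Lemma ssmall_subM m (f f' g g' : series L m) : sint g -> sint f' ->
  ssmall (f - f') -> ssmall (g - g') -> ssmall (f * g - f' * g').
Proof.
move=> hg hf' h1 h2; have -> : f * g - f' * g' = g * (f - f') + f' * (g - g') by ring.
by apply: ssmallD; apply: ssmallM.
Qed.

(* The [y x^(n-1)]-multiple is the derivative of a product of [n] factors all
   congruent to [x]; it vanishes modulo the maximal ideal when [n] does. *)
Lemma prod_perturb m (I : eqType) (s : seq I) (A B : I -> series L m)
    (x y c : series L m) :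
  (forall i, i \in s -> sint (A i) /\ sint (B i)) -> sint x -> sint y -> ssmall c ->
  (forall i, i \in s -> ssmall (A i - x) /\ ssmall (B i - y)) ->
  exists E, [/\ \prod_(i <- s) (A i + c * B i) - \prod_(i <- s) A i = c * E, sint E
    & ssmall (E - (y * x ^+ (size s).-1) *+ size s)].
Proof.
move=> hAB hx hy hc; have sintX z n : sint z -> sint (z ^+ n : series L m).
  by move=> hz; elim: n => [|n IH]; [exact: sint1|rewrite exprS; apply: sintM].
elim: s hAB => [|i s IH] hAB hs.
  exists 0; rewrite !big_nil subrr mulr0 mulr0n subrr; split=> //; last exact: ssmall0.
  by move=> k; apply: val_ge0.
have [Ai Bi] := hAB i (mem_head _ _); have [Ax By] := hs i (mem_head _ _).
have hAB' j : j \in s -> sint (A j) /\ sint (B j).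
  by move=> js; apply: hAB; rewrite inE js orbT.
have hs' j : j \in s -> ssmall (A j - x) /\ ssmall (B j - y).
  by move=> js; apply: hs; rewrite inE js orbT.
have [E [EE Ei Es]] := IH hAB' hs'.
have Pi : sint (\prod_(j <- s) A j).
  rewrite big_seq; elim/big_ind: _ => [||j /hAB'[]//]; [exact: sint1|exact: sintM].
have Ps : ssmall (\prod_(j <- s) A j - x ^+ size s).
  elim: (s) hAB' hs' {E EE Ei Es IH Pi hAB hs} => [|j t IH] h1 h2.
    by rewrite big_nil subrr; apply: ssmall0.
  have [? ?] := h1 j (mem_head _ _); have [? ?] := h2 j (mem_head _ _).
  have h1' l : l \in t -> sint (A l) /\ sint (B l).
    by move=> js; apply: h1; rewrite inE js orbT.
  rewrite big_cons exprS; apply: ssmall_subM => //.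
    rewrite big_seq; elim/big_ind: _ => [||l /h1'[]//]; [exact: sint1|exact: sintM].
  apply: IH => // l js; apply: h2; by rewrite inE js orbT.
have ci : sint c by move=> k; apply/val_gtW/hc.
exists (B i * \prod_(j <- s) A j + (A i + c * B i) * E); split.
- rewrite !big_cons -[\prod_(j <- s) (A j + _)](subrK (\prod_(j <- s) A j)) EE.
  by ring.
- by do ![apply: sintD|apply: sintM].
have -> : (y * x ^+ (size (i :: s)).-1) *+ size (i :: s)
   = y * x ^+ size s + x * ((y * x ^+ (size s).-1) *+ size s).
  rewrite /= mulrS mulrnAr mulrCA; congr (_ + _).
  by case: (size s) => [|n]; rewrite ?mulr0n //= exprS.
rewrite opprD addrACA; apply: ssmallD.
  by apply: ssmall_subM.
rewrite mulrDl addrAC; apply: ssmallD; last first.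
  rewrite -mulrA mulrC; apply: ssmallM => //; exact: sintM.
by apply: ssmall_subM.
Qed.

End IntegralSeries.

(** * Splitting into linear factors over a ring of series *)

Section RegularDifferences.
Variable R : comNzRingType.

(** Distinctness of roots is strengthened to differences that are not zero divisors: if y is a root
    of (X - x) Q1 and x - y is regular, then y is a root of Q1. This works over any commutative
    ring. *)
Lemma regular_prod_XsubC (Q : {poly R}) (s : seq R) :
  (forall x, x \in s -> root Q x) ->
  pairwise (fun x y => `[< forall z, (x - y) * z = 0 -> z = 0 >]) s ->
  Q \is monic -> size Q = (size s).+1 -> Q = \prod_(x <- s) ('X - x%:P).
Proof.
elim: s Q => [|x s IH] Q rQ ps mQ sQ.
  rewrite big_nil; have /size_poly1P[c c0 QE] : size Q == 1%N by rewrite sQ.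
  by move: mQ; rewrite QE monicE lead_coefC => /eqP->.
have /factor_theorem[Q1 QE] := rQ x (mem_head _ _).
have mQ1 : Q1 \is monic by move: mQ; rewrite QE monicMr ?monicXsubC.
have sQ1 : size Q1 = (size s).+1.
  by move: sQ; rewrite QE size_Mmonic ?monicXsubC ?monic_neq0 // size_XsubC addn2 => -[].
move: ps; rewrite /= => /andP[/allP hx ps].
rewrite big_cons mulrC QE; congr (_ * _); apply: IH => // y ys.
have := rQ y (mem_behead (s := x :: s) ys); rewrite !rootE QE hornerM hornerXsubC => /eqP h.
apply/eqP; have /asboolP := hx y ys; apply.
by rewrite -opprB mulNr mulrC h oppr0.
Qed.

End RegularDifferences.

(** The coefficients of g vanish one after the other because the constant term of f is invertible.
    This is applied to differences of translates. *)
Lemma series_regular (L : fieldType) (f g : series L 1) :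
  coef1 f 0 != 0 -> f * g = 0 -> g = 0.
Proof.
move=> f0 fg; apply: s1P => n; elim/ltn_ind: n => n IH.
have := congr1 (fun h => coef1 h n) fg; rewrite coef1M coef1z big_ord_recl subn0.
rewrite big1 => [|i _]; last first.
  have h : (n - lift ord0 i < n)%N by rewrite lift0; have := ltn_ord i; lia.
  by rewrite [coef1 g _]IH // coef1z mulr0.
by rewrite addr0 => /eqP; rewrite mulf_eq0 (negPf f0) => /eqP.
Qed.

(** Turns a repetition in a list of roots into a visible square factor, to be refuted by
    [root_simple]. *)
Lemma nuniq_perm (I : eqType) (s : seq I) : ~~ uniq s ->
  exists z t, perm_eq s (z :: z :: t).
Proof.
elim: s => [//|x s IH] /=; case: (boolP (x \in s)) => [xs _|xs /IH[z [t zt]]].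
  by exists x, (rem x s); rewrite perm_cons perm_to_rem.
exists z, (x :: t); apply: (@perm_trans _ (x :: z :: z :: t)); first by rewrite perm_cons.
by apply/permPl; apply: (perm_catCA [:: x] [:: z; z] t).
Qed.

(** * Values of series at the zeros of a distinguished polynomial *)

Section Evaluation.
Variables (p : nat) (O : comNzRingType) (cO : padic_complete p O).
Variables (L : fieldType) (w : valuation L) (e : {rmorphism O -> L}).
Hypotheses (p0 : p%:R != 0 :> L) (wp : w p%:R = 1).
Hypothesis e_int : forall x, val_ge w 0 (e x).
Local Notation T := (sT O).
Local Notation pdvd := (pdvd p).

Lemma pdvd_val N x : pdvd N x -> val_ge w N%:R (e x).
Proof.
move=> [y ->]; rewrite rmorphM rmorphXn rmorph_nat -[N%:R]addr0; apply: val_geM => //.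
by rewrite /val_ge valuationX // wp mulr1 lexx orbT.
Qed.

Variables (q : nat) (P : {poly O}) (a E : series O 1).
Hypotheses (mP : P \is monic) (sP : size P = q.+1).
Hypothesis (pP : forall i, (i < q)%N -> pdvd 1 P`_i).
Hypotheses (PE : pser P = a * E) (E1 : pdvd 1 (E - 1)).
Hypothesis (divP : forall f, exists R Q, f = pser R + a * Q).

Lemma divP_unit : exists E', [/\ E * E' = 1, a = pser P * E' &
   forall f, exists R Q, f = pser R + pser P * Q].
Proof.
have [E' EE'] := punit (padic_complete_series 1 cO) E1.
have aE : a = pser P * E' by rewrite PE -mulrA EE' mulr1.
exists E'; split=> // f; have [R [Q ->]] := divP f.
by exists R, (E' * Q); rewrite mulrA -aE.
Qed.

Section Root.
Variables (lam : L) (rlam : root (map_poly e P) lam).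

(** If w(lam) <= 0, every lower term of P(lam) has valuation at least 1 + q w(lam), whereas lam^q,
    which they cancel, has valuation q w(lam). *)
Lemma root_val_gt0 : val_gt w 0 lam.
Proof.
rewrite /val_gt; have [//|l0] := eqVneq lam 0; rewrite /= ltNge; apply/negP => wl.
have := rlam; rewrite rootE horner_coef size_map_poly_id0; last first.
  by rewrite (monicP mP) rmorph1 oner_neq0.
have lc : (map_poly e P)`_q = 1.
  by rewrite coef_map /=; have := monicP mP; rewrite lead_coefE sP /= => ->; rewrite rmorph1.
rewrite sP big_ord_recr /= lc addrC addr_eq0 mul1r => /eqP lqE.
have : val_ge w (1 + q%:R * w lam) (lam ^+ q).
  rewrite lqE val_geN; apply: val_ge_sum => i _; rewrite coef_map.
  apply: val_geM; first by have := pdvd_val (pP (ltn_ord i)).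
  rewrite /val_ge valuationX // ler_wnM2r ?orbT // ler_nat ltnW //.
rewrite /val_ge expf_eq0 (negPf l0) andbF valuationX //= gerDr.
by rewrite ler10.
Qed.

Lemma root_val_ge : exists2 d, 0 < d & val_ge w d lam.
Proof.
have := root_val_gt0; rewrite /val_gt; case: eqP => [->|_] /= h.
  by exists 1 => //; apply: val_ge0.
by exists (w lam) => //; rewrite /val_ge lexx orbT.
Qed.

Lemma lam_int : val_ge w 0 lam. Proof. exact: val_gtW root_val_gt0. Qed.

Lemma horner_int (R : {poly O}) : val_ge w 0 (map_poly e R).[lam].
Proof.
rewrite horner_coef; apply: val_ge_sum => i _; rewrite coef_map.
by apply: val_geM0; [exact: e_int|apply: val_geX0; exact: lam_int].
Qed.

(* Truncating [Q] in degree [N] changes [P Q] by a multiple of ['X^N], so the value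
   of [R] at [lam] has valuation at least [N * w lam] for every [N]. *)
Lemma horner_multiple R Q : pser R = pser P * Q -> (map_poly e R).[lam] = 0.
Proof.
move=> RPQ; have [d d0 dl] := root_val_ge; apply: (val_ge_sep d0) => N.
pose QN := \poly_(i < N) coef1 Q i; pose S := P * QN - R.
have SE : S = drop_poly N S * 'X^N.
  rewrite -[S in LHS](poly_take_drop N) [take_poly N S](_ : _ = 0) ?add0r //.
  apply/polyP => i; rewrite coef_take_poly coef0; case: ifP => // iN.
  rewrite coefB -[R`_i]coef1_pser RPQ coef1M coefM -sumrB big1 // => j _.
  rewrite coef1_pser coef_poly ifT ?subrr //.
  by apply: leq_ltn_trans iN; apply: leq_subr.
have -> : (map_poly e R).[lam] = - (map_poly e S).[lam].
  by rewrite rmorphB rmorphM /= hornerD hornerN hornerM (rootP rlam) mul0r add0r opprK.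
rewrite val_geN SE rmorphM /= map_polyXn hornerM hornerXn -[N%:R * d]add0r.
by apply: val_geM; [apply: horner_int|apply: val_geX].
Qed.

End Root.

Definition rem_poly f : {poly O} := projT1 (cid (divP f)).

Lemma rem_polyP f : exists Q, f = pser (rem_poly f) + pser P * Q.
Proof.
have [E' [EE' aE _]] := divP_unit; rewrite /rem_poly; case: cid => R /= [Q fE].
by exists (E' * Q); rewrite mulrA -aE.
Qed.

(** The value f(lam), defined by division: f is its remainder modulo P, and P vanishes at lam. By
    [horner_multiple] all remainders have the same value at lam, so the choice made in [rem_poly] is
    immaterial. *)
Definition ev (lam : L) f : L := (map_poly e (rem_poly f)).[lam].

Section EvalMorphism.
Variables (lam : L) (rlam : root (map_poly e P) lam).
Local Notation ev := (ev lam).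

Lemma evE f R Q : f = pser R + pser P * Q -> ev f = (map_poly e R).[lam].
Proof.
move=> fE; apply/eqP; rewrite -subr_eq0 -hornerN -hornerD -rmorphB; apply/eqP.
have [Q' fE'] := rem_polyP f; apply: (@horner_multiple _ rlam _ (Q - Q')).
move: fE'; set r := rem_poly f => fE'.
have -> : pser (r - R) = (f - pser P * Q') - (f - pser P * Q).
  by rewrite {1}fE' fE !addrK rmorphB.
by ring.
Qed.

Lemma ev_pser R : ev (pser R) = (map_poly e R).[lam].
Proof. by apply: (@evE _ _ 0); rewrite mulr0 addr0. Qed.

Lemma evB f g : ev (f - g) = ev f - ev g.
Proof.
have [Q fE] := rem_polyP f; have [Q' gE] := rem_polyP g.
rewrite (@evE _ (rem_poly f - rem_poly g) (Q - Q')).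
  by rewrite rmorphB hornerD hornerN.
by rewrite rmorphB /= mulrBr addrACA -opprD -fE -gE.
Qed.

Lemma evM f g : ev (f * g) = ev f * ev g.
Proof.
have [Q fE] := rem_polyP f; have [Q' gE] := rem_polyP g.
rewrite (@evE _ (rem_poly f * rem_poly g) (pser (rem_poly f) * Q' + Q * g)).
  by rewrite rmorphM hornerM.
rewrite rmorphM /= {1}fE mulrDl mulrDr [in X in X + _ = _]gE.
by rewrite mulrDr -addrA; congr (_ + _); rewrite mulrCA -mulrA.
Qed.

Lemma ev1 : ev 1 = 1.
Proof.
by rewrite -(rmorph1 (@pser O)) ev_pser rmorph1 hornerC.
Qed.

(** As for [subst], the root hypothesis is an argument so that the morphism structure can be
    declared. *)
Definition evm of root (map_poly e P) lam := ev.
Fact evm_is_zmod_morphism : zmod_morphism (evm rlam).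
Proof. exact: evB. Qed.
Fact evm_is_monoid_morphism : monoid_morphism (evm rlam).
Proof. by split; [exact: ev1|exact: evM]. Qed.
HB.instance Definition _ :=
  GRing.isZmodMorphism.Build (series O 1) L (evm rlam) evm_is_zmod_morphism.
HB.instance Definition _ :=
  GRing.isMonoidMorphism.Build (series O 1) L (evm rlam) evm_is_monoid_morphism.

Lemma evD f g : ev (f + g) = ev f + ev g. Proof. exact: (rmorphD (evm rlam)). Qed.
Lemma ev0 : ev 0 = 0. Proof. exact: (rmorph0 (evm rlam)). Qed.
Lemma evXn f n : ev (f ^+ n) = ev f ^+ n. Proof. exact: (rmorphXn (evm rlam)). Qed.
Lemma ev_sum (I : Type) (r : seq I) (Q : pred I) (f : I -> series O 1) :
  ev (\sum_(i <- r | Q i) f i) = \sum_(i <- r | Q i) ev (f i).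
Proof. exact: (rmorph_sum (evm rlam)). Qed.
Lemma ev_const c : ev (sconst c) = e c.
Proof. by rewrite -pserC ev_pser map_polyC hornerC. Qed.
Lemma ev_sT : ev T = lam.
Proof. by rewrite -pserX ev_pser map_polyX hornerX. Qed.
Lemma ev_a : ev a = 0.
Proof.
have [E' [_ -> _]] := divP_unit; rewrite evM ev_pser (rootP rlam) mul0r //.
Qed.

Lemma ev_int f : val_ge w 0 (ev f).
Proof. exact: horner_int. Qed.

Lemma ev_unit_neq0 f g : f * g = 1 -> ev f != 0.
Proof.
move=> fg; apply/eqP => f0; have := ev1; rewrite -fg evM f0 mul0r => /eqP.
by rewrite eq_sym oner_eq0.
Qed.

Lemma ev_split N f :
  ev f = \sum_(i < N) e (coef1 f i) * lam ^+ i + lam ^+ N * ev (sshift N f).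
Proof.
rewrite {1}[f](s1_split _ N) evD evM evXn ev_sT ev_sum; congr (_ + _).
by apply: eq_bigr => i _; rewrite evM ev_const evXn ev_sT.
Qed.

Lemma ev_comp_split N f g : g 0%MM = 0 ->
  ev (comp1 f g) = \sum_(i < N) e (coef1 f i) * ev g ^+ i
     + ev g ^+ N * ev (comp1 (sshift N f) g).
Proof.
move=> g0; rewrite {1}[comp1 f g](comp1_split g0 _ N) evD evM evXn ev_sum.
by congr (_ + _); apply: eq_bigr => i _; rewrite evM ev_const evXn.
Qed.

Lemma ev_val_gt0 g : g 0%MM = 0 -> val_gt w 0 (ev g).
Proof.
move=> g0; rewrite (ev_split 1) big_ord1 expr0 mulr1 expr1 coef1_0 g0 rmorph0 add0r.
rewrite mulrC -[0]addr0; apply: val_gtM; [exact: ev_int|exact: root_val_gt0].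
Qed.

(** Ties the algebraic value to the limits in [is_translate]: the tail is ev(g)^m times an integral
    element, and ev(g) has positive valuation. *)
Lemma ev_comp_limit f g : g 0%MM = 0 ->
  val_limit w (fun N => \sum_(j < N) e (coef1 f j) * ev g ^+ j) (ev (comp1 f g)).
Proof.
move=> g0 N; have := ev_val_gt0 g0; rewrite /val_gt.
have [gz _|gz /= wg] := eqVneq (ev g) 0.
  (* If ev(g) = 0 its valuation carries no information, but the tail already vanishes for m >= 1. *)
  exists 1%N => m m1; rewrite (ev_comp_split m _ g0) opprD addrA subrr add0r gz.
  by rewrite expr0n gtn_eqF // mul0r oppr0 val_ge0.
exists (Num.bound (N%:R / w (ev g))) => m hm.
rewrite (ev_comp_split m _ g0) opprD addrA subrr add0r val_geN mulrC -[N%:R]add0r.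
apply: val_geM; first exact: ev_int.
rewrite /val_ge valuationX // -ler_pdivrMr // ltW ?orbT //.
have /archi_boundP h : 0 <= N%:R / w (ev g) by rewrite divr_ge0 // ltW.
by apply: lt_le_trans h _; rewrite ler_nat.
Qed.

(** The series H(T, lam). *)
Definition evx (H : series O 2) : series L 1 := series1 (fun i => ev (row i H)).

Lemma coef1_evx H i : coef1 (evx H) i = ev (row i H).
Proof. exact: coef1_series1. Qed.

Lemma evxB H K : evx (H - K) = evx H - evx K.
Proof. by apply: s1P => i; rewrite coef1B !coef1_evx rowB evB. Qed.
Lemma evxD H K : evx (H + K) = evx H + evx K.
Proof. by apply: s1P => i; rewrite coef1D !coef1_evx rowD evD. Qed.
Lemma evxM H K : evx (H * K) = evx H * evx K.
Proof.
apply: s1P => i; rewrite coef1M coef1_evx rowM ev_sum.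
by apply: eq_bigr => j _; rewrite evM !coef1_evx.
Qed.
Lemma evx_const c : evx (sconst c) = sconst (e c).
Proof.
apply: s1P => i; rewrite coef1_evx row_const coef1_const.
by case: eqP => _; rewrite ?ev_const ?ev0.
Qed.
Lemma evx1 : evx 1 = 1.
Proof. by rewrite -(rmorph1 (@sconst O 2)) evx_const rmorph1. Qed.
Lemma evx_inX f : evx (inX f) = smap e f.
Proof. by apply: s1P => i; rewrite coef1_evx rowX ev_const. Qed.
Lemma evx_inY f : evx (inY f) = sconst (ev f).
Proof.
apply: s1P => i; rewrite coef1_evx rowY coef1_const.
by case: eqP => _; rewrite ?ev0.
Qed.

Definition evxm of root (map_poly e P) lam := evx.
Fact evxm_is_zmod_morphism : zmod_morphism (evxm rlam).
Proof. exact: evxB. Qed.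
Fact evxm_is_monoid_morphism : monoid_morphism (evxm rlam).
Proof. by split; [exact: evx1|exact: evxM]. Qed.
HB.instance Definition _ :=
  GRing.isZmodMorphism.Build (series O 2) (series L 1) (evxm rlam) evxm_is_zmod_morphism.
HB.instance Definition _ :=
  GRing.isMonoidMorphism.Build (series O 2) (series L 1) (evxm rlam) evxm_is_monoid_morphism.

Lemma evxXn H n : evx (H ^+ n) = evx H ^+ n. Proof. exact: (rmorphXn (evxm rlam)). Qed.
Lemma evx_sum (I : Type) (r : seq I) (Q : pred I) (f : I -> series O 2) :
  evx (\sum_(i <- r | Q i) f i) = \sum_(i <- r | Q i) evx (f i).
Proof. exact: (rmorph_sum (evxm rlam)). Qed.

Lemma evx_int H k : val_ge w 0 (evx H k).
Proof. by rewrite -(mnm1_ord0 k) -/(coef1 _ _) coef1_evx ev_int. Qed.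

(* Evaluating [H(u(T), u(X))] at [X = lam] is evaluating [H] at [X = u(lam)],
   and then substituting [u(T)] for [T]. *)
Lemma evx_comp2 H u : u 0%MM = 0 ->
  evx (comp2 H (inX u) (inY u)) =
    comp1 (series1 (fun i => ev (comp1 (row i H) u))) (smap e u).
Proof.
move=> u0; have X0 : inX u 0%MM = 0 by rewrite /inX comp1_zc ?svar0.
have Y0 : inY u 0%MM = 0 by rewrite /inY comp1_zc ?svar0.
have eu0 : smap e u 0%MM = 0 by rewrite /smap u0 rmorph0.
apply: s1P => n; rewrite [RHS](@comp1E _ _ _ eu0 _ _ n.+1) ?mdeg_mnm1 //.
rewrite {1}[H](s2_split _ n.+1) comp2D // comp2M // comp2Xn // comp2X // comp2_sum //.
rewrite evxD evxM evxXn evx_inX evx_sum coef1D.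
rewrite [X in _ + X](@sordgeM _ _ n.+1 0) ?addr0 ?addn0 ?mdeg_mnm1 //; last exact: sordgeX.
rewrite coef1_sum; apply: eq_bigr => i _.
rewrite comp2M // comp2Xn // comp2X // comp2_inY // evxM evxXn evx_inX.
have -> : comp1 (row i H) (inY u) = inY (comp1 (row i H) u).
  by rewrite /inY comp1A ?svar0.
by rewrite evx_inY coef1CM coef1_series1.
Qed.

Variables (F : series O 2) (FP : is_fgl F) (aF : is_fgl_hom F F a).
Local Notation Y := (svar O (@Ordinal 2 1 isT)).

(* The series [f(F(T, lam))]. *)
Definition trans f : series L 1 := evx (comp1 f F).

Let F0 : F 0%MM = 0 := fgl_zconst FP.
Let a0 : a 0%MM = 0. Proof. by case: aF. Qed.

(** F(X, 0) = X, so f(F) and f(X) differ by a multiple of Y. Putting Y = lam gives the congruence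
    [trans_small]; putting Y = a(lam) = 0 gives the invariance [trans_comp_endo]. *)
Lemma comp1_fgl_split f : exists H, comp1 f F = inX f + Y * H.
Proof.
have [H HE] := s2_splitY (comp1 f F); exists H; rewrite {1}HE; congr (inX _ + _).
have := congr1 (fun h => comp2 h T 0) HE.
rewrite comp2D ?sT0 // comp2M ?sT0 // comp2Y ?sT0 // mul0r addr0.
rewrite comp2_inX ?sT0 // comp1_id comp2_comp1 ?sT0 // fgl_0r ?sT0 //.
by rewrite comp1_id => <-.
Qed.

Lemma transB f g : trans (f - g) = trans f - trans g.
Proof. by rewrite /trans comp1B // evxB. Qed.
Lemma transM f g : trans (f * g) = trans f * trans g.
Proof. by rewrite /trans comp1M // evxM. Qed.
Lemma trans1 : trans 1 = 1.
Proof. by rewrite /trans comp1_1 // evx1. Qed.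

Definition transm of root (map_poly e P) lam := trans.
Fact transm_is_zmod_morphism : zmod_morphism (transm rlam).
Proof. exact: transB. Qed.
Fact transm_is_monoid_morphism : monoid_morphism (transm rlam).
Proof. by split; [exact: trans1|exact: transM]. Qed.
HB.instance Definition _ :=
  GRing.isZmodMorphism.Build (series O 1) (series L 1) (transm rlam) transm_is_zmod_morphism.
HB.instance Definition _ :=
  GRing.isMonoidMorphism.Build (series O 1) (series L 1) (transm rlam) transm_is_monoid_morphism.

Lemma transD f g : trans (f + g) = trans f + trans g.
Proof. exact: (rmorphD (transm rlam)). Qed.
Lemma transXn f n : trans (f ^+ n) = trans f ^+ n.
Proof. exact: (rmorphXn (transm rlam)). Qed.
Lemma trans_nat n : trans n%:R = n%:R.
Proof. exact: (rmorph_nat (transm rlam)). Qed.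
Lemma trans_sum (I : Type) (r : seq I) (Q : pred I) (f : I -> series O 1) :
  trans (\sum_(i <- r | Q i) f i) = \sum_(i <- r | Q i) trans (f i).
Proof. exact: (rmorph_sum (transm rlam)). Qed.
Lemma trans_const c : trans (sconst c) = sconst (e c).
Proof. by rewrite /trans comp1_const // evx_const. Qed.

Lemma trans_int f : sint w (trans f).
Proof. by move=> k; apply: evx_int. Qed.

Lemma evx_Y : evx Y = sconst lam.
Proof. by rewrite -[Y](comp1_sT (svar0 _ _)) evx_inY ev_sT. Qed.

Lemma trans_small f : ssmall w (trans f - smap e f).
Proof.
have [H HE] := comp1_fgl_split f; rewrite /trans HE evxD evx_inX addrAC subrr add0r.
rewrite evxM evx_Y mulrC; apply: ssmallM; first by move=> k; apply: evx_int.
move=> k; rewrite /sconst; case: eqP => _; rewrite ?mulr1n ?mulr0n ?val_gt0 //.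
exact: root_val_gt0.
Qed.

(** a(F(T, lam)) = F(a(T), a(lam)) = a(T) since a(lam) = 0: series in a are invariant under
    translation by torsion points. *)
Lemma trans_comp_endo c : trans (comp1 c a) = smap e (comp1 c a).
Proof.
have X0 : inX a 0%MM = 0 by rewrite /inX comp1_zc ?svar0.
have Y0 : inY a 0%MM = 0 by rewrite /inY comp1_zc ?svar0.
have [H HE] := comp1_fgl_split c.
have [_ aE] := (is_fgl_homE F F a).1 aF.
rewrite /trans comp1A // aE -comp2_comp1 // HE comp2D // comp2M // comp2Y //.
rewrite comp2_inX // -/(inX a) evxD evxM evx_inY ev_a rmorph0 mul0r addr0.
have -> : comp1 c (inX a) = inX (comp1 c a) by rewrite /inX comp1A ?svar0.
exact: evx_inX.
Qed.

Lemma coef1_trans0 f : coef1 (trans f) 0 = ev f.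
Proof.
rewrite coef1_evx; congr ev; have := congr1 (fun h => comp2 h 0 T) (s2_split1 (comp1 f F)).
rewrite comp2D ?sT0 // comp2M ?sT0 // comp2X ?sT0 // mul0r addr0.
rewrite comp2_inY ?sT0 // comp1_id comp2_comp1 ?sT0 // fgl_0l ?sT0 //.
by rewrite comp1_id => <-.
Qed.

Lemma trans_pser R : trans (pser R) = (map_poly (@sconst L 1) (map_poly e R)).[trans T].
Proof.
have sz (A B : nzRingType) (g : A -> B) (Q : {poly A}) : (size (map_poly g Q) <= size Q)%N.
  exact: size_poly.
rewrite (horner_coef_wide _ (leq_trans (sz _ _ _ _) (sz _ _ _ R))).
rewrite -{1}[R]coefK poly_def !rmorph_sum /= trans_sum.
apply: eq_bigr => i _; rewrite -mul_polyC rmorphM /= pserC rmorphXn /= pserX.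
by rewrite transM transXn trans_const !coef_map.
Qed.

(* [trans] fixes [a], so the coefficient of [T] in [trans (a * E)] is [p * ev E],
   which a double root of [P] would annihilate. *)
Lemma root_simple S : coef1 a 1 = p%:R -> map_poly e P <> ('X - lam%:P) ^+ 2 * S.
Proof.
move=> a1 PS; have := trans_pser P; rewrite PE PS transM.
have aT : comp1 T a = a by rewrite comp1_sT.
rewrite -[in trans a]aT trans_comp_endo aT rmorphM rmorphXn rmorphB /= map_polyX map_polyC /=.
rewrite hornerM horner_exp hornerXsubC => /(congr1 (fun h => coef1 h 1)).
have z0 : (trans T - sconst lam) 0%MM = 0.
  by rewrite sB -!coef1_0 coef1_trans0 ev_sT coef1_const subrr.
rewrite [RHS](@sordgeM _ _ 2 0) ?addn0 ?mdeg_mnm1 //; last exact: sordgeX.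
rewrite coef1M big_ord_recl big_ord1 /= !coef1_smap coef1_0 a0 rmorph0 mul0r add0r.
rewrite a1 rmorph_nat coef1_trans0 => /eqP; rewrite mulf_eq0 (negPf p0) /=.
by have [E' [EE' _ _]] := divP_unit; rewrite (negPf (ev_unit_neq0 EE')).
Qed.

End EvalMorphism.

Section Roots.
Variables (F : series O 2) (FP : is_fgl F) (aF : is_fgl_hom F F a).
Hypothesis a1 : coef1 a 1 = p%:R.

Lemma roots_enum (s : seq L) : map_poly e P = \prod_(z <- s) ('X - z%:P) ->
  [/\ uniq s, size s = q & forall x, (x \in s) = root (map_poly e P) x].
Proof.
move=> sE; have lP : e (lead_coef P) != 0 by rewrite (monicP mP) rmorph1 oner_neq0.
have rs x : (x \in s) = root (map_poly e P) x by rewrite sE root_prod_XsubC.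
split=> //; last first.
  by have := size_map_poly_id0 lP; rewrite sE size_prod_XsubC sP => -[].
apply/negPn/negP => /nuniq_perm[z [t zt]].
have rz : root (map_poly e P) z by rewrite -rs (perm_mem zt) mem_head.
apply: (root_simple rz FP aF (S := \prod_(x <- t) ('X - x%:P)) a1).
by rewrite sE (perm_big _ zt) /= !big_cons mulrA -expr2.
Qed.

End Roots.

(** * The norm operator and its fixed point *)

Section Norm.
Implicit Types (u g : series O 1).
(** The form in which unramifiedness is used: a strict gain of valuation on elements of [O] is a
    gain of a whole factor p. *)
Hypothesis e_gt : forall N x, val_gt w N%:R (e x) -> pdvd N.+1 x.
Hypotheses (q0 : (0 < q)%N) (qp : pdvd 1 (q%:R : O)).
Hypothesis (sgn_q : pdvd 1 ((-1) ^+ q.+1 - 1 : O)).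
Variables (F : series O 2) (FP : is_fgl F) (aF : is_fgl_hom F F a).
Hypothesis aT : pdvd 1 (a - T ^+ q).
Variables (s : seq L) (us : uniq s) (ss : size s = q).
Hypothesis rs : forall x, (x \in s) = root (map_poly e P) x.
Local Notation trans x := (trans x F).

Let rx x : x \in s -> root (map_poly e P) x. Proof. by rewrite rs. Qed.
Let a0 : a 0%MM = 0. Proof. by case: aF. Qed.

(** T = sum of d_i(a) u^i by [weierstrass_basis], and a vanishes at the torsion points, so x = sum
    of d_i(0) u(x)^i is determined by u(x). *)
Lemma ev_inj u x y : pdvd 1 (u - T) -> x \in s -> y \in s -> ev x u = ev y u -> x = y.
Proof.
move=> uT xs ys uxy; have [d dE] := weierstrass_basis cO q0 a0 aT uT T.
have evd z : z \in s -> z = \sum_(i < q) e (coef1 (d i) 0) * ev z u ^+ i.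
  move=> /rx rz; rewrite -{1}(ev_sT rz) {1}dE (ev_sum rz).
  apply: eq_bigr => i _; rewrite (evM rz) (evXn rz) (ev_comp_split rz 1 _ a0) big_ord1.
  by rewrite (ev_a rz) mul0r addr0 mulr1.
by rewrite (evd x xs) (evd y ys); apply: eq_bigr => i _; rewrite uxy.
Qed.

Definition norm u : series L 1 := \prod_(x <- s) trans x u.

(* The [trans x u] are the [q] distinct roots of [Z^q - \sum_i c_i(a) Z^i], where
   [u^q = \sum_i c_i(a) u^i]; the norm is read off the constant coefficient. *)
Lemma norm_descends u : u 0%MM = 0 -> pdvd 1 (u - T) ->
  exists g, [/\ g 0%MM = 0, pdvd 1 (g - T) & norm u = smap e (comp1 g a)].
Proof.
move=> u0 uT; have [c [cE c0T cp]] := weierstrass_power cO q0 a0 aT uT.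
have c00 : c 0%N 0%MM = 0.
  have := congr1 (fun f : series O 1 => f 0%MM) cE.
  rewrite sX0 u0 expr0n gtn_eqF // s_sum (bigD1 (Ordinal q0)) //= mulr1 comp1_zc //.
  rewrite big1 => [|i]; first by rewrite addr0.
  by rewrite -val_eqE /= => i0; rewrite sM0 sX0 u0 expr0n (negPf i0) mulr0.
(* At Z = 0 the polynomial is -c_0(a), and also (-1)^q times the norm, whence the sign. It is 1
   modulo p, which keeps the series congruent to T. *)
exists (sconst ((-1) ^+ q.+1) * c 0%N); split.
- by rewrite sM0 c00 mulr0.
- rewrite -[T in _ - T]mul1r; apply: pdvd_subM => //.
  rewrite -(rmorph1 (@sconst O 1)) -rmorphB; exact: pdvd_rmorph sgn_q.
pose R := \poly_(i < q) smap e (comp1 (c i) a).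
have sR : (size R <= q)%N by apply: size_poly.
have sQ : size ('X^q - R) = q.+1.
  by rewrite size_polyDl ?size_polyXn // size_polyN ltnS.
have mQ : 'X^q - R \is monic.
  by rewrite monicE lead_coefE sQ /= coefB coefXn eqxx coef_poly ltnn subr0.
have QE : 'X^q - R = \prod_(x <- [seq trans x u | x <- s]) ('X - x%:P).
  apply: regular_prod_XsubC => //; last by rewrite size_map ss.
    move=> f /mapP[x /rx rz ->]; rewrite rootE hornerD hornerN hornerXn.
    rewrite -(transXn rz FP) {1}cE (trans_sum rz FP).
    rewrite subr_eq0 (horner_coef_wide _ sR); apply/eqP/eq_bigr => i _.
    by rewrite coef_poly ltn_ord (transM rz FP) (transXn rz FP) (trans_comp_endo rz FP aF).
  (* The constant term of [trans x u] is u(F(0, x)) = u(x). These values are distinct by [ev_inj],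
     so the differences are regular. *)
  rewrite pairwise_map; apply/(pairwiseP 0) => i j; rewrite !inE => si sj ij /=.
  apply/asboolP => z; apply: series_regular; rewrite coef1B.
  have ts k : (k < size s)%N -> coef1 (trans (nth 0 s k) u) 0 = ev (nth 0 s k) u.
    by move=> sk; apply: coef1_trans0.
  rewrite !ts // subr_eq0; apply/eqP => /(ev_inj uT (mem_nth 0 si) (mem_nth 0 sj)) /eqP.
  by rewrite nth_uniq // ltn_eqF.
have := congr1 (fun Q => Q.[0]) QE.
rewrite hornerD hornerN hornerXn expr0n gtn_eqF // add0r horner_coef0 coef_poly q0.
rewrite horner_prod big_map; under eq_bigr do rewrite hornerXsubC sub0r -mulN1r.
rewrite big_split /= big_const_seq count_predT ss iter_mulr_1 -/(norm u) => NE.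
have cst : smap e (sconst ((-1) ^+ q.+1)) = (-1) ^+ q.+1 :> series L 1.
  by rewrite smap_const !rmorphXn /= !rmorphN1.
rewrite comp1M // comp1_const // rmorphM /= cst exprS -mulrA mulN1r -mulrN NE mulrA.
by rewrite -exprMn mulrNN mulr1 expr1n mul1r.
Qed.

(** With u = u' + p^(N+1) d, the norms differ by p^(N+1) D. Since translation is trivial modulo the
    maximal ideal, D is there q d u'^(q-1), which is zero because p divides q. *)
Lemma norm_contract N u u' : pdvd N.+1 (u - u') ->
  forall k, val_gt w N.+1%:R ((norm u - norm u') k).
Proof.
move=> [d dE]; have uE : u = u' + p%:R ^+ N.+1 * d by rewrite -dE subrKC.
have psmall : ssmall w (p%:R ^+ N.+1 : series L 1).
  move=> k; rewrite -[_ ^+ _]mulr1 spM s1; case: eqP => _; last by rewrite mulr0 val_gt0.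
  by rewrite mulr1 /val_gt valuationX // wp mulr1 ltr0n orbT.
have nE : norm u = \prod_(x <- s) (trans x u' + p%:R ^+ N.+1 * trans x d).
  rewrite /norm big_seq [RHS]big_seq; apply: eq_bigr => x /rx rz.
  by rewrite uE (transD rz FP) (transM rz FP) (transXn rz FP) (trans_nat rz FP).
have eint (f : series O 1) : sint w (smap e f) by move=> k; apply: e_int.
have [D [DE Di Ds]] := @prod_perturb L w 1 L s (fun x => trans x u') (fun x => trans x d)
  (smap e u') (smap e d) (p%:R ^+ N.+1)
  (fun x xs => conj (trans_int (rx xs) F u') (trans_int (rx xs) F d)) (eint _) (eint _) psmall
  (fun x xs => conj (trans_small (rx xs) FP u') (trans_small (rx xs) FP d)).
move=> k; rewrite nE DE spM -[N.+1%:R]addr0; apply: val_gtM.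
  by rewrite /val_ge valuationX // wp mulr1 lexx orbT.
suff : ssmall w D by apply.
rewrite -[D](subrK ((smap e d * smap e u' ^+ (size s).-1) *+ size s)).
apply: ssmallD => // j; rewrite ss -rmorphXn -rmorphM -rmorphMn /= -mulr_natl /smap natsM.
apply: (@val_ge_gt _ _ 1); first exact: ltr01.
by apply: (pdvd_val (N := 1)); apply: pdvdMr.
Qed.

(** The norms now come from [O], so [e_gt] improves a valuation above N + 1 to divisibility by
    p^(N+2), and [pdvd_comp1_inj] passes from g(a) and g'(a) to g and g'. *)
Lemma norm_contract_descended N u u' g g' : pdvd N.+1 (u - u') ->
  norm u = smap e (comp1 g a) -> norm u' = smap e (comp1 g' a) -> pdvd N.+2 (g - g').
Proof.
move=> uu' ug ug'; apply: (pdvd_comp1_inj cO q0 a0 aT); apply/pdvd_seriesP => k.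
apply: e_gt; have := norm_contract uu' k.
by rewrite ug ug' comp1B // -rmorphB.
Qed.

Lemma norm_fixed_unique u u' : pdvd 1 (u - T) -> pdvd 1 (u' - T) ->
  norm u = smap e (comp1 u a) -> norm u' = smap e (comp1 u' a) -> u = u'.
Proof.
move=> uT u'T hu hu'; apply/eqP; rewrite -subr_eq0; apply/eqP.
apply: (psep (padic_complete_series 1 cO)) => N.
suff : pdvd N.+1 (u - u') by apply: pdvd_leq.
elim: N => [|N IH]; first exact: pdvd_trans uT (pdvd_sym u'T).
exact: norm_contract_descended IH hu hu'.
Qed.

Lemma norm_fixed_exists :
  exists u, [/\ u 0%MM = 0, pdvd 1 (u - T) & norm u = smap e (comp1 u a)].
Proof.
have cS := padic_complete_series 1 cO.
(* The norm operator as a total function, unconstrained outside the series T mod p without constant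
   term. *)
have /choice[G GP] : forall u, exists g, u 0%MM = 0 -> pdvd 1 (u - T) ->
    [/\ g 0%MM = 0, pdvd 1 (g - T) & norm u = smap e (comp1 g a)].
  move=> u; have [[u0 uT]|h] := EM (u 0%MM = 0 /\ pdvd 1 (u - T)).
    by have [g] := norm_descends u0 uT; exists g.
  by exists 0 => u0 uT; case: h.
pose v n := iter n G T.
have vP n : v n 0%MM = 0 /\ pdvd 1 (v n - T).
  elim: n => [|n [h1 h2]] /=; last by have [] := GP _ h1 h2.
  by rewrite sT0 subrr; split=> //; apply: pdvd0.
have vN n : norm (v n) = smap e (comp1 (v n.+1) a).
  by have [h1 h2] := vP n; have [] := GP _ h1 h2.
have vc n : pdvd n.+1 (v n.+1 - v n).
  elim: n => [|n IH]; last exact: norm_contract_descended IH (vN _) (vN _).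
  by have [_ h1] := vP 1%N; have [_ h2] := vP 0%N; apply: pdvd_trans h1 (pdvd_sym h2).
have [u uP] := plim cS (fun n => pdvd_leq (leqnSn n) (vc n)).
have u0 : u 0%MM = 0.
  apply: (psep cO) => N; have := (pdvd_seriesP p N _).1 (uP N) 0%MM.
  by rewrite sB (vP N).1 subr0.
have uT : pdvd 1 (u - T) by apply: pdvd_trans (uP 1%N) (vP 1%N).2.
(* The limit is fixed: g and u both agree with the iterate of index N + 2 modulo p^(N+2), g because
   u agrees with the preceding iterate modulo p^(N+1) and the norm gains one p. *)
exists u; split=> //; have [g [g0 gT gE]] := norm_descends u0 uT.
suff ug : u = g by rewrite {2}ug.
apply/eqP; rewrite -subr_eq0; apply/eqP/(psep cS) => N.
have h : pdvd N.+2 (g - v N.+2) by apply: norm_contract_descended (uP N.+1) gE (vN _).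
by apply: (@pdvd_leq _ _ _ N.+2); [lia|apply: pdvd_trans (uP _) (pdvd_sym h)].
Qed.

(** * Passage to another law in the class *)

Section Transport.
Variables (F' : series O 2) (FP' : is_fgl F') (u v a' : series O 1).
Hypotheses (uF : is_fgl_hom F F' u) (uT : pdvd 1 (u - T)).
Hypotheses (v0 : v 0%MM = 0) (uv : comp1 u v = T).
Hypotheses (aT' : pdvd 1 (a' - T ^+ q)) (ua : comp1 u a = comp1 a' u).

Let u0 : u 0%MM = 0. Proof. by case: uF. Qed.
Let eu0 : smap e u 0%MM = 0. Proof. by rewrite /smap u0 rmorph0. Qed.
Let ezv0 : smap e v 0%MM = 0. Proof. by rewrite /smap v0 rmorph0. Qed.

(** The series F'(T, u(x)). Its coefficients are values at x of composites with u, so evaluation is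
    only used at the zeros of P and never set up anew for a'. *)
Definition translate x : series L 1 := series1 (fun i => ev x (comp1 (row i F') u)).

Lemma translate_limit x i : x \in s ->
  val_limit w (fun N => \sum_(j < N) e (coef2 F' i j) * ev x u ^+ j)
    (coef1 (translate x) i).
Proof.
move=> /rx rz; have := ev_comp_limit rz (row i F') u0; rewrite coef1_series1.
move=> h N; have [M hM] := h N; exists M => m /hM.
by under eq_bigr do rewrite coef1_row.
Qed.

Lemma trans_hom x : x \in s -> trans x u = comp1 (translate x) (smap e u).
Proof.
move=> /rx rz; rewrite -(evx_comp2 rz _ u0); congr evx.
by have [_ ->] := (is_fgl_homE F F' u).1 uF.
Qed.

(** u(F(T, x)) = F'(u(T), u(x)), so the norm of u is the product of the translates composed with u.
    As u(a) = a'(u), composing with v cancels u on both sides. *)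
Lemma norm_translate :
  norm u = smap e (comp1 u a) <-> \prod_(x <- s) translate x = smap e a'.
Proof.
have -> : norm u = comp1 (\prod_(x <- s) translate x) (smap e u).
  rewrite /norm big_seq; under eq_bigr => x xs do rewrite trans_hom //.
  rewrite -big_seq; elim: (s) => [|x t IH]; first by rewrite !big_nil comp1_1.
  by rewrite !big_cons comp1M // IH.
rewrite ua smap_comp1; split=> [/(congr1 (fun f => comp1 f (smap e v)))|-> //].
by rewrite !comp1A // -smap_comp1 uv smap_var !comp1_id.
Qed.

Lemma not_pdvd1 : ~ pdvd 1 (1 : O).
Proof.
move=> /pdvd_val; rewrite rmorph1 /val_ge oner_eq0 valuation1 /=.
by rewrite ler10.
Qed.

(** [enum_Lambda] admits any distinguished P' with a' = P' h, h a unit. If its degree d were not q,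
    the coefficient of T^d in a' would be both h(0) and 0 modulo p, which a unit h forbids. *)
Lemma distinguished_size (P' : {poly O}) (h h' : series O 1) :
  P' \is monic -> (forall i, (i < (size P').-1)%N -> pdvd 1 P'`_i) ->
  a' = pser P' * h -> h * h' = 1 -> size P' = q.+1.
Proof.
move=> mP' pP' aE hh; set d := (size P').-1.
have dE : size P' = d.+1 by rewrite prednK // size_poly_gt0 monic_neq0.
rewrite dE; congr S; apply/eqP/negPn/negP => dq.
have hd : pdvd 1 (coef1 a' d - coef1 h 0).
  rewrite aE coef1M big_ord_recr /= subnn coef1_pser.
  have -> : P'`_d = 1 by have := monicP mP'; rewrite lead_coefE.
  rewrite mul1r addrK; apply: pdvd_sum => i _; rewrite coef1_pser; apply: pdvdMr.
  exact/pP'.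
have ad : pdvd 1 (coef1 a' d).
  have := (pdvd_seriesP p 1 _).1 aT' [multinom d | _ < 1].
  by rewrite sB -!/(coef1 _ _) coef1Xn (negPf dq) subr0.
have h0 : pdvd 1 (coef1 h 0).
  by rewrite -[coef1 h 0](subKr (coef1 a' d)); apply: pdvdB.
apply: not_pdvd1; have -> : 1 = h 0%MM * h' 0%MM by rewrite -sM0 hh s1 eqxx.
by apply: pdvdMr; rewrite -coef1_0.
Qed.

(** a'(u(x)) = u(a(x)) = 0 and h is a unit, so each u(x) is a root of P'. These are q distinct roots
    of a polynomial of degree q. *)
Lemma transport_roots (P' : {poly O}) (h h' : series O 1) :
  P' \is monic -> (forall i, (i < (size P').-1)%N -> pdvd 1 P'`_i) ->
  a' = pser P' * h -> h * h' = 1 ->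
  uniq [seq ev x u | x <- s] /\
  forall y, (y \in [seq ev x u | x <- s]) = root (map_poly e P') y.
Proof.
move=> mP' pP' aE hh; have sP' := distinguished_size mP' pP' aE hh.
have us' : uniq [seq ev x u | x <- s].
  by rewrite map_inj_in_uniq // => x y xs ys; apply: ev_inj.
split=> // y.
have rs' : all (root (map_poly e P')) [seq ev x u | x <- s].
  apply/allP => _ /mapP[x /rx rz ->]; rewrite rootE.
  have -> : (map_poly e P').[ev x u] = ev x (comp1 (pser P') u).
    rewrite -{2}[P']coefK poly_def rmorph_sum comp1_sum // (ev_sum rz).
    rewrite (horner_coef_wide _ (size_poly _ _ : (size (map_poly e P') <= size P')%N)).
    apply: eq_bigr => i _.
    rewrite -mul_polyC rmorphM /= pserC rmorphXn /= pserX comp1M // comp1_const //.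
    by rewrite comp1Xn // comp1_sT // (evM rz) (ev_const rz) (evXn rz) coef_map.
  have : ev x (comp1 u a) = 0.
    rewrite (ev_comp_split rz 1 _ a0) big_ord1 coef1_0 u0 rmorph0 mul0r add0r expr1.
    by rewrite (ev_a rz) mul0r.
  rewrite ua aE comp1M // (evM rz) => /eqP; rewrite mulf_eq0 => /orP[//|].
  have hu : comp1 h u * comp1 h' u = 1 by rewrite -comp1M // hh comp1_1.
  by rewrite (negPf (ev_unit_neq0 rz hu)).
have lP : e (lead_coef P') != 0 by rewrite (monicP mP') rmorph1 oner_neq0.
have szP : size (map_poly e P') = (size [seq ev x u | x <- s]).+1.
  by rewrite size_map_poly_id0 // sP' size_map ss.
rewrite (all_roots_prod_XsubC szP rs') ?uniq_rootsE // rootZ ?root_prod_XsubC //.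
by rewrite lead_coef_eq0 -size_poly_eq0 szP.
Qed.

End Transport.
End Norm.
End Evaluation.

(** * The ring of integers of an unramified extension *)

Section UnramifiedIntegers.
Variables (p n : nat) (p_prime : prime p).
Variables (Qp : fieldType) (vp : valuation Qp) (QpP : is_Qp p vp).
Variables (K : fieldExtType Qp) (vK : valuation K).
Hypotheses (vKP : val_extends (GRing.in_alg K) vp vK) (unrK : unramified vp vK).
Local Notation O := (val_ring vK).

Lemma pchar_Qp_neq0 m : (0 < m)%N -> m%:R != 0 :> Qp.
Proof.
have [c0 _ _ _] := QpP; move=> m0; have /pcharf0P -> := c0; by rewrite -lt0n.
Qed.

Lemma intr_Qp_neq0 (z : int) : z != 0 -> z%:~R != 0 :> Qp.
Proof.
case: z => m z0; first by apply: pchar_Qp_neq0; rewrite lt0n.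
by rewrite NegzE mulrNz oppr_eq0; apply: pchar_Qp_neq0.
Qed.

Lemma ratr_neq0 (r : rat) : r != 0 -> ratr r != 0 :> Qp.
Proof.
move=> r0; rewrite /ratr mulf_neq0 ?invr_neq0 ?intr_Qp_neq0 ?denq_neq0 //.
by rewrite numq_eq0.
Qed.

Lemma val_p_Qp : vp p%:R = 1.
Proof.
have [_ h _ _] := QpP; have := h (Posz p)%:~R; rewrite ratr_int [p%:R]pmulrn => -> //.
  by rewrite /padic_val numq_int denq_int /= (logn_prime _ p_prime) eqxx logn1 subr0.
by rewrite intr_eq0 eqz_nat -lt0n prime_gt0.
Qed.

Lemma p_neq0_Qp : p%:R != 0 :> Qp.
Proof. by rewrite pchar_Qp_neq0 ?prime_gt0. Qed.

Lemma p_neq0_K : p%:R != 0 :> K.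
Proof. by rewrite -(rmorph_nat (GRing.in_alg K)) fmorph_eq0 p_neq0_Qp. Qed.

Lemma val_p : vK p%:R = 1.
Proof. by rewrite -(rmorph_nat (GRing.in_alg K)) vKP ?p_neq0_Qp ?val_p_Qp. Qed.

(** Density gives a rational r with v(x - r) > v(x). Then v(x) = v(r) by the ultrametric inequality,
    and rationals have integral p-adic valuation. *)
Lemma valuation_int_Qp x : x != 0 -> exists z : int, vp x = z%:~R.
Proof.
move=> x0; have [_ hv hd _] := QpP.
have [r hr] := hd x (Num.bound `|vp x|).
have vx : vp x < (Num.bound `|vp x|)%:R.
  by apply: le_lt_trans (ler_norm _) _; apply: archi_boundP.
have xr : vp x = vp (ratr r) /\ r != 0.
  have [r0|r0] := eqVneq r 0.
    by move: hr; rewrite r0 /ratr [numq 0](_ : _ = 0) // mul0r subr0 /val_ge (negPf x0) leNgt vx.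
  split=> //; have rr0 := ratr_neq0 r0; move: hr; set y := ratr r in rr0 * => hr.
  have [xy|xy] := eqVneq (x - y) 0; first by rewrite (subr0_eq xy).
  have hlt : vp x < vp (x - y).
    by move: hr; rewrite /val_ge (negPf xy) /=; apply: lt_le_trans.
  have yx0 : - (x - y) != 0 by rewrite oppr_eq0.
  have E : y = x + - (x - y) by ring.
  have E' : x = y + (x - y) by ring.
  apply/eqP; rewrite eq_le; apply/andP; split.
    have := valuationD vp x0 yx0; rewrite -E => /(_ rr0).
    by rewrite valuationN // minElt hlt.
  have := valuationD vp rr0 xy; rewrite -E' => /(_ x0).
  rewrite minElt; case: ltP => // _ h; by move: hlt; rewrite ltNge h.
case: xr => -> r0; rewrite hv // /padic_val.
by exists ((logn p `|numq r|)%:Z - (logn p `|denq r|)%:Z); rewrite rmorphB.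
Qed.

Lemma valuation_int x : x != 0 -> exists z : int, vK x = z%:~R.
Proof. by move=> /unrK[y y0 ->]; apply: valuation_int_Qp. Qed.

Lemma val_gtS N x : val_gt vK N%:R x -> val_ge vK N.+1%:R x.
Proof.
rewrite /val_gt /val_ge; have [//|x0] := eqVneq x 0; rewrite /=.
have [z ->] := valuation_int x0; rewrite -![_%:R]/(_%:Z%:~R) ltr_int ler_int.
by move=> h; lia.
Qed.

Lemma val_ring_intro (x : K) : val_ge vK 0 x -> exists y : O, \val y = x.
Proof. by move=> h; exists (@ValRing _ vK x h). Qed.

Lemma val_ring_int (x : O) : val_ge vK 0 (\val x).
Proof. by case: x. Qed.

Lemma val_ge_p N x : val_ge vK 0 x -> val_ge vK N%:R (p%:R ^+ N * x).
Proof.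
move=> hx; rewrite -[N%:R]addr0; apply: val_geM => //.
by rewrite /val_ge valuationX ?p_neq0_K // val_p mulr1 lexx orbT.
Qed.

Lemma pdvdE N (x : O) : pdvd p N x <-> val_ge vK N%:R (\val x).
Proof.
split=> [[y ->]|hx].
  rewrite rmorphM rmorphXn rmorph_nat; apply: val_ge_p; exact: val_ring_int.
have pN0 : p%:R ^+ N != 0 :> K by rewrite expf_neq0 ?p_neq0_K.
have [y yE] : exists y : O, \val y = \val x / p%:R ^+ N.
  apply: val_ring_intro; move: hx; rewrite /val_ge mulf_eq0 invr_eq0 (negPf pN0) orbF.
  have [//|x0 /=] := eqVneq (\val x) 0.
  have := valuationM vK (mulf_neq0 x0 (invr_neq0 pN0)) pN0.
  rewrite divfK // valuationX ?p_neq0_K // val_p mulr1 => ->.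
  by rewrite lerDr.
by exists y; apply: val_inj; rewrite rmorphM rmorphXn rmorph_nat /= yE mulrCA divff // mulr1.
Qed.

Lemma pdvd_gt N (x : O) : val_gt vK N%:R (\val x) -> pdvd p N.+1 x.
Proof. by move=> /val_gtS /pdvdE. Qed.

Lemma val_ge_alg r (x : Qp) : val_ge vK r (x%:A : K) = val_ge vp r x.
Proof.
rewrite /val_ge -/(GRing.in_alg K x) fmorph_eq0; have [//|x0] := eqVneq x 0.
by rewrite vKP.
Qed.

Variables (k : finFieldType) (red : {rmorphism O -> k}) (redP : is_reduction red).

Lemma red_eq0 x : red x = 0 -> pdvd p 1 x.
Proof. by move=> /eqP; rewrite redP.2 => /(@pdvd_gt 0). Qed.

Lemma red_pdvd x : pdvd p 1 x -> red x = 0.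
Proof. by move/pdvdE/(val_ge_gt ltr01) => h; apply/eqP; rewrite redP.2. Qed.

(** The sequence c will mark the places where one given digit occurs, so that the sums stay in [Qp],
    the field whose completeness is given. *)
Lemma padic_digit_sum (c : nat -> bool) : exists l : Qp,
  forall N, val_ge vp N%:R (l - \sum_(j < N) p%:R ^+ j * (c j)%:R).
Proof.
have [_ _ _ cpl] := QpP; pose A N : Qp := \sum_(j < N) p%:R ^+ j * (c j)%:R.
have AMN N M : (N <= M)%N -> val_ge vp N%:R (A M - A N).
  move=> NM; rewrite /A -(subnKC NM) big_split_ord /= addrAC subrr add0r.
  apply: val_ge_sum => j _; rewrite exprD -mulrA -[N%:R]addr0; apply: val_geM.
    by rewrite /val_ge valuationX ?p_neq0_Qp // val_p_Qp mulr1 lexx orbT.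
  apply: val_geM0; last by case: (c _); rewrite ?val_ge0 ?val_ge1.
  by apply: val_geX0; rewrite /val_ge val_p_Qp ler01 orbT.
have [l lP] : exists l, val_limit vp A l.
  apply: cpl => N; exists N => i j Ni Nj.
  have -> : A i - A j = (A i - A N) - (A j - A N) by ring.
  by apply: val_geB; apply: AMN.
exists l => N; have [M hM] := lP N; rewrite -/(A N).
have -> : l - A N = (A (M + N)%N - A N) - (A (M + N)%N - l) by ring.
by apply: val_geB; [apply: AMN; rewrite leq_addl|apply: hM; rewrite leq_addr].
Qed.

(* Writing the terms of a Cauchy sequence with digits in a set of representatives
   of the finite field [k] and grouping equal digits, the limit is a finite
   combination of limits in [Qp]. *)
Lemma val_ring_complete : padic_complete p O.
Proof.
have p0 : p%:R != 0 :> K := p_neq0_K.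
split=> [x px|x hx|s hs].
- apply: val_inj; apply/eqP; rewrite rmorph0; have := congr1 val px.
  by rewrite rmorphM rmorph_nat rmorph0 => /eqP; rewrite mulf_eq0 (negPf p0).
- apply: val_inj; rewrite rmorph0; apply: (@val_ge_sep _ vK 1) => // N.
  by rewrite mulr1; apply/pdvdE.
have [tau tauP] := choice redP.1.
have /choice[nxt nxtP] : forall y : O, exists y', y = tau (red y) + p%:R * y'.
  move=> y; have [y' hy] : pdvd p 1 (y - tau (red y)).
    by apply: red_eq0; rewrite rmorphB tauP subrr.
  by exists y'; rewrite -[p%:R]expr1 -hy subrKC.
have [a aP] := choice hs.
(* [y N] is what remains after N digits: each step adds the increment [a j], then splits off the
   digit [c j]. *)
pose y N := nat_rect (fun=> O) (s 0%N) (fun j z => nxt (z + a j)) N.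
pose c j := red (y j + a j).
have sE N : s N = \sum_(j < N) p%:R ^+ j * tau (c j) + p%:R ^+ N * y N.
  elim: N => [|N IH]; first by rewrite big_ord0 add0r mul1r.
  rewrite -[s N.+1](subrK (s N)) aP addrC IH -addrA -mulrDr {1}[y N + a N]nxtP.
  by rewrite big_ord_recr /= -addrA -/(c N) mulrDr mulrA -exprSr.
have /choice[l lP] : forall x : k, exists l : Qp,
    forall N, val_ge vp N%:R (l - \sum_(j < N) p%:R ^+ j * (c j == x)%:R).
  by move=> x; apply: (padic_digit_sum (fun j => c j == x)).
pose z : K := \sum_(x : k) (l x)%:A * \val (tau x).
have [zO zE] : exists zO : O, \val zO = z.
  apply: val_ring_intro; apply: val_ge_sum => x _; apply: val_geM0; last exact: val_ring_int.
  by rewrite val_ge_alg; have := lP x 0%N; rewrite big_ord0 subr0.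
exists zO => N; rewrite sE opprD addrA; apply: pdvdB; last exact: pdvd_p.
apply/pdvdE; rewrite rmorphB /= zE.
have -> : \val (\sum_(j < N) p%:R ^+ j * tau (c j)) =
    \sum_(x : k) (\sum_(j < N) p%:R ^+ j * (c j == x)%:R : Qp)%:A * \val (tau x).
  have AE x (t : K) : (\sum_(j < N) p%:R ^+ j * (c j == x)%:R : Qp)%:A * t =
      \sum_(j < N) p%:R ^+ j * (c j == x)%:R * t.
    rewrite -[_%:A]/(GRing.in_alg K _) (rmorph_sum (GRing.in_alg K)) mulr_suml.
    by apply: eq_bigr => j _; rewrite rmorphM rmorphXn !rmorph_nat.
  under [RHS]eq_bigr do rewrite AE.
  rewrite exchange_big rmorph_sum; apply: eq_bigr => j _.
  rewrite rmorphM rmorphXn rmorph_nat (bigD1 (c j)) //= eqxx mulr1 big1 ?addr0 // => x.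
  by rewrite eq_sym => /negPf->; rewrite mulr0 mul0r.
rewrite -sumrB; apply: val_ge_sum => x _; rewrite -mulrBl -[N%:R]addr0.
apply: val_geM; last exact: val_ring_int.
by rewrite -!/(GRing.in_alg K _) -rmorphB val_ge_alg.
Qed.

End UnramifiedIntegers.

(** * Lifts of the Honda formal group law *)

Section HondaCongruence.
Variables (p n q : nat) (p_gt1 : (1 < p)%N) (n0 : (0 < n)%N) (qE : q = (p ^ n)%N).
Variables (O : comNzRingType) (K : fieldType) (j : {rmorphism O -> K}).
Hypotheses (jinj : injective j) (p0 : p%:R != 0 :> K).
Local Notation l := (honda_log K p q).
Local Notation pdvd := (pdvd p).
Local Notation T := (sT O).

Let q1 : (1 < q)%N. Proof. by rewrite qE -[1%N](expn0 p) ltn_exp2l. Qed.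
Let q0 : (0 < q)%N. Proof. exact: ltnW q1. Qed.

Lemma coef_honda_log_pow i : coef1 l (q ^ i) = (p%:R ^+ i)^-1.
Proof. by rewrite coef1_series1 /= trunc_expnK // eqxx. Qed.

Lemma coef_honda_log m : coef1 l m = 0 \/ exists i, m = (q ^ i)%N.
Proof.
rewrite coef1_series1 /=; case: eqP => [->|_]; last by left.
by right; exists (trunc_log q m).
Qed.

(** Consecutive coefficients p^-(i+1) and p^-i, in degrees q^(i+1) and q^i, differ by a factor p. *)
Lemma honda_log_equation :
  p%:R * l = p%:R * sT K + comp1 l (sT K ^+ q).
Proof.
apply: s1P => m; rewrite coef1D /coef1 !natsM -!/(coef1 _ m) coef1_comp1Tq // coef1X.
have pow i : coef1 l (q ^ i * q) * p%:R = coef1 l (q ^ i).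
  rewrite -expnSr !coef_honda_log_pow exprS invfM mulrC mulrA divff // mul1r //.
have [[m' ->]|nm] := EM (exists i, m = (q ^ i)%N).
  case: m' => [|i].
    rewrite expn0 eqxx mulr1 -(expn0 q) coef_honda_log_pow expr0 invr1 mulr1 expn0.
    by rewrite dvdn1 gtn_eqF // addr0.
  rewrite expnSr gtn_eqF; last by rewrite -expnSr -[1%N](expn0 q) ltn_exp2l.
  by rewrite mulr0 add0r dvdn_mull // mulnK // mulrC pow.
have [->|//] := coef_honda_log m; rewrite mulr0.
rewrite (_ : m == 1%N = false) ?mulr0 ?add0r; last first.
  by apply/eqP => m1; case: nm; exists 0%N.
case: ifP => // /dvdnP[r mE]; rewrite mE mulnK //.
have [->//|[i rE]] := coef_honda_log r.
by case: nm; exists i.+1; rewrite mE rE expnSr.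
Qed.

Lemma honda_log_term (B C : series O 1) d m : (1 < m)%N ->
  (forall i, m = (q ^ i)%N -> pdvd i.+1 (coef1 (B - C) d)) ->
  exists y, coef1 l m * j (coef1 (B - C) d) = j (p%:R * y).
Proof.
move=> m1 h; have [->|[i mE]] := coef_honda_log m.
  by exists 0; rewrite mul0r mulr0 rmorph0.
have [y yE] := h i mE; exists y.
rewrite mE coef_honda_log_pow yE exprSr !rmorphM rmorphXn rmorph_nat.
by rewrite -mulrA mulKf ?expf_neq0 // mulrC.
Qed.

(* Since [p * l = p T + l(T^q)], this compares the coefficients of [l(A)] and
   [l(T^q)] degree by degree; an x = y mod p gives x^(q^i) = y^(q^i) mod p^(i+1), which
   absorbs the denominator of the coefficient of [l] in degree [q^i]. *)
Lemma honda_congruence (A : series O 1) : A 0%MM = 0 ->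
  comp1 l (smap j A) = p%:R * l -> pdvd 1 (A - sT O ^+ q).
Proof.
move=> A0 lA.
have Tq0 : (T ^+ q) 0%MM = 0 by rewrite sX0 sT0 expr0n gtn_eqF.
have jA0 : smap j A 0%MM = 0 by rewrite /smap A0 rmorph0.
have jT0 : smap j (T ^+ q) 0%MM = 0 by rewrite /smap Tq0 rmorph0.
suff h d : pdvd 1 (coef1 (A - T ^+ q) d).
  by apply/pdvd_seriesP => k; rewrite -(mnm1_ord0 k); apply: h.
elim/ltn_ind: d => d IH; case: d IH => [|d] IH.
  by rewrite coef1_0 sB A0 Tq0 subr0; apply: pdvd0.
(* A' keeps only the part of A - T^q of degree at most d, so A' = T^q mod p by induction. *)
pose A' := A - T ^+ d.+1 * sshift d.+1 (A - T ^+ q).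
have A'T : pdvd 1 (A' - T ^+ q).
  have -> : A' - T ^+ q = \sum_(i < d.+1) sconst (coef1 (A - T ^+ q) i) * T ^+ i.
    rewrite /A' addrAC; apply/eqP; rewrite subr_eq; apply/eqP; exact: s1_split.
  apply: pdvd_sum => i _; apply: pdvdMr; apply: pdvd_rmorph; exact: IH.
have A'0 : A' 0%MM = 0 by rewrite /A' sB A0 sM0 sX0 sT0 expr0n /= mul0r subr0.
(* A and A' have no constant term and first differ in degree d + 1, so their powers of exponent at
   least 2 agree there. *)
have AA' m : (1 < m)%N -> coef1 (A ^+ m) d.+1 = coef1 (A' ^+ m) d.+1.
  move=> m1; apply/eqP; rewrite -subr_eq0 -coef1B subrXX.
  have -> : A - A' = T ^+ d.+1 * sshift d.+1 (A - T ^+ q) by rewrite /A' subKr.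
  rewrite -mulrA coef1XnM ltnn subnn coef1_0 sM0 s_sum big1 ?mulr0 // => i _.
  rewrite sM0 !sX0 A0 A'0 -exprD expr0n.
  by have := ltn_ord i; case: eqP => //; lia.
have term m : (1 < m)%N -> exists y,
    coef1 l m * j (coef1 (A ^+ m - (T ^+ q) ^+ m) d.+1) = j (p%:R * y).
  move=> m1; apply: honda_log_term => // i mE.
  rewrite coef1B AA' // -coef1B; apply: (pdvd_seriesP p i.+1 _).1.
  (* Here q^i = p^(n i), and n i + 1 >= i + 1 because n > 0. *)
  rewrite mE qE -expnM; have := pdvd_subXpn (n * i) A'T.
  rewrite qE; apply: pdvd_leq; rewrite ltnS leq_pmull //.
have [y yP] : exists y : nat -> O, forall m, (1 < m)%N ->
    coef1 l m * j (coef1 (A ^+ m - (T ^+ q) ^+ m) d.+1) = j (p%:R * y m).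
  have /choice[y yP] : forall m, exists y, (1 < m)%N ->
      coef1 l m * j (coef1 (A ^+ m - (T ^+ q) ^+ m) d.+1) = j (p%:R * y).
    move=> m; case: (ltnP 1 m) => [/term[y ->]|_]; first by exists y.
    by exists 0.
  by exists y.
have E : coef1 (comp1 l (smap j A) - comp1 l (smap j (T ^+ q))) d.+1
    = j (p%:R * (d == 0%N)%:R).
  have -> : smap j (T ^+ q) = sT K ^+ q by rewrite rmorphXn /= smap_var.
  rewrite lA honda_log_equation addrK /coef1 natsM -/(coef1 _ _) coef1X eqSS.
  by rewrite rmorphM !rmorph_nat.
move: E; rewrite coef1B {1 2}/coef1 (@comp1E _ _ _ jA0 _ _ d.+2) ?mdeg_mnm1 //.
rewrite (@comp1E _ _ _ jT0 _ _ d.+2) ?mdeg_mnm1 // -sumrB.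
rewrite (eq_bigr (fun i : 'I_d.+2 => coef1 l i *
  j (coef1 (A ^+ i - (T ^+ q) ^+ i) d.+1))); last first.
  by move=> i _; rewrite -mulrBr -!rmorphXn /= coef1B rmorphB.
(* Index 0 contributes nothing, index 1 contributes the coefficient sought, and the others lie in p
   O by [term]. *)
rewrite !big_ord_recl /= subrr coef1z rmorph0 mulr0 add0r.
have -> : coef1 l (bump 0 0) = 1.
  by have := coef_honda_log_pow 0; rewrite expn0 expr0 invr1.
rewrite mul1r (eq_bigr (fun i : 'I_d => j (p%:R * y i.+2))) => [|i _]; last exact: yP.
rewrite -rmorph_sum -mulr_sumr -rmorphD => /jinj /eqP.
rewrite eq_sym -subr_eq -mulrBr => /eqP <-; rewrite -[p%:R]expr1; exact: pdvd_p.
Qed.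

End HondaCongruence.

Lemma smap_fgl_mul (R S : comNzRingType) (f : {rmorphism R -> S}) (F : series R 2) m :
  smap f (fgl_mul F m) = fgl_mul (smap f F) m.
Proof.
elim: m => [|m IH]; first by rewrite !fgl_mul0 rmorph0.
by rewrite !fgl_mulS smap_comp2 smap_var IH.
Qed.

Lemma log_fgl_mul (O : comNzRingType) (K : comNzRingType) (j : {rmorphism O -> K})
    (H : series O 2) (l : series K 1) m : is_fgl H -> l 0%MM = 0 ->
  comp1 l (smap j H) = inX l + inY l ->
  comp1 l (smap j (fgl_mul H m)) = m%:R * l.
Proof.
move=> HP l0 lH; have jz (a : series O 1) : a 0%MM = 0 -> smap j a 0%MM = 0.
  by move=> h; rewrite /smap h rmorph0.
have jH0 : smap j H 0%MM = 0 by rewrite /smap fgl_zconst ?rmorph0.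
elim: m => [|m IH]; first by rewrite fgl_mul0 rmorph0 comp1_z // mul0r.
have jm0 : smap j (fgl_mul H m) 0%MM = 0 by rewrite jz // fgl_mul_zc.
rewrite fgl_mulS smap_comp2 smap_var -comp2_comp1 ?svar0 // lH comp2D ?svar0 //.
by rewrite comp2_inX ?svar0 // comp2_inY ?svar0 // comp1_id IH mulrS mulrDl mul1r.
Qed.

(** * Existence and uniqueness in a star-isomorphism class *)

Section Embedding.
Variables (K : fieldType) (vK : valuation K) (L : closedFieldType) (iota : {rmorphism K -> L}).

Fact emb_is_zmod_morphism : zmod_morphism (@emb K vK L iota).
Proof. by move=> x y; rewrite /emb !rmorphB. Qed.
Fact emb_is_monoid_morphism : monoid_morphism (@emb K vK L iota).
Proof. by split=> [|x y]; rewrite /emb ?rmorph1 ?rmorphM. Qed.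
HB.instance Definition _ := GRing.isZmodMorphism.Build (val_ring vK) L
  (@emb K vK L iota) emb_is_zmod_morphism.
HB.instance Definition _ := GRing.isMonoidMorphism.Build (val_ring vK) L
  (@emb K vK L iota) emb_is_monoid_morphism.
End Embedding.

Lemma is_fgl_iso_inv (R : comNzRingType) (F F' : series R 2) u : is_fgl_iso F F' u ->
  exists v, [/\ v 0%MM = 0, comp1 u v = sT R & comp1 v u = sT R].
Proof.
move=> [_ [v [[v0 _] uv vu]]]; exists v.
by split=> //; rewrite comp1_scomp; [exact: (funext uv)|exact: (funext vu)].
Qed.

Section Main.
Variables (p n : nat) (p_prime : prime p).
Variables (Qp : fieldType) (vp : valuation Qp) (QpP : is_Qp p vp).
Variables (K : fieldExtType Qp) (vK : valuation K).
Hypotheses (vKP : val_extends (GRing.in_alg K) vp vK) (unrK : unramified vp vK).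
Variables (k : finFieldType) (card_k : #|k| = (p ^ n)%N).
Variables (red : {rmorphism val_ring vK -> k}) (redP : is_reduction red).
Variables (L : closedFieldType) (iota : {rmorphism K -> L}).
Variables (w : valuation L) (wP : val_extends iota vK w).
Variables (G : series k 2) (GP : is_honda p n red G).
Local Notation O := (val_ring vK).
Local Notation q := (p ^ n)%N.
Local Notation T := (sT O).
Local Notation pdvd := (pdvd p).
Local Notation e := (emb iota).

Let cO : padic_complete p O := val_ring_complete p_prime QpP vKP unrK redP.
Let red0 := red_eq0 p_prime QpP vKP unrK redP.

Let n0 : (0 < n)%N.
Proof.
by have := finNzRing_gt1 k; rewrite card_k; case: n.
Qed.
Let q0 : (0 < q)%N. Proof. by rewrite expn_gt0 prime_gt0. Qed.

Let q_div : pdvd 1 (q%:R : O).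
Proof. by rewrite natrX; apply: (pdvd_leq n0); exists 1; rewrite mulr1. Qed.

(** For odd p the exponent q + 1 is even; for p = 2 both signs are 1 modulo 2. *)
Let sgn_q : pdvd 1 ((-1) ^+ q.+1 - 1 : O).
Proof.
have [p2|p_odd] := even_prime p_prime; last first.
  by rewrite exprS -signr_odd oddX p_odd orbT expr1 mulrNN mulr1 subrr; apply: pdvd0.
rewrite -signr_odd; case: odd; last by rewrite expr0 subrr; apply: pdvd0.
by exists (-1); rewrite p2 !expr1; ring.
Qed.

Let p0L : p%:R != 0 :> L.
Proof. by rewrite -(rmorph_nat iota) fmorph_eq0 (p_neq0_K p_prime QpP). Qed.
Let wp : w p%:R = 1.
Proof. by rewrite -(rmorph_nat iota) wP ?(p_neq0_K p_prime QpP) // (val_p p_prime QpP vKP). Qed.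

Let val_ge_iota r x : val_ge w r (iota x) = val_ge vK r x.
Proof. by rewrite /val_ge fmorph_eq0; have [//|x0] := eqVneq x 0; rewrite wP. Qed.
Let val_gt_iota r x : val_gt w r (iota x) = val_gt vK r x.
Proof. by rewrite /val_gt fmorph_eq0; have [//|x0] := eqVneq x 0; rewrite wP. Qed.

Let e_int (x : O) : val_ge w 0 (e x).
Proof. by rewrite /emb val_ge_iota; apply: val_ring_int. Qed.
Let e_gt N (x : O) : val_gt w N%:R (e x) -> pdvd N.+1 x.
Proof. by rewrite /emb val_gt_iota; apply: (pdvd_gt p_prime QpP vKP unrK). Qed.

Let red_series m (f g : series O m) : smap red f = smap red g -> pdvd 1 (f - g).
Proof.
move=> h; apply/pdvd_seriesP => i; apply: red0; rewrite sB rmorphB.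
by have := congr1 (fun f => f i) h; rewrite /smap => ->; rewrite subrr.
Qed.
Let series_red m (f g : series O m) : pdvd 1 (f - g) -> smap red f = smap red g.
Proof.
move=> /pdvd_seriesP h; apply/funext => i; apply/eqP; rewrite -subr_eq0 /smap -rmorphB.
by apply/eqP; apply: (red_pdvd p_prime QpP vKP redP); apply: h.
Qed.

Section Lift.
Variables (F : series O 2) (FP : is_lift red G F).
Local Notation alpha := (fgl_mul F p).

(** Modulo p the series [p] depends only on the reduction G, so the congruence is checked on the
    lift H that has the explicit logarithm. *)
Lemma lift_frobenius : pdvd 1 (alpha - T ^+ q).
Proof.
have [H [HP /= lH redH]] := GP; have [fF /funext redF] := FP.
have hH : pdvd 1 (fgl_mul H p - T ^+ q).
  have inj : injective (\val : O -> K) by apply: val_inj.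
  apply: (honda_congruence (prime_gt1 p_prime) n0 erefl inj (p_neq0_K p_prime QpP K)).
    exact: fgl_mul_zc.
  apply: log_fgl_mul => //.
    by rewrite -coef1_0 coef1_series1 /= trunc_log0 expn0.
  by rewrite comp1_scomp /inX /inY !comp1_scomp; apply/funext.
have /red_series hHF : smap red alpha = smap red (fgl_mul H p).
  by rewrite !smap_fgl_mul redF (funext redH).
exact: pdvd_trans hHF hH.
Qed.

Lemma lift_frobenius_series : frobenius_series p q alpha.
Proof.
have [fF _] := FP; split.
- by rewrite coef1_0 fgl_mul_zc.
- exact: coef1_fgl_mul.
move=> i; have := (pdvd_seriesP p 1 _).1 lift_frobenius [multinom i | _ < 1].
by rewrite sB -!/(coef1 _ _) coef1Xn => -[c cE]; exists c; rewrite cE expr1.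
Qed.

Lemma lift_lubin_tate : is_lubin_tate alpha F.
Proof. by have [fF _] := FP; split=> //; apply: fgl_mul_hom. Qed.

Lemma weierstrass_alpha : exists P E h,
  [/\ [/\ P \is monic, size P = q.+1 & forall i, (i < q)%N -> pdvd 1 P`_i],
      pser P = alpha * E, pdvd 1 (E - 1), E * h = 1 & alpha = pser P * h].
Proof.
have [fF _] := FP.
have [P [E [mP sP pP PE E1]]] :=
  weierstrass_preparation cO q0 (fgl_mul_zc p fF) lift_frobenius.
have [h hE] := punit (padic_complete_series 1 cO) E1.
by exists P, E, h; split=> //; rewrite PE -mulrA hE mulr1.
Qed.

Lemma distinguishedP (P : {poly O}) : distinguished P <->
  P \is monic /\ forall i, (i < (size P).-1)%N -> pdvd 1 P`_i.
Proof.
split=> -[mP h]; split=> // i /h.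
  by move=> hi; apply: (@pdvd_gt _ p_prime _ _ QpP _ _ vKP unrK 0).
by move=> /(pdvdE p_prime QpP vKP); apply: val_ge_gt; apply: ltr01.
Qed.

Lemma weierstrass_polyP (a : series O 1) (P : {poly O}) : weierstrass_poly a P <->
  [/\ P \is monic, forall i, (i < (size P).-1)%N -> pdvd 1 P`_i
    & exists h h', a = pser P * h /\ h * h' = 1].
Proof.
split=> [[/distinguishedP[mP hP] [h [h' hh] aE]]|[mP hP [h [h' [aE hh]]]]].
  split=> //; exists h, h'; split; [exact: (funext aE)|exact: (funext hh)].
split; first exact/distinguishedP.
by exists h => [|i]; [exists h'; rewrite -[smul h h']/(h * h') hh|rewrite aE].
Qed.

End Lift.

Section Class.
Variables (F0 : series O 2) (F0P : is_lift red G F0).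
Local Notation a := (fgl_mul F0 p).
Let fF0 : is_fgl F0. Proof. by case: F0P. Qed.
Let aT : pdvd 1 (a - T ^+ q) := lift_frobenius F0P.
Let aF : is_fgl_hom F0 F0 a := fgl_mul_hom p fF0.
Variables (P : {poly O}) (E : series O 1).
Hypotheses (mP : P \is monic) (sP : size P = q.+1).
Hypothesis (pP : forall i, (i < q)%N -> pdvd 1 P`_i).
Hypotheses (PE : pser P = a * E) (E1 : pdvd 1 (E - 1)).
Hypothesis (divP : forall f, exists R Q, f = pser R + a * Q).
Variables (s : seq L) (us : uniq s) (ss : size s = q).
Hypothesis rs : forall x, (x \in s) = root (map_poly e P) x.
Local Notation ev := (ev e divP).

Section Member.
Variables (F' : series O 2) (F'P : is_lift red G F') (u v : series O 1).
Hypotheses (uF : is_fgl_hom F0 F' u) (uT : pdvd 1 (u - T)).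
Hypotheses (v0 : v 0%MM = 0) (uv : comp1 u v = T).
Local Notation a' := (fgl_mul F' p).
Let fF' : is_fgl F'. Proof. by case: F'P. Qed.
Let aT' : pdvd 1 (a' - T ^+ q) := lift_frobenius F'P.
Let ua : comp1 u a = comp1 a' u := fgl_mul_iso p fF0 fF' uF.

(** Limits are unique, so the translates are the algebraic ones, whatever enumeration and family of
    series the product formula supplies. *)
Lemma prod_translates (s' : seq L) (f : L -> series L 1) :
  perm_eq s' [seq ev x u | x <- s] ->
  (forall lam, lam \in s' -> is_translate iota w F' lam (f lam)) ->
  sprod s' f = \prod_(x <- s) translate e divP F' u x.
Proof.
move=> ps hf; rewrite sprodE (perm_big _ ps) /= big_map big_seq [RHS]big_seq.
apply: eq_bigr => x xs; apply: s1P => i.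
have xs' : ev x u \in s' by rewrite (perm_mem ps); apply: map_f.
apply: val_limit_unique (hf _ xs' i) _.
exact: (translate_limit cO p0L wp e_int mP sP pP PE E1 divP rs uF i xs).
Qed.

(** The data of the product formula are forced: the roots of P' are the u(x) by [transport_roots],
    and the translates are limits. What remains is the identity of [norm_translate]. *)
Lemma product_formula_norm :
  product_formula iota w p a' F' <-> norm e divP F0 s u = smap e (comp1 u a).
Proof.
rewrite (norm_translate cO p0L wp e_int mP sP pP PE E1 divP rs uF v0 uv ua).
split=> [[s' [f [[us' [P' /weierstrass_polyP[mP' hP' [h [h' [aE hh]]]] rs']] hf prod]]]|prod].
  have [ut rt] := transport_roots cO p0L wp e_int mP sP pP PE E1 divP q0 aF aT us ss rs
    uF uT aT' ua mP' hP' aE hh.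
  rewrite -(@prod_translates s' f) //; first by apply/esym/funext.
  by apply: uniq_perm => // x; rewrite rs' rt.
have [P' [E' [h [[mP' sP' pP'] PE' _ hh aE]]]] := weierstrass_alpha F'P.
have pP'' i : (i < (size P').-1)%N -> pdvd 1 P'`_i by rewrite sP'; apply: pP'.
have hE : h * E' = 1 by rewrite mulrC.
have [ut rt] := transport_roots cO p0L wp e_int mP sP pP PE E1 divP q0 aF aT us ss rs
    uF uT aT' ua mP' pP'' aE hE.
(* The translates are indexed by x, but the formula wants a function of the torsion point u(x), with
   any value elsewhere. *)
have /choice[f hf] : forall y, exists g, y \in [seq ev x u | x <- s] ->
    is_translate iota w F' y g.
  move=> y; case: (boolP (y \in _)) => [/mapP[x xs ->]|_]; last by exists 0.
  exists (translate e divP F' u x) => _ i.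
  exact: (translate_limit cO p0L wp e_int mP sP pP PE E1 divP rs uF i xs).
exists [seq ev x u | x <- s], f; split=> //.
  by split=> //; exists P' => //; apply/weierstrass_polyP; split=> //; exists h, E'.
by move=> i; rewrite prod_translates // prod.
Qed.

End Member.
End Class.

Lemma class_representative (F0 : series O 2) (F0P : is_lift red G F0) :
  exists (F : series O 2) (alpha : series O 1),
    [/\ is_lift red G F /\ star_isomorphic red F0 F,
        frobenius_series p q alpha,
        is_lubin_tate alpha F,
        product_formula iota w p alpha F
      & forall F' : series O 2,
          is_lift red G F' -> star_isomorphic red F0 F' ->
          product_formula iota w p (fgl_mul F' p) F' -> F' =1 F].
Proof.
have [fF0 redF0] := F0P; have aT := lift_frobenius F0P.
have a1 := coef1_fgl_mul p fF0; have aF := fgl_mul_hom p fF0.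
have [P [E [h [[mP sP pP] PE E1 Eh aPh]]]] := weierstrass_alpha F0P.
have divP := weierstrass_division cO q0 (fgl_mul_zc p fF0) aT.
have [s sE] := closed_field_poly_normal (map_poly e P).
have lP : e (lead_coef P) != 0 by rewrite (monicP mP) rmorph1 oner_neq0.
move: sE; rewrite lead_coef_map_id0 ?rmorph0 // (monicP mP) rmorph1 scale1r => sE.
have [us ss rs] := roots_enum cO p0L wp e_int mP sP pP PE E1 divP fF0 aF a1 sE.
have [u [u0 uT uN]] := norm_fixed_exists cO p0L wp e_int mP sP pP PE E1 divP
  e_gt q0 q_div sgn_q fF0 aF aT us ss rs.
have [v [v0 vT uv vu]] := comp1_inverse cO u0 uT.
have TT (f : series O 1) : pdvd 1 (f - T) -> smap red f = sT k.
  by move=> /series_red ->; rewrite smap_var.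
have FP : is_lift red G (fgl_conj u v F0).
  split; first exact: fgl_conjP.
  move=> i; rewrite /fgl_conj smap_comp1 smap_comp2 !smap_comp1 !smap_var !TT //.
  have rF0 : smap red F0 0%MM = 0 by rewrite /smap fgl_zconst ?rmorph0.
  rewrite [comp1 (sT k) (svar _ _)]comp1_sT ?svar0 // [comp1 (sT k) (svar _ _)]comp1_sT ?svar0 //.
  by rewrite comp2_id comp1_sT.
have uF := fgl_conj_hom fF0 u0 v0 vu.
exists (fgl_conj u v F0), (fgl_mul (fgl_conj u v F0) p); split.
- split=> //; exists u; split; first exact: fgl_conj_iso.
  by move=> i; rewrite TT.
- exact: lift_frobenius_series.
- exact: lift_lubin_tate.
- by apply/(product_formula_norm F0P mP sP pP PE E1 divP us ss rs FP uF uT v0 uv).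
move=> F' F'P [u' [u'iso u'red]] pf.
have u'T : pdvd 1 (u' - T) by apply: red_series; rewrite smap_var; apply/funext.
have [v' [v'0 uv' _]] := is_fgl_iso_inv u'iso.
have [u'F _] := u'iso.
have u'N := (product_formula_norm F0P mP sP pP PE E1 divP us ss rs F'P u'F u'T v'0 uv').1 pf.
(* The star-isomorphism from [F0] is thus the same series for every law with the product formula,
   and it determines the law. *)
have uu' : u' = u.
  exact: (norm_fixed_unique cO p0L wp e_int mP sP pP PE E1
    e_gt q0 q_div fF0 aF aT ss rs u'T uT u'N uN).
by rewrite uu' in u'F; rewrite (fgl_iso_conj fF0 F'P.1 u'F v0 uv).
Qed.

End Main.

Theorem theorem3p2 (p n : nat) (p_prime : prime p)
    (Qp : fieldType) (vp : valuation Qp) (QpP : is_Qp p vp)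
    (K : fieldExtType Qp) (dimK : \dim {:K} = n)
    (vK : valuation K) (vKP : val_extends (GRing.in_alg K) vp vK)
    (unrK : unramified vp vK)
    (k : finFieldType) (card_k : #|k| = (p ^ n)%N)
    (red : {rmorphism val_ring vK -> k}) (redP : is_reduction red)
    (Kbar : closedFieldType) (iota : {rmorphism K -> Kbar})
    (KbarP : is_algebraic_closure iota)
    (w : valuation Kbar) (wP : val_extends iota vK w)
    (G : series k 2) (GP : is_honda p n red G)
    (F0 : series (val_ring vK) 2) (F0P : is_lift red G F0) :
  exists (F : series (val_ring vK) 2) (alpha : series (val_ring vK) 1),
    [/\ is_lift red G F /\ star_isomorphic red F0 F,
        frobenius_series p (p ^ n) alpha,
        is_lubin_tate alpha F,
        product_formula iota w p alpha F
      & forall F' : series (val_ring vK) 2,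
          is_lift red G F' -> star_isomorphic red F0 F' ->
          product_formula iota w p (fgl_mul F' p) F' -> F' =1 F].
Proof.
exact: (class_representative p_prime QpP vKP unrK card_k redP wP GP F0P).
Qed.
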